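(* Let $V:\mathbb{R}^N\to\mathbb{R}$ be measurable and suppose there exist constants $C_V>0$ and $\alpha\in\mathbb{R}$ such that $$\frac{C_V}{(1+|z|)^\alpha}\le V(z)\quad\text{for a.e. } z\in\mathbb{R}^N.$$ Let $Q:\mathbb{R}^N\to\mathbb{R}$ be measurable and suppose there exist constants $C_Q>0$ and $\beta\in\mathbb{R}$ such that $$0<Q(z)\le \frac{C_Q}{(1+|z|)^\beta}\quad\text{for a.e. } z\in\mathbb{R}^N.$$ Then the embedding $E_V^\gamma\hookrightarrow L^p_Q(\mathbb{R}^N)$ is continuous if one of the following conditions holds: (i) $\alpha\le N<\beta$ and $2\le p\le 2_\gamma^*$; (ii) $N\le\alpha<\beta$ and $2\le p\le\overline{p}$, where $$\overline{p}:=\min\left\{\frac{2(\beta-N)}{\alpha-N},\,2_\gamma^*\right\};$$ (iii) $\alpha\le N$, $\underline{\beta}\le\beta<N$, and $\underline{p}\le p\le 2_\gamma^*$, where $$\underline{\beta}:=\max\left\{N-\frac{2_\gamma^*(N-2)}{2},\,N-\frac{2_\gamma^*(N-\alpha)}{2}\right\},\qquad \underline{p}:=\max\left\{2,\frac{2(N-\beta)}{N-2},\frac{2(N-\beta)}{N-\alpha}\right\}.$$ Furthermore, the embedding $E_V^\gamma\hookrightarrow L^p_Q(\mathbb{R}^N)$ is compact whenever one of the following holds: (i') $\alpha\le N<\beta$ and $2\le p<2_\gamma^*$; (ii') $N<\alpha\le\beta$ and $2\le p<\overline{p}$, with $\overline{p}$ as in (ii).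
   Context: Let $\gamma>0$, let $m,k\ge1$ be integers with $N=m+k\ge3$, and write $z=(x,y)\in\mathbb{R}^m\times\mathbb{R}^k=\mathbb{R}^N$; $|z|$ is the Euclidean norm. Put $\nabla_\gamma u=(\nabla_x u,\,|x|^\gamma\nabla_y u)$, $N_\gamma=m+(\gamma+1)k$ and $2_\gamma^*=\frac{2N_\gamma}{N_\gamma-2}$. $E_V^\gamma$ is the completion of $C_0^\infty(\mathbb{R}^N)$ with respect to the norm $\|u\|_{E_V^\gamma}=\left(\int_{\mathbb{R}^N}\left[|\nabla_\gamma u|^2+V(z)u^2\right]dz\right)^{1/2}$; it is a Hilbert space. For $1\le p<\infty$, $L^p_Q(\mathbb{R}^N)$ is the space of measurable $u:\mathbb{R}^N\to\mathbb{R}$ with $\int_{\mathbb{R}^N}Q(z)|u|^p\,dz<\infty$, with norm $\|u\|_{L^p_Q(\mathbb{R}^N)}=\left(\int_{\mathbb{R}^N}Q(z)|u|^p\,dz\right)^{1/p}$. Convention: a quotient of a positive number by $0$ (which occurs when $\alpha=N$) is read as $+\infty$. *)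

(* Defs.v *)
From HB Require Import structures.
From mathcomp Require Import all_boot all_order all_algebra.
From mathcomp Require Import all_classical all_reals all_analysis.
From mathcomp Require Import measurable_realfun.

Set Implicit Arguments.
Unset Strict Implicit.
Unset Printing Implicit Defensive.

Import Order.TTheory GRing.Theory Num.Theory.
Import numFieldNormedType.Exports.

Local Open Scope classical_set_scope.
Local Open Scope ring_scope.

Definition rV_display : measure_display.
Proof. exact: default_measure_display. Qed.

Section measurable_rV.
Variables (R : realType) (n : nat).

Let coord (i : 'I_n) (v : 'rV[R]_n) : measurableTypeR R := v 0 i.

Let rV_set0 : g_sigma_preimage coord set0.
Proof. exact: sigma_algebra0. Qed.

Let rV_setC A : g_sigma_preimage coord A -> g_sigma_preimage coord (~` A).
Proof. exact: sigma_algebraC. Qed.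

Let rV_bigcup (F : (set 'rV[R]_n)^nat) :
  (forall i, g_sigma_preimage coord (F i)) ->
  g_sigma_preimage coord (\bigcup_i F i).
Proof. exact: sigma_algebra_bigcup. Qed.

HB.instance Definition _ := @isMeasurable.Build rV_display 'rV[R]_n
  (g_sigma_preimage coord) rV_set0 rV_setC rV_bigcup.

End measurable_rV.

Section measurable_rV_lemmas.
Context (R : realType) d (T : measurableType d).

Lemma measurable_coord n (i : 'I_n) :
  measurable_fun [set: 'rV[R]_n] (fun v => v 0 i : measurableTypeR R).
Proof.
move=> _ Y mY; rewrite setTI; apply: sub_sigma_algebra => /=.
rewrite -bigcup_seq/=; exists i => /=; first by rewrite mem_index_enum.
by exists Y => //; rewrite setTI.
Qed.

Lemma measurable_fun_rV n (f : T -> 'rV[R]_n) :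
  (forall i, measurable_fun setT (fun t => f t 0 i : measurableTypeR R)) ->
  measurable_fun setT f.
Proof.
move=> mf _ Y mY; rewrite setTI.
suff: measurable `<=` [set A : set 'rV[R]_n | measurable (f @^-1` A)] by apply.
apply: smallest_sub.
  split=> [|A|F]/=.
  - by rewrite preimage_set0.
  - by rewrite setTD preimage_setC => ?; exact: measurableC.
  - by move=> mF; rewrite preimage_bigcup; exact: bigcup_measurable.
rewrite -bigcup_seq/=; apply: bigcup_sub => i _ _ [B mB <-]/=.
by rewrite setTI -[X in measurable X]setTI; exact: mf.
Qed.

End measurable_rV_lemmas.

Section lebesgue_measure_rV.
Variable R : realType.

Definition consrV n (p : measurableTypeR R * 'rV[R]_n) : 'rV[R]_n.+1 :=
  row_mx (const_mx p.1 : 'rV_1) p.2.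

Definition unconsrV n (v : 'rV[R]_n.+1) : measurableTypeR R * 'rV[R]_n :=
  (v 0 0, rsubmx (v : 'rV_(1 + n))).

Lemma unconsrVK n : cancel (@unconsrV n) (@consrV n).
Proof.
move=> v; rewrite /consrV /unconsrV/=.
apply/rowP => i; rewrite mxE.
by case: split_ordP => j ->; rewrite mxE ?(ord1 j); congr (v _ _); exact/val_inj.
Qed.

Lemma consrVK n : cancel (@consrV n) (@unconsrV n).
Proof.
move=> [t v]; rewrite /consrV /unconsrV/= row_mxKr; congr pair.
by rewrite mxE; case: splitP => // j _; rewrite mxE.
Qed.

Lemma measurable_consrV n : measurable_fun setT (@consrV n).
Proof.
apply: measurable_fun_rV => i.
have [j ij|j ij] := @split_ordP 1 n i.
- rewrite (_ : (fun _ => _) = fst); first exact: measurable_fst.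
  by apply/funext => p; rewrite ij [LHS](@row_mxEl _ 1 1 n) mxE.
- rewrite (_ : (fun _ => _) =
    (fun v : 'rV[R]_n => v 0 j : measurableTypeR R) \o snd).
    exact: measurableT_comp (@measurable_coord R n j) measurable_snd.
  by apply/funext => p; rewrite ij [LHS](@row_mxEr _ 1 1 n).
Qed.

Lemma measurable_unconsrV n : measurable_fun setT (@unconsrV n).
Proof.
apply: measurable_fun_pair; first exact: measurable_coord.
apply: measurable_fun_rV => i.
under eq_fun do rewrite mxE.
exact: measurable_coord.
Qed.

Section step.
Variables (n : nat) (mu : {sigma_finite_measure set 'rV[R]_n -> \bar R}).

Definition leb_step : set 'rV[R]_n.+1 -> \bar R :=
  pushforward (@lebesgue_measure R \x mu)%E (@consrV n).

Let mstep := measure_function_pushforward__canonical__measure_function_Measure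
  (@lebesgue_measure R \x mu)%E (@measurable_consrV n).

Let leb_step0 : leb_step set0 = 0%E.
Proof. exact: (measure0 mstep). Qed.

Let leb_step_ge0 A : (0 <= leb_step A)%E.
Proof. exact: (measure_ge0 mstep). Qed.

Let leb_step_sigma_additive : semi_sigma_additive leb_step.
Proof. exact: (@measure_semi_sigma_additive _ _ _ mstep). Qed.

HB.instance Definition _ := isMeasure.Build _ _ _ leb_step
  leb_step0 leb_step_ge0 leb_step_sigma_additive.

Let leb_step_sigma_finite : sigma_finite setT leb_step.
Proof.
have /sigma_finiteP[F [TF ndF Foo]] := sigma_finiteT (@lebesgue_measure R).
have /sigma_finiteP[G [TG ndG Goo]] := sigma_finiteT mu.
exists (fun i => @unconsrV n @^-1` (F i `*` G i)).
  rewrite -preimage_bigcup -[LHS](preimage_setT (@unconsrV n)); congr preimage.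
  rewrite -setXTT TF TG predeqE => -[x y]; split.
    move=> [/= [i _ Fix] [k _ Gky]]; exists (maxn i k) => //; split.
    - by move: x Fix; exact/subsetPset/ndF/leq_maxl.
    - by move: y Gky; exact/subsetPset/ndG/leq_maxr.
  by move=> [i _ []/= ? ?]; split; exists i.
move=> i; have [mF Fioo] := Foo i; have [mG Gioo] := Goo i; split.
  rewrite -[X in measurable X]setTI.
  by apply: measurable_unconsrV => //; exact: measurableX.
rewrite /leb_step /pushforward -comp_preimage.
rewrite (_ : _ \o _ = id); last by apply/funext => x /=; rewrite consrVK.
rewrite preimage_id product_measure1E// lte_mul_pinfty//.
by rewrite ge0_fin_numE.
Qed.

HB.instance Definition _ :=
  Measure_isSigmaFinite.Build _ _ _ leb_step leb_step_sigma_finite.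

End step.

Fixpoint lebesgue_rV n : {sigma_finite_measure set 'rV[R]_n -> \bar R} :=
  match n with
  | 0 => @dirac _ _ (0 : 'rV[R]_0) R
  | n'.+1 => leb_step (lebesgue_rV n')
  end.

End lebesgue_measure_rV.

Lemma lebesgue_rV_box (R : realType) n (A : 'I_n -> set (measurableTypeR R)) :
  (forall i, measurable (A i)) ->
  lebesgue_rV R n [set v | forall i, A i (v 0 i)] =
  (\prod_(i < n) lebesgue_measure (A i))%E.
Proof.
elim: n A => [|n ih] A mA.
  rewrite big_ord0 /= diracE (_ : _ \in _)//.
  by rewrite inE/= => -[].
have mB : measurable [set v : 'rV[R]_n | forall i, A (lift ord0 i) (v 0 i)].
  rewrite (_ : mkset _ = \big[setI/setT]_(i < n)
      (setT `&` (fun v : 'rV[R]_n => v 0 i : measurableTypeR R) @^-1`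
        A (lift ord0 i))).
    by apply: bigsetI_measurable => i _; exact: measurable_coord.
  rewrite -bigcap_seq; apply/seteqP; split=> [v Av i _|v Av i].
    by split=> //; exact: Av.
  by have [] := Av i (mem_index_enum _).
rewrite big_ord_recl -ih// -product_measure1E//.
rewrite /= /leb_step /pushforward; congr (_ _).
apply/seteqP; split=> -[t v] /=.
  move=> Av; split=> [|i].
    have := Av ord0; rewrite (_ : consrV (t, v) 0 ord0 = t)//.
    by have [] := consrVK (t, v).
  have := Av (lift ord0 i); congr (A _ _).
  by rewrite -(rshift1 i) [LHS](@row_mxEr _ 1 1 n).
move=> [At Av] i; have [j ij|j ij] := @split_ordP 1 n i.
  rewrite ij [X in A _ X](@row_mxEl _ 1 1 n) mxE/=.
  by rewrite (_ : lshift n j = ord0)//; apply/val_inj; rewrite /= (ord1 j).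
rewrite ij [X in A _ X](@row_mxEr _ 1 1 n).
by rewrite (_ : @rshift 1 n j = lift ord0 j)//; exact: rshift1.
Qed.

Section grushin.
Variables (R : realType) (m k : nat).
Local Notation space := ('rV[R]_m * 'rV[R]_k)%type.

Definition lebesgue : {measure set space -> \bar R} :=
  (lebesgue_rV R m \x lebesgue_rV R k)%E.
Local Notation mu := lebesgue.

(* The sigma-algebra carried by [space] is the Borel one, so measurability in
   the sense of Lebesgue is measurability for its completion.  The library's
   integral is defined for arbitrary functions, as a supremum over simple Borel
   functions below the positive and the negative part; for the functions
   considered here it is the usual integral with respect to the completed
   measure. *)
Definition lebesgue_measurable (f : space -> R) : Prop :=
  forall B : set (measurableTypeR R), measurable B ->
    completed_algebra_gen mu (f @^-1` B).

(* The norm `|_| of the library on these spaces is the sup norm. *)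
Definition enorm n (v : 'rV[R]_n) : R := Num.sqrt (\sum_(i < n) v 0 i ^+ 2).

Definition znorm (z : space) : R := Num.sqrt (enorm z.1 ^+ 2 + enorm z.2 ^+ 2).

Definition direction (i : 'I_m + 'I_k) : space :=
  match i with
  | inl a => (delta_mx 0 a, 0)
  | inr b => (0, delta_mx 0 b)
  end.

Definition partial (i : 'I_m + 'I_k) (f : space -> R) : space -> R :=
  fun z => 'D_(direction i) f z.

Definition smooth (f : space -> R) : Prop :=
  forall s : seq ('I_m + 'I_k), let g := foldr partial f s in
    continuous g /\ forall i z, derivable g z (direction i).

Definition test_function (f : space -> R) : Prop :=
  smooth f /\ compact (closure [set z | f z != 0]).

Definition grushin_grad (gamma : R) (u : space -> R) (z : space) : space :=
  (\row_(i < m) partial (inl i) u z,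
   enorm z.1 `^ gamma *: \row_(j < k) partial (inr j) u z).

Definition energy (gamma : R) (V u : space -> R) : \bar R :=
  (\int[mu]_z (znorm (grushin_grad gamma u z) ^+ 2 + V z * u z ^+ 2)%:E)%E.

(* When V is not locally integrable some test functions have infinite energy;
   the norm is defined on the others only. *)
Definition energy_domain (gamma : R) (V : space -> R) : set (space -> R) :=
  [set u | test_function u /\ (energy gamma V u < +oo)%E].

Definition energy_norm (gamma : R) (V u : space -> R) : R :=
  Num.sqrt (fine (energy gamma V u)).

(* [E], with [iota], is a completion of the energy domain; the values of [iota]
   outside of this domain are irrelevant. *)
Record is_energy_completion (gamma : R) (V : space -> R)
    (E : completeNormedModType R) (iota : (space -> R) -> E) : Prop := {
  completion_linear : forall (a : R) (u v : space -> R),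
    energy_domain gamma V u -> energy_domain gamma V v ->
    iota (fun z => a * u z + v z) = a *: iota u + iota v ;
  completion_isometry : forall u : space -> R,
    energy_domain gamma V u -> `|iota u| = energy_norm gamma V u ;
  completion_dense : closure (iota @` energy_domain gamma V) = setT
}.

Definition LpQ_norm (Q : space -> R) (p : R) (u : space -> R) : \bar R :=
  ((\int[mu]_z (Q z * `|u z| `^ p)%:E) `^ p^-1)%E.

Definition LpQ (Q : space -> R) (p : R) : set (space -> R) :=
  [set u | lebesgue_measurable u /\
           (\int[mu]_z (Q z * `|u z| `^ p)%:E < +oo)%E].

(* [J e] is a representative of the class, modulo equality almost everywhere,
   of the element of L^p_Q that corresponds to [e].  By density, linearity,
   [embedding_inclusion] and [embedding_bounded] determine [J] up to this
   equality. *)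
Record is_continuous_embedding (gamma : R) (V Q : space -> R) (p : R)
    (E : completeNormedModType R) (iota : (space -> R) -> E)
    (J : E -> space -> R) : Prop := {
  embedding_LpQ : forall e, LpQ Q p (J e) ;
  embedding_linear : forall (a : R) (e f : E),
    \forall z \ae mu, J (a *: e + f) z = a * J e z + J f z ;
  embedding_inclusion : forall u : space -> R,
    energy_domain gamma V u -> \forall z \ae mu, J (iota u) z = u z ;
  embedding_injective : forall e : E,
    (\forall z \ae mu, J e z = 0) -> e = 0 ;
  embedding_bounded : exists C : R,
    forall e : E, (LpQ_norm Q p (J e) <= (C * `|e|)%:E)%E
}.

Definition continuously_embedded (gamma : R) (V Q : space -> R) (p : R)
    (E : completeNormedModType R) (iota : (space -> R) -> E) : Prop :=
  exists J : E -> space -> R, is_continuous_embedding gamma V Q p iota J.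

Definition compactly_embedded (gamma : R) (V Q : space -> R) (p : R)
    (E : completeNormedModType R) (iota : (space -> R) -> E) : Prop :=
  exists2 J : E -> space -> R, is_continuous_embedding gamma V Q p iota J &
  forall e : nat -> E, (exists M : R, forall n, `|e n| <= M) ->
  exists2 s : nat -> nat, {homo s : i j / (i < j)%N} &
  exists2 g : space -> R, LpQ Q p g &
    LpQ_norm Q p (fun z => J (e (s n)) z - g z) @[n --> \oo] --> 0%E.

End grushin.

Section exponents.
Variables (R : realType) (m k : nat) (gamma alpha beta : R).
Local Notation N := ((m + k)%:R : R).

Definition homogeneous_dim : R := m%:R + (gamma + 1) * k%:R.

Definition critical_exponent : R :=
  2 * homogeneous_dim / (homogeneous_dim - 2).

(* The library's division in \bar R satisfies r / 0 = +oo for r > 0. *)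
Definition p_bar : \bar R :=
  Order.min ((2 * (beta - N))%:E / (alpha - N)%:E)%E critical_exponent%:E.

Definition beta_underline : R :=
  Num.max (N - critical_exponent * (N - 2) / 2)
          (N - critical_exponent * (N - alpha) / 2).

Definition p_underline : \bar R :=
  Order.max 2%:E (Order.max (2 * (N - beta) / (N - 2))%:E
    ((2 * (N - beta))%:E / (N - alpha)%:E)%E).

End exponents.

(* Main.v *)
From HB Require Import structures.
Require Import Defs.
From mathcomp Require Import all_boot all_order all_algebra.
From mathcomp Require Import all_classical all_reals all_analysis.
From mathcomp Require Import measurable_realfun ring lra.

(** Two quantities are controlled by the energy of a test function [u]: the
    integral of [V u ^ 2], by definition, and that of [|u| ^ b], where [b] is the
    critical exponent, by the Sobolev inequality for the Grushin gradient
    ([sobolev_sqr]).  Each of the conditions for continuity implies that the point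
    [(p, beta)] lies above the segment from [(2, alpha)] to [(b, 0)]
    ([above_segment_le], [above_segment_lt]), so that by Young's inequality
    [Q |u| ^ p] is pointwise at most a multiple of [V u ^ 2 + |u| ^ b]
    ([weighted_young]).  Integrating this for [u] of norm [1] gives the bound of
    the embedding on test functions ([mass_le_norm]).

    The Sobolev inequality comes from translations.  Moving [u] by a vector whose
    components are at most [r] along [x] and at most [r ^ (1 + gamma)] along [y]
    changes it by at most a multiple of [r] times the square root of its energy,
    in the norm of L^2 ([dist2_box]).  The box of these vectors has measure
    [2 ^ N r ^ Ng], with [Ng] the homogeneous dimension.  If it is twice as large
    as the set where [u ^ 2 > l], at least half of its vectors move a given point
    out of this set; applied to a truncation of [u ^ 2] between the levels [l] and
    [2 l], this bounds the measure of the set where [u ^ 2 > 2 l] by the energy of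
    [u] between these levels and a power of the measure at the level [l]
    ([level_le]).  The sum over the levels [2 ^ j l] is the Sobolev inequality.

    An element [e] of the completion corresponds to the function whose distance to
    each test function [u] is bounded by the distance of [e] to [u]
    ([represents]).  It is the almost everywhere limit of rapidly converging
    approximations, by Fatou's lemma, and it is unique.  That the map is injective
    is the closability of the energy, which is lower semicontinuous with respect
    to convergence almost everywhere ([full_energy_lsc]): with difference
    quotients in place of derivatives this is Fatou's lemma again.

    Under the conditions for compactness, [Q |u| ^ p] is a small multiple of
    [V u ^ 2 + |u| ^ b] up to a multiple of [u ^ 2] on a ball ([weighted_small]).
    There the estimate for translations shows that, up to a small multiple of the
    energy, the norm of L^2 is controlled by finitely many integrals over cells
    ([rellich]).  These form bounded sequences of reals, whence a subsequence for
    which all of them converge ([cauchy_extraction]). *)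

Set Implicit Arguments.
Unset Strict Implicit.
Unset Printing Implicit Defensive.

Import Order.TTheory GRing.Theory Num.Theory.
Import numFieldNormedType.Exports.

Local Open Scope classical_set_scope.
Local Open Scope ring_scope.

(** * Translation invariance of Lebesgue measure *)

Lemma measurable_add_rV (R : realType) n :
  measurable_fun setT (fun p : 'rV[R]_n * 'rV[R]_n => p.1 + p.2).
Proof.
apply: measurable_fun_rV => i; under eq_fun do rewrite mxE.
by apply: measurable_funD;
  apply: (measurableT_comp (@measurable_coord R n i)).
Qed.

Lemma measurable_add_pair (R : realType) m k :
  measurable_fun setT
    (fun p : ('rV[R]_m * 'rV[R]_k) * ('rV[R]_m * 'rV[R]_k) => p.1 + p.2).
Proof.
apply: measurable_fun_pair => /=.
  apply: (measurableT_comp (@measurable_add_rV R m)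
    (g := fun p => (p.1.1, p.2.1))).
  by apply: measurable_fun_pair; apply: measurableT_comp.
apply: (measurableT_comp (@measurable_add_rV R k)
  (g := fun p => (p.1.2, p.2.2))).
by apply: measurable_fun_pair; apply: measurableT_comp.
Qed.

Lemma measurable_shift (R : realType) m k (h : 'rV[R]_m * 'rV[R]_k) :
  measurable_fun setT (fun z : 'rV[R]_m * 'rV[R]_k => z + h).
Proof.
apply: (measurableT_comp (@measurable_add_pair R m k)
  (g := fun z : 'rV[R]_m * 'rV[R]_k => (z, h))).
exact: measurable_fun_pair.
Qed.

(** By uniqueness of the product measure it suffices to compare the measures of
    rectangles. *)
Lemma product_measure_preserving (R : realType) d1 d2 (T1 : measurableType d1)
    (T2 : measurableType d2) (m1 : {sigma_finite_measure set T1 -> \bar R})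
    (m2 : {sigma_finite_measure set T2 -> \bar R}) (f1 : T1 -> T1)
    (f2 : T2 -> T2) :
  measurable_fun setT f1 -> measurable_fun setT f2 ->
  (forall A, measurable A -> m1 (f1 @^-1` A) = m1 A) ->
  (forall A, measurable A -> m2 (f2 @^-1` A) = m2 A) ->
  forall A, measurable A ->
  (m1 \x m2)%E ((fun p => (f1 p.1, f2 p.2)) @^-1` A) = (m1 \x m2)%E A.
Proof.
move=> mf1 mf2 f1E f2E A mA.
have mf : measurable_fun setT (fun p : T1 * T2 => (f1 p.1, f2 p.2)).
  by apply: measurable_fun_pair; apply: measurableT_comp.
pose m' := measure_function_pushforward__canonical__measure_function_Measure
  (m1 \x m2)%E mf.
apply/esym; apply: (@product_measure_unique _ _ _ _ _ m1 m2 m') => // B C mB mC.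
rewrite /m'/= /pushforward/=.
rewrite (_ : _ @^-1` _ = (f1 @^-1` B) `*` (f2 @^-1` C))//.
have mf1B : measurable (f1 @^-1` B).
  by rewrite -[X in measurable X]setTI; apply: mf1.
have mf2C : measurable (f2 @^-1` C).
  by rewrite -[X in measurable X]setTI; apply: mf2.
etransitivity; first exact: product_measure1E.
by congr (_ * _)%E; [exact: f1E|exact: f2E].
Qed.

Lemma integral_measure_preserving (R : realType) d (T : measurableType d)
    (mu : {measure set T -> \bar R}) (phi : T -> T) (f : T -> \bar R) :
  measurable_fun setT phi ->
  (forall A, measurable A -> mu (phi @^-1` A) = mu A) ->
  measurable_fun setT f -> (forall x, 0 <= f x)%E ->
  (\int[mu]_x f (phi x) = \int[mu]_x f x)%E.
Proof.
move=> mphi phiE mf f0.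
rewrite -[LHS](@ge0_integral_pushforward _ _ _ _ _ _ mphi mu setT f)//.
by apply: eq_measure_integral => A mA _; exact: phiE.
Qed.

(** Lebesgue measure is determined by its values on half-open intervals. *)
Lemma lebesgue_measure_shift (R : realType) (t : R)
    (A : set (measurableTypeR R)) : measurable A ->
  lebesgue_measure ((fun x : measurableTypeR R => x + t : measurableTypeR R)
    @^-1` A) = lebesgue_measure A.
Proof.
move=> mA.
have mf : measurable_fun setT
    (fun x : measurableTypeR R => x + t : measurableTypeR R).
  exact: measurable_funD.
pose m' := measure_function_pushforward__canonical__measure_function_Measure
  (@lebesgue_measure R) mf.
apply/esym; apply: (@lebesgue_measure_unique R m') => //= _ [[a b]] _ <-.
rewrite /pushforward/= (_ : _ @^-1` _ = `]a - t, b - t]%classic); last first.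
  by apply/seteqP; split => x /=; rewrite !in_itv/= ltrBlDr lerBrDr.
rewrite !lebesgue_measure_itv/= !lte_fin ltrD2r.
by case: ifP => // _; rewrite -!EFinB; congr EFin; ring.
Qed.

Lemma lebesgue_rV_shift (R : realType) n (h : 'rV[R]_n) (A : set 'rV[R]_n) :
  measurable A -> lebesgue_rV R n ((fun v : 'rV[R]_n => v + h) @^-1` A) = lebesgue_rV R n A.
Proof.
elim: n h A => [|n ih] h A mA.
  congr (_ _); apply/seteqP; split => v /=;
  by rewrite (_ : v + h = v)//; apply/rowP => -[].
rewrite /= /leb_step /pushforward.
have mcA : measurable (@consrV R n @^-1` A).
  by rewrite -[X in measurable X]setTI; apply: measurable_consrV.
rewrite -[RHS](@product_measure_preserving _ _ _ _ _ (@lebesgue_measure R)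
  (lebesgue_rV R n) (fun x : measurableTypeR R => x + h 0 0 : measurableTypeR R)
  (fun v : 'rV[R]_n => v + rsubmx (h : 'rV_(1 + n))))//.
- congr (_ _); apply/seteqP; split => -[t v] /=; congr (A _).
    apply/rowP => i; rewrite !mxE; case: splitP => j ij; rewrite !mxE//.
      by congr (_ + h _ _); apply/val_inj; rewrite /= ?ij (ord1 j).
    by congr (_ + h _ _); apply/val_inj; rewrite /= ?ij.
  apply/rowP => i; rewrite !mxE; case: splitP => j ij; rewrite !mxE//.
    by congr (_ + h _ _); apply/val_inj; rewrite /= ?ij (ord1 j).
  by congr (_ + h _ _); apply/val_inj; rewrite /= ?ij.
- exact: measurable_funD.
- apply: (measurableT_comp (@measurable_add_rV R n)
    (g := fun v : 'rV[R]_n => (v, rsubmx (h : 'rV_(1 + n))))).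
  exact: measurable_fun_pair.
- by move=> B mB; exact: lebesgue_measure_shift.
- by move=> B mB; exact: ih.
Qed.

Lemma product_sigma_finite (R : realType) d1 d2 (T1 : measurableType d1)
    (T2 : measurableType d2) (m1 : {sigma_finite_measure set T1 -> \bar R})
    (m2 : {sigma_finite_measure set T2 -> \bar R}) :
  sigma_finite setT (m1 \x m2)%E.
Proof.
by have [] := lebesgue_integral_fubini.measure_function_Measure_isSigmaFinite__to__measure_function_isSigmaFinite m1 m2.
Qed.

Section lebesgue_space.
Context {R : realType} {m k : nat}.
Local Notation space := ('rV[R]_m * 'rV[R]_k)%type.
Local Notation mu := (lebesgue R m k).

Lemma lebesgue_sigma_finite : sigma_finite setT mu.
Proof.
exact: product_sigma_finite.
Qed.

(** The integral over a product, and hence Tonelli's theorem, needs the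
    sigma-finite structure of the measure. *)
Definition lebesgue_sf : {sigma_finite_measure set space -> \bar R} :=
  HB.pack (mu : set space -> \bar R) (Measure.class mu)
    (Measure_isSigmaFinite.Build _ _ _ mu lebesgue_sigma_finite).

Lemma lebesgue_shift (h : space) (A : set space) : measurable A ->
  mu ((fun z : space => z + h) @^-1` A) = mu A.
Proof.
move=> mA; rewrite /lebesgue/=.
rewrite -[RHS](@product_measure_preserving _ _ _ _ _ (lebesgue_rV R m)
  (lebesgue_rV R k) (fun v : 'rV[R]_m => v + h.1) (fun v : 'rV[R]_k => v + h.2))//.
- apply: (measurableT_comp (@measurable_add_rV R m)
    (g := fun v : 'rV[R]_m => (v, h.1))).
  exact: measurable_fun_pair.
- apply: (measurableT_comp (@measurable_add_rV R k)
    (g := fun v : 'rV[R]_k => (v, h.2))).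
  exact: measurable_fun_pair.
- by move=> B mB; exact: lebesgue_rV_shift.
- by move=> B mB; exact: lebesgue_rV_shift.
Qed.

(** * Continuous functions are Borel *)

Lemma rV_ball_measurable n (v : 'rV[R]_n) (e : R) : measurable (ball v e).
Proof.
have [e0|e0] := leP e 0.
  rewrite (_ : ball v e = set0)//; apply/seteqP; split => // w.
  by case=> + _; rewrite ltNge e0.
rewrite (_ : ball v e = \bigcap_(i in [set: 'I_n])
  ((fun w : 'rV[R]_n => w 0 i : measurableTypeR R) @^-1` ball (v 0 i) e)).
  apply: fin_bigcap_measurable => // i _.
  rewrite -[X in measurable X]setTI; apply: measurable_coord => //.
  exact: measurable_ball.
apply/seteqP; split => w /=.
  by move=> [_ vw] i _; apply: vw.
by move=> vw; split => // i j; rewrite (ord1 i); apply: vw.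
Qed.

Lemma rat_rV_near n (v : 'rV[R]_n) (e : R) : 0 < e ->
  exists q : 'rV[rat]_n, ball v e (map_mx ratr q).
Proof.
move=> e0.
have near (x : R) : exists q : rat, `|x - ratr q| < e.
  have [|q] := @rat_in_itvoo R (x - e) (x + e); first by lra.
  by rewrite in_itv/= => /andP[? ?]; exists q; rewrite ltr_norml; lra.
exists (\row_i xchoose (near (v 0 i))); split => // i j.
by rewrite (ord1 i) !mxE; exact: (xchooseP (near (v 0 j))).
Qed.

(** Both factors are separable: an open set is the union of the countably many
    balls with rational centres and radii [1 / n] that it contains. *)
Lemma open_space_measurable (O : set space) : open O -> measurable O.
Proof.
move=> oO.
pose I := (('rV[rat]_m * 'rV[rat]_k) * nat)%type.
pose c (i : I) : space := (map_mx ratr i.1.1, map_mx ratr i.1.2).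
pose B (i : I) : set space := ball (c i) i.2.+1%:R^-1.
have OE : O = \bigcup_(i in [set i | B i `<=` O]) B i.
  apply/seteqP; split=> [z Oz|z [i Bi /Bi]//].
  have /nbhs_ballP[e /= e0 ezO] : nbhs z O by apply: open_nbhs_nbhs; split.
  have [n _ /(_ n (leqnn n)) ne] := near_infty_natSinv_lt (PosNum (divr_gt0 e0 (ltr0n R 2))).
  rewrite /= in ne.
  have n0 : 0 < n.+1%:R^-1 :> R by rewrite invr_gt0.
  have [q1 zq1] := rat_rV_near z.1 n0.
  have [q2 zq2] := rat_rV_near z.2 n0.
  exists ((q1, q2), n); last by split; apply: ball_sym.
  move=> w cw; apply: ezO; rewrite (splitr e).
  apply: (@ball_triangle _ _ (c ((q1, q2), n))).
    by apply: le_ball (ltW ne) _ _; split.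
  by apply: le_ball (ltW ne) _ _.
rewrite OE bigcup_mkcond; apply: countable_bigcupT_measurable => [|i].
  exact: countableP.
case: ifP => // _; apply: measurableX; exact: rV_ball_measurable.
Qed.

Lemma continuous_space_measurable (f : space -> R) :
  continuous f -> measurable_fun setT (f : space -> measurableTypeR R).
Proof.
move=> /continuousP cf; apply: (measurability _ (RGenOpens.measurableE R)).
move=> _ [_ [a [b ->]] <-]; rewrite setTI; apply: open_space_measurable.
by apply: cf; exact: interval_open.
Qed.

End lebesgue_space.

(** * Integrands that are measurable only for the completed measure *)

Section modification.
Context d (T : measurableType d) (R : realType) (mu : {measure set T -> \bar R}).
Local Open Scope ereal_scope.
Import HBNNSimple.

Lemma le_integral_modification (N : set T) (f g : T -> \bar R) :
  measurable N -> mu N = 0 -> (forall x, 0 <= f x) -> (forall x, 0 <= g x) ->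
  (forall x, ~ N x -> f x = g x) -> \int[mu]_x f x <= \int[mu]_x g x.
Proof.
move=> mN N0 f0 g0 fg; rewrite ge0_integralTE// ge0_integralTE//.
apply: ge_ereal_sup => _ [h /= hf <-].
have mNC : measurable (~` N) by exact: measurableC.
pose h' : {nnsfun T >-> R} := proj_nnsfun h mNC.
apply: (@le_trans _ _ (sintegral mu h')).
  rewrite -!integralT_nnsfun.
  have -> : \int[mu]_x (h x)%:E = \int[mu]_x (h' x)%:E; last by [].
  apply: ge0_ae_eq_integral => //.
  - exact/measurable_EFinP.
  - exact/measurable_EFinP.
  - by move=> x _; rewrite lee_fin.
  - by move=> x _; rewrite lee_fin.
  - exists N; split => // x /=; apply: contra_notP => Nx _.
    by rewrite /= mindicE mem_set ?mulr1.
apply: ereal_sup_ubound; exists h' => //= x.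
have [Nx|Nx] := pselect (N x).
  by rewrite /= mindicE memNset ?mulr0//=; apply.
by rewrite -fg//; apply: le_trans (hf x); rewrite /= mindicE mem_set ?mulr1.
Qed.

Lemma ge0_integral_modification (N : set T) (f g : T -> \bar R) :
  measurable N -> mu N = 0 -> (forall x, 0 <= f x) -> (forall x, 0 <= g x) ->
  (forall x, ~ N x -> f x = g x) -> \int[mu]_x f x = \int[mu]_x g x.
Proof.
move=> mN N0 f0 g0 fg; apply/eqP; rewrite eq_le.
by rewrite !(@le_integral_modification N)// => x Nx; rewrite fg.
Qed.

(** The integral of a nonnegative function is a supremum over the simple
    functions below it, which may be cut off on a null set; hence arbitrary
    integrands are allowed. *)
Lemma integral_modification (N : set T) (f g : T -> \bar R) :
  measurable N -> mu N = 0 -> (forall x, ~ N x -> f x = g x) ->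
  \int[mu]_x f x = \int[mu]_x g x.
Proof.
move=> mN N0 fg; rewrite integralE [RHS]integralE; congr (_ - _).
  by apply: (ge0_integral_modification mN N0) => // x Nx; rewrite !funeposE fg.
by apply: (ge0_integral_modification mN N0) => // x Nx; rewrite !funenegE fg.
Qed.

End modification.

Section borel_modification.
Context d (T : measurableType d) (R : realType) (mu : {measure set T -> \bar R}).

(** A function is determined by its sublevel sets at rational levels, and outside
    of the union [N] of countably many null sets those of [f] are Borel.  On [N]
    the values of [g] are taken, so that a property that [f] has only almost
    everywhere holds everywhere for the modification. *)
Lemma borel_modification (f g : T -> R) (P : T -> R -> Prop) :
  (forall B : set (measurableTypeR R), measurable B ->
    completed_algebra_gen mu (f @^-1` B)) ->
  measurable_fun setT (g : T -> measurableTypeR R) ->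
  (forall z, P z (g z)) -> (\forall z \ae mu, P z (f z)) ->
  exists f' : T -> R, exists N : set T, [/\ measurable N, mu N = 0%E,
    measurable_fun setT (f' : T -> measurableTypeR R),
    (forall z, P z (f' z)) & (forall z, ~ N z -> f' z = f z)].
Proof.
move=> mf mg Pg [A [mA A0 PA]].
have split_level (q : rat) : exists BN : set T * set T,
    [/\ measurable BN.1, measurable BN.2, mu BN.2 = 0%E &
     forall z, ~ BN.2 z -> (BN.1 z <-> f z < ratr q)].
  have [B mB [N [M [mM M0 NM]] BNE]] := mf _ (measurable_itv `]-oo, ratr q[).
  exists (B, M); split => // z Mz /=.
  have -> : (f z < ratr q) = ((f @^-1` `]-oo, (ratr q : R)[) z) :> Prop.
    by rewrite /= in_itv.
  rewrite -BNE; split; first by left.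
  by case=> // /NM.
have [BN BNP] := choice split_level.
pose N := A `|` \bigcup_(q in [set: rat]) (BN q).2.
have mN : measurable N.
  apply: measurableU => //; apply: bigcupT_measurable_rat => q.
  by have [] := BNP q.
have N0 : mu N = 0%E.
  apply/negligibleP => //; apply: negligibleU; first exact/negligibleP.
  pose F (i : nat) := if unpickle i is Some q then (BN q).2 else set0.
  apply: (@negligibleS _ _ _ _ (\bigcup_i F i)).
    by move=> z [q _ qz]; exists (pickle q); [exact: I|rewrite /F pickleK].
  apply: negligible_bigcup => i; rewrite /F.
  case: unpickle => [q|]; last exact: negligible_set0.
  by have [_ ? ? _] := BNP q; exact/negligibleP.
pose f' z := if z \in N then g z else f z.
exists f', N; split; [exact: mN|exact: N0|..].
- apply: (measurability _ (RGenInftyO.measurableE R)).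
  move=> _ [_ [a ->] <-]; rewrite setTI.
  have -> : f' @^-1` `]-oo, a[ = (N `&` g @^-1` `]-oo, a[) `|`
      (~` N `&` \bigcup_(q in [set q : rat | ratr q <= a]) (BN q).1).
    apply/seteqP; split => z /=.
      rewrite /f'; case: ifPn => [|/negP]; rewrite inE => Nz.
        by left.
      rewrite in_itv/= => /rat_in_itvoo[q]; rewrite in_itv/= => /andP[fq qa].
      right; split => //; exists q; first exact: ltW.
      have [_ _ _ /(_ z) [|_]] := BNP q; last exact.
      by apply: contra_not Nz => ?; right; exists q.
    case=> [[Nz]|[Nz [q /= qa qz]]]; first by rewrite /f' mem_set.
    rewrite /f' memNset// in_itv/= (lt_le_trans _ qa)//.
    have [_ _ _ /(_ z) [|+ _]] := BNP q; last exact.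
    by apply: contra_not Nz => ?; right; exists q.
  apply: measurableU; apply: measurableI; [exact: mN|..].
  - by rewrite -[X in measurable X]setTI; apply: mg => //.
  - exact: measurableC.
  - rewrite bigcup_mkcond; apply: bigcupT_measurable_rat => q.
    by case: ifP => // _; have [] := BNP q.
- move=> z; rewrite /f'; case: ifPn => // /negP; rewrite inE => Nz.
  by apply: contrapT => /PA; apply: contra_not Nz => ?; left.
- by move=> z Nz; rewrite /f' memNset.
Qed.

End borel_modification.

(** * Integrals of nonnegative real functions *)

Lemma le_of_eq d (T : porderType d) (x y : T) : x = y -> (x <= y)%O.
Proof. by move=> ->. Qed.

Section real_integrands.
Context d (T : measurableType d) (R : realType) (mu : {measure set T -> \bar R}).
Implicit Types f g : T -> R.

Lemma ge0_le_integralR f g : measurable_fun setT f -> measurable_fun setT g ->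
  (forall x, 0 <= f x) -> (forall x, f x <= g x) ->
  (\int[mu]_x (f x)%:E <= \int[mu]_x (g x)%:E)%E.
Proof.
move=> mf mg f0 fg; apply: ge0_le_integral => //.
- by move=> x _; rewrite lee_fin.
- exact/measurable_EFinP.
- exact/measurable_EFinP.
- by move=> x _; rewrite lee_fin.
Qed.

Lemma ge0_integralRD f g : measurable_fun setT f -> measurable_fun setT g ->
  (forall x, 0 <= f x) -> (forall x, 0 <= g x) ->
  (\int[mu]_x (f x + g x)%:E = \int[mu]_x (f x)%:E + \int[mu]_x (g x)%:E)%E.
Proof.
move=> mf mg f0 g0; under eq_integral do rewrite EFinD.
rewrite ge0_integralD//.
- by move=> x _; rewrite lee_fin.
- exact/measurable_EFinP.
- by move=> x _; rewrite lee_fin.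
- exact/measurable_EFinP.
Qed.

Lemma ge0_integralRZ (c : R) f : measurable_fun setT f -> 0 <= c ->
  (forall x, 0 <= f x) ->
  (\int[mu]_x (c * f x)%:E = c%:E * \int[mu]_x (f x)%:E)%E.
Proof.
move=> mf c0 f0; under eq_integral do rewrite EFinM.
rewrite ge0_integralZl_EFin//.
- by move=> x _; rewrite lee_fin.
- exact/measurable_EFinP.
Qed.

End real_integrands.

(** * Directional derivatives *)

Section line.
Context {R : realType} {V : normedModType R}.
Implicit Types (f : V -> R) (z v : V).

Lemma is_derive_line f z v (s d : R) :
  is_derive (z + s *: v) v f d <-> is_derive s 1 (fun s => f (z + s *: v)) d.
Proof.
have quotE : (fun h : R => h^-1 *:
    ((f \o shift (z + s *: v)) (h *: v) - f (z + s *: v))) =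
  (fun h => h^-1 *: (((fun s => f (z + s *: v)) \o shift s) (h *: 1) -
    (fun s => f (z + s *: v)) s)).
  apply/funext => h /=; congr (_ *: (f _ - _)).
  by rewrite [h *: 1]mulr1 scalerDl addrCA.
by split => -[df dfE]; (split; [move: df|move: dfE]);
  rewrite /derivable /derive quotE.
Qed.

Lemma is_derive_at_line f z v (d : R) :
  is_derive z v f d <-> is_derive (0 : R) 1 (fun s => f (z + s *: v)) d.
Proof. by rewrite -is_derive_line scale0r addr0. Qed.

Lemma is_derive_along_comp (phi : R -> R) f z v (a d : R) :
  is_derive (f z) 1 phi a -> is_derive z v f d ->
  is_derive z v (phi \o f) (a * d).
Proof.
move=> dphi /is_derive_at_line df; apply/is_derive_at_line.
apply: (@is_derive1_comp _ phi (fun s => f (z + s *: v))) => //.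
by rewrite scale0r addr0.
Qed.

Lemma line_lipschitz f z v (M s : R) : (forall z, derivable f z v) ->
  (forall z, `|'D_v f z| <= M) -> `|f (z + s *: v) - f z| <= M * `|s|.
Proof.
move=> df dfM.
have dl (t : R) : is_derive t 1 (fun s => f (z + s *: v)) ('D_v f (z + t *: v)).
  by apply/is_derive_line; split.
have cl : continuous (fun s : R => f (z + s *: v)).
  by move=> t; apply/differentiable_continuous/derivable1_diffP; have [] := dl t.
have [s0|s0] := leP 0 s.
  have [c _] := @MVT_segment R (fun s => f (z + s *: v))
    (fun t => 'D_v f (z + t *: v)) 0 s s0 (fun x _ => dl x)
    (continuous_subspaceT cl).
  by rewrite scale0r addr0 subr0 => ->; rewrite normrM ler_wpM2r.
have [c _] := @MVT_segment R (fun s => f (z + s *: v))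
  (fun t => 'D_v f (z + t *: v)) s 0 (ltW s0) (fun x _ => dl x)
  (continuous_subspaceT cl).
rewrite scale0r addr0 sub0r distrC => ->.
by rewrite normrM normrN ler_wpM2r.
Qed.

Lemma dyadic_quotient_cvg f z v (t : R) : derivable f z v ->
  (2 ^+ j * (f (z + (t / 2 ^+ j) *: v) - f z)) @[j --> \oo] --> t * 'D_v f z.
Proof.
move=> df; have [->|t0] := eqVneq t 0.
  rewrite mul0r; apply: cvg_near_cst; near=> j.
  by rewrite mul0r scale0r addr0 subrr mulr0.
have h0 : t / 2 ^+ j @[j --> \oo] --> (0 : R).
  rewrite -[X in _ --> X](mulr0 t).
  under eq_fun do rewrite -exprVn.
  by apply: cvgMr; apply: cvg_expr; rewrite ger0_norm ?invf_lt1 ?ltr1n ?invr_ge0.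
have hj0 : t / 2 ^+ j @[j --> \oo] --> (0 : R)^'.
  move=> A nA; have : \forall j \near \oo, t / 2 ^+ j != 0 -> A (t / 2 ^+ j).
    exact: (h0 _ nA).
  apply: filterS => j Aj; apply: Aj.
  by rewrite mulf_neq0// invr_neq0// expf_neq0.
have cq : (t / 2 ^+ j)^-1 * (f ((t / 2 ^+ j) *: v + z) - f z) @[j --> \oo]
    --> 'D_v f z by exact: (cvg_comp _ _ hj0 df).
have -> : (fun j => 2 ^+ j * (f (z + (t / 2 ^+ j) *: v) - f z)) =
    (fun j => t * ((t / 2 ^+ j)^-1 * (f ((t / 2 ^+ j) *: v + z) - f z))).
  apply/funext => j; rewrite invfM invrK mulrA mulrA mulfV// mul1r.
  by rewrite (addrC _ z).
by apply: cvgM; [exact: cvg_cst|exact: cq].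
Unshelve. all: by end_near. Qed.

End line.

(** * Functions of class C^1 with compact support *)

Section c1c.
Context {R : realType} {m k : nat}.
Local Notation space := ('rV[R]_m * 'rV[R]_k)%type.
Local Notation dir i := (direction R i).
Implicit Types f g : space -> R.

(** This class contains the test functions and is stable under the truncations
    of the proof of the Sobolev inequality, which are not smooth. *)
Record C1c f : Prop := {
  C1c_continuous : continuous f ;
  C1c_derivable : forall i z, derivable f z (dir i) ;
  C1c_partial : forall i, continuous (partial i f) ;
  C1c_support : exists K : set space,
    [/\ compact K, closed K & forall z, ~ K z -> f z = 0] }.

Lemma test_function_C1c f : test_function f -> C1c f.
Proof.
move=> [sf cK]; split.
- by have [] := sf [::].
- by have [] := sf [::].
- by move=> i; have [] := sf [:: i].
- exists (closure [set z | f z != 0]); split => //; first exact: closed_closure.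
  move=> z zK; apply/eqP; apply: contra_notT zK => fz.
  exact: subset_closure.
Qed.

Lemma partial0_off (K : set space) f i z : closed K ->
  (forall z, ~ K z -> f z = 0) -> ~ K z -> partial i f z = 0.
Proof.
move=> cK f0 Kz; rewrite /partial /derive; apply: cvg_lim => //.
apply: cvg_near_cst.
have nK : nbhs z (~` K).
  by apply: open_nbhs_nbhs; split => //; exact: closed_openC.
have : \forall h \near (0 : R), (~` K) (h *: dir i + z).
  have : h *: dir i + z @[h --> (0 : R)] --> 0 *: dir i + z.
    by apply: cvgD; [exact: scalel_continuous|exact: cvg_cst].
  by rewrite scale0r add0r; apply.
move=> nearK; apply: nbhs_dnbhs; near=> h => /=.
by rewrite [f z]f0// f0 ?subrr ?scaler0//; near: h.
Unshelve. all: by end_near. Qed.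

Lemma C1c_bounded f : C1c f -> exists M : R, [/\ 0 <= M,
  (forall z, `|f z| <= M), (forall i z, `|partial i f z| <= M) &
  (forall z, M < `|z| -> f z = 0)].
Proof.
move=> [cf df pf [K [cK clK f0]]].
have bdd g : continuous g -> (forall z, ~ K z -> g z = 0) ->
    exists M : R, 0 <= M /\ forall z, `|g z| <= M.
  move=> cg g0.
  have [M [_ MK]] := compact_bounded (continuous_compact (continuous_subspaceT cg) cK).
  exists (`|M| + 1); split; first by rewrite addr_ge0.
  move=> z; have [Kz|/g0->] := pselect (K z); last by rewrite normr0 addr_ge0.
  apply: MK; last by exists z.
  by rewrite (le_lt_trans (ler_norm M))// ltrDl.
have [M0 [M00 M0f]] := bdd f cf f0.
have /choice[M1 M1P] : forall i, exists M : R, 0 <= M /\ forall z, `|partial i f z| <= M.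
  by move=> i; apply: bdd => // z; exact: partial0_off.
have [M2 [_ M2K]] := compact_bounded cK.
pose M := M0 + \sum_i M1 i + (`|M2| + 1).
have s0 : 0 <= \sum_i M1 i by apply: sumr_ge0 => i _; have [] := M1P i.
exists M; split.
- by rewrite /M !addr_ge0.
- move=> z; rewrite (le_trans (M0f z))// /M -addrA lerDl !addr_ge0//.
- move=> i z; have [_ /(_ z) h] := M1P i; rewrite (le_trans h)// /M.
  rewrite (bigD1 i)//= addrACA addrC -!addrA lerDl !addr_ge0//.
  by apply: sumr_ge0 => j _; have [] := M1P j.
- move=> z Mz; apply: f0 => Kz; move: Mz; rewrite ltNge.
  rewrite (M2K M)//; rewrite (le_lt_trans (ler_norm M2))// /M.
  by rewrite addrA ltr_pwDr// lerDr addr_ge0.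
Qed.

Lemma C1cB f g : C1c f -> C1c g -> C1c (f \- g).
Proof.
move=> [cf df pf [K [cK clK f0]]] [cg dg pg [L [cL clL g0]]]; split.
- by move=> z; apply: continuousB; [exact: cf|exact: cg].
- by move=> i z; apply: derivableB; [exact: df|exact: dg].
- move=> i; rewrite (_ : partial i _ = partial i f \- partial i g).
    by move=> z; apply: continuousB; [exact: pf|exact: pg].
  by apply/funext => z; rewrite /partial [LHS]deriveB.
- exists (K `|` L); split; first exact: compactU.
    exact: closedU.
  by move=> z /not_orP[/f0 fz /g0 gz] /=; rewrite fz gz subrr.
Qed.

Lemma C1c_comp (phi phi' : R -> R) f : (forall x : R, is_derive x 1 phi (phi' x)) ->
  continuous phi' -> phi 0 = 0 -> C1c f ->
  C1c (phi \o f) /\ forall i z, partial i (phi \o f) z = phi' (f z) * partial i f z.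
Proof.
move=> dphi cphi' phi0 [cf df pf [K [cK clK f0]]].
have cphi : continuous phi.
  by move=> x; apply/differentiable_continuous/derivable1_diffP; have [] := dphi x.
have D i z : is_derive z (dir i) (phi \o f) (phi' (f z) * partial i f z).
  by apply: is_derive_along_comp => //; split.
have DE i z : partial i (phi \o f) z = phi' (f z) * partial i f z.
  by have [_ ?] := D i z.
split; last exact: DE.
split.
- by move=> z; apply: continuous_comp; [exact: cf|exact: cphi].
- by move=> i z; have [] := D i z.
- move=> i; rewrite (_ : partial i _ = (phi' \o f) \* partial i f).
    move=> z; apply: continuousM; last exact: pf.
    by apply: continuous_comp; [exact: cf|exact: cphi'].
  by apply/funext => z; rewrite DE.
- by exists K; split => // z /f0 /= ->.
Qed.

End c1c.

(** * Differences under translations *)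

Section translation.
Context {R : realType} {m k : nat}.
Local Notation space := ('rV[R]_m * 'rV[R]_k)%type.
Local Notation dir i := (direction R i).
Variable mu : {sigma_finite_measure set space -> \bar R}.
Hypothesis mu_shift : forall (h : space) (A : set space), measurable A ->
  mu ((fun z : space => z + h) @^-1` A) = mu A.
Hypothesis mu_bounded : forall M : R, (mu [set z : space | (`|z| <= M)%R] < +oo)%E.
Implicit Types (f g w : space -> R) (z h : space).

Lemma integral_translate (h : space) (F : space -> R) :
  measurable_fun setT F -> (forall z, 0 <= F z) ->
  (\int[mu]_z (F (z + h)%R)%:E = \int[mu]_z (F z)%:E)%E.
Proof.
move=> mF F0.
apply: (@integral_measure_preserving _ _ _ mu _ (EFin \o F) (measurable_shift h)).
- exact: mu_shift.
- exact/measurable_EFinP.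
- by move=> z; rewrite lee_fin.
Qed.

Lemma measurable_norm_le (M : R) : measurable [set z : space | (`|z| <= M)%R].
Proof.
rewrite (_ : mkset _ = (fun z : space => `|z| : R) @^-1` `]-oo, M]); last first.
  by apply/seteqP; split => z; rewrite /= in_itv.
rewrite -[X in measurable X]setTI.
by apply: continuous_space_measurable => // z; exact: norm_continuous.
Qed.

Lemma measurable_fun_translate (h : space) (F : space -> R) :
  measurable_fun setT F -> measurable_fun setT (fun z : space => F (z + h)).
Proof. by move=> mF; exact: (measurableT_comp mF (measurable_shift h)). Qed.

(** The weights [w] that occur are invariant along the direction of [h]. *)
Definition transl w f h : \bar R :=
  (\int[mu]_z (w z * (f (z + h)%R - f z) ^+ 2)%:E)%E.

Lemma measurable_transl w f h : measurable_fun setT w ->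
  measurable_fun setT f ->
  measurable_fun setT (fun z : space => w z * (f (z + h) - f z) ^+ 2).
Proof.
move=> mw mf; apply: measurable_funM; first exact: mw.
apply: measurable_funX; apply: measurable_funB; last exact: mf.
exact: measurable_fun_translate.
Qed.

Lemma transl_translate w f h h' : measurable_fun setT w -> (forall z, 0 <= w z) ->
  measurable_fun setT f ->
  (\int[mu]_z (w (z + h')%R * (f (z + h' + h)%R - f (z + h')%R) ^+ 2)%:E =
   transl w f h)%E.
Proof.
move=> mw w0 mf.
apply: (@integral_translate h' (fun z => w z * (f (z + h)%R - f z) ^+ 2)).
- exact: measurable_transl.
- by move=> z; rewrite mulr_ge0// sqr_ge0.
Qed.

(** The difference of step [h + h] is a sum of two differences of step [h], which
    have the same weighted norm by translation invariance. *)
Lemma transl_double w f h : measurable_fun setT w -> (forall z, 0 <= w z) ->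
  measurable_fun setT f -> (forall z, w (z + h) = w z) ->
  (transl w f (h + h)%R <= 4%:E * transl w f h)%E.
Proof.
move=> mw w0 mf wh.
have mT := measurable_transl h mw mf.
have mT' : measurable_fun setT
    (fun z : space => w (z + h) * (f (z + h + h) - f (z + h)) ^+ 2).
  exact: (measurable_fun_translate h mT).
have le4 : (transl w f (h + h)%R <= \int[mu]_z (2 *
    (w (z + h)%R * (f (z + h + h)%R - f (z + h)%R) ^+ 2 +
     w z * (f (z + h)%R - f z) ^+ 2))%:E)%E.
  apply: ge0_le_integralR.
  - exact: measurable_transl.
  - by apply: measurable_funM => //; exact: measurable_funD.
  - by move=> z; rewrite mulr_ge0// sqr_ge0.
  - move=> z /=; rewrite wh addrA -mulrDr [leRHS]mulrCA ler_wpM2l//.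
    rewrite -subr_ge0.
    set a := f (z + h + h); set b := f (z + h); set c := f z.
    have -> : 2 * ((a - b) ^+ 2 + (b - c) ^+ 2) - (a - c) ^+ 2 =
      (a - b - (b - c)) ^+ 2 by ring.
    exact: sqr_ge0.
apply: (le_trans le4); rewrite ge0_integralRZ//; last 2 first.
- exact: measurable_funD.
- by move=> z; rewrite addr_ge0// mulr_ge0// sqr_ge0.
rewrite ge0_integralRD//; last 2 first.
- by move=> z; rewrite mulr_ge0// sqr_ge0.
- by move=> z; rewrite mulr_ge0// sqr_ge0.
rewrite transl_translate// -/(transl w f h).
have t0 : (0 <= transl w f h)%E.
  by apply: integral_ge0 => z _; rewrite lee_fin mulr_ge0// sqr_ge0.
rewrite ge0_muleDr// -ge0_muleDl// -EFinD.
by rewrite (_ : 2 + 2 = 4 :> R)//; ring.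
Qed.

Lemma transl_dyadic w f v (t : R) j :
  measurable_fun setT w -> (forall z, 0 <= w z) ->
  measurable_fun setT f -> (forall (s : R) z, w (z + s *: v) = w z) ->
  (transl w f (t *: v) <=
   (4 ^+ j)%:E * transl w f ((t / 2 ^+ j) *: v))%E.
Proof.
move=> mw w0 mf wv; elim: j => [|j ih].
  by rewrite !expr0 divr1 mul1e.
apply: (le_trans ih).
have -> : (t / 2 ^+ j) *: v = (t / 2 ^+ j.+1) *: v + (t / 2 ^+ j.+1) *: v.
  by rewrite -scalerDl exprS invfM; congr (_ *: _); field.
rewrite (exprSr 4) [in leRHS]EFinM -muleA; apply: lee_wpmul2l.
  by rewrite lee_fin exprn_ge0.
apply: transl_double; [exact: mw|exact: w0|exact: mf|exact: wv].
Qed.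

(** Differences are controlled by derivatives: iterating the doubling bound
    replaces the translation by ever smaller ones, for which the difference
    quotients converge boundedly to the derivative. *)
Lemma transl_le_partial w f i (t : R) :
  measurable_fun setT w -> (forall z, 0 <= w z) ->
  (forall M, exists C, forall z, `|z| <= M -> w z <= C) -> C1c f ->
  (forall (s : R) z, w (z + s *: dir i) = w z) ->
  (transl w f (t *: dir i) <=
   (t ^+ 2)%:E * \int[mu]_z (w z * partial i f z ^+ 2)%:E)%E.
Proof.
move=> mw w0 wb cf wi.
have mf : measurable_fun setT f.
  by apply: continuous_space_measurable; exact: C1c_continuous cf.
have mpf : measurable_fun setT (partial i f).
  by apply: continuous_space_measurable; exact: C1c_partial cf i.
have [M [M0 fM pfM fM0]] := C1c_bounded cf.
pose rho := M + `|t| * `|dir i|.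
have [C wC] := wb rho.
(* The differences of step [t / 2 ^ j] and their limit as [j] grows. *)
pose F (j : nat) (z : space) :=
  w z * (2 ^+ j * (f (z + (t / 2 ^+ j) *: dir i) - f z)) ^+ 2.
pose G (z : space) := w z * (t * partial i f z) ^+ 2.
pose A := [set z : space | `|z| <= rho].
have mA : measurable A by exact: measurable_norm_le.
have dirD (j : nat) z : `|f (z + (t / 2 ^+ j) *: dir i) - f z| <=
    M * (`|t| / 2 ^+ j).
  apply: (le_trans (@line_lipschitz _ _ f z (dir i) M _ _ _)) => //.
  - by move=> z'; exact: C1c_derivable cf i z'.
  - by move=> z'; exact: pfM.
  - by rewrite normrM [`|_^-1|]ger0_norm// invr_ge0 exprn_ge0.
pose H (z : space) : R := (`|C| * (M * `|t|) ^+ 2) * \1_A z.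
have c0 : 0 <= `|C| * (M * `|t|) ^+ 2 by rewrite mulr_ge0// sqr_ge0.
have mF j : measurable_fun setT (F j).
  apply: measurable_funM; first exact: mw.
  apply: measurable_funX; apply: measurable_funM; first exact: measurable_cst.
  by apply: measurable_funB; [exact: measurable_fun_translate|exact: mf].
have mG : measurable_fun setT G.
  apply: measurable_funM; first exact: mw.
  by apply: measurable_funX; apply: measurable_funM; [exact: measurable_cst|].
have mH : measurable_fun setT H.
  by apply: measurable_funM; [exact: measurable_cst|exact: measurable_indic].
have iH : mu.-integrable setT (EFin \o H).
  apply/integrableP; split; first exact/measurable_EFinP.
  have H0 z : 0 <= H z by rewrite mulr_ge0.
  under eq_integral do rewrite /= ger0_norm//.
  rewrite (@ge0_integralRZ _ _ _ mu (`|C| * (M * `|t|) ^+ 2) \1_A)//.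
  rewrite integral_indic// setIT.
  by apply: lte_mul_pinfty; [rewrite lee_fin|exact: fin_numE|exact: mu_bounded].
have FG z : F j z @[j --> \oo] --> G z.
  apply: cvgM; first exact: cvg_cst.
  have df : derivable f z (dir i) by exact: C1c_derivable.
  have dq := @dyadic_quotient_cvg _ _ f z (dir i) t df.
  under eq_fun do rewrite expr2.
  by rewrite expr2; apply: cvgM; exact: dq.
have FH j z : `|F j z| <= H z.
  have F0 : 0 <= F j z by rewrite mulr_ge0// sqr_ge0.
  rewrite ger0_norm//.
  have [zrho|zrho] := leP `|z| rho.
    rewrite /H indicE mem_set// mulr1; apply: ler_pM => //; first exact: sqr_ge0.
      by rewrite (le_trans (wC z zrho))// ler_norm.
    rewrite -ler_sqrt ?sqr_ge0// !sqrtr_sqr normrM [`|M * _|]ger0_norm ?mulr_ge0//.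
    rewrite [`|2 ^+ j|]ger0_norm ?exprn_ge0//.
    rewrite mulrC -ler_pdivlMr ?exprn_gt0//.
    by rewrite -mulrA; exact: dirD.
  rewrite /F (fM0 z); last first.
    by rewrite (le_lt_trans _ zrho)// /rho lerDl mulr_ge0.
  rewrite fM0 ?subrr ?mulr0 ?expr0n ?mulr0//; first by rewrite mulr_ge0.
  have : `|z| <= `|z + (t / 2 ^+ j) *: dir i| + `|(t / 2 ^+ j) *: dir i|.
    rewrite -{1}[z](addrK ((t / 2 ^+ j) *: dir i)).
    exact: ler_normB.
  have : `|(t / 2 ^+ j) *: dir i| <= `|t| * `|dir i|.
    rewrite normrZ ler_wpM2r// normrM ler_piMr// ger0_norm ?invr_ge0 ?exprn_ge0//.
    by rewrite invf_le1 ?exprn_gt0// exprn_ege1// ler1n.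
  by move: zrho; rewrite /rho; lra.
have [|||||_ _ cvgI] := @dominated_convergence _ _ _ mu setT measurableT
  (fun j => EFin \o F j) (EFin \o G) (EFin \o H).
- by move=> j; exact/measurable_EFinP.
- exact/measurable_EFinP.
- by apply: aeW => z _; apply: cvg_EFin; [exact: nearW|exact: FG].
- exact: iH.
- by apply: aeW => z j _; rewrite /= lee_fin.
have -> : ((t ^+ 2)%:E * \int[mu]_z (w z * partial i f z ^+ 2)%:E =
    \int[mu]_z (G z)%:E)%E.
  rewrite -ge0_integralRZ ?sqr_ge0//.
  - by apply: eq_integral => z _; rewrite /G exprMn mulrCA.
  - by apply: measurable_funM => //; exact: measurable_funX.
  - by move=> z; rewrite mulr_ge0// sqr_ge0.
rewrite -(cvg_lim _ cvgI)//; apply: lime_ge; first by apply/cvg_ex; eexists; exact: cvgI.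
apply: nearW => j; apply: (le_trans (transl_dyadic t j mw w0 mf wi)).
rewrite -ge0_integralRZ ?exprn_ge0//; last 2 first.
- exact: measurable_transl.
- by move=> z; rewrite mulr_ge0// sqr_ge0.
apply: le_of_eq; apply: eq_integral => z _.
rewrite /F /= exprMn -exprM mulnC exprM mulrCA; congr (_ * (_ * _))%:E.
by congr (_ ^+ j); ring.
Qed.

End translation.

(** * The Grushin energy and translations *)

Lemma EFin_muleDl (R : realType) (a b : R) (x : \bar R) : 0 <= a -> 0 <= b ->
  (a%:E * x + b%:E * x = (a + b)%:E * x)%E.
Proof. by move=> a0 b0; rewrite EFinD ge0_muleDl. Qed.

Section grushin_translation.
Context {R : realType} {m k : nat}.
Local Notation space := ('rV[R]_m * 'rV[R]_k)%type.
Local Notation dir i := (direction R i).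
Variable mu : {sigma_finite_measure set space -> \bar R}.
Hypothesis mu_shift : forall (h : space) (A : set space), measurable A ->
  mu ((fun z : space => z + h) @^-1` A) = mu A.
Hypothesis mu_bounded : forall M : R,
  (mu [set z : space | (`|z| <= M)%R] < +oo)%E.
Variable gamma : R.
Hypothesis gamma_gt0 : 0 < gamma.
Implicit Types (f g w : space -> R) (z h : space).

Lemma enorm_ge0 n (v : 'rV[R]_n) : 0 <= enorm v.
Proof. exact: sqrtr_ge0. Qed.

Lemma sqr_enorm n (v : 'rV[R]_n) : enorm v ^+ 2 = \sum_(i < n) v 0 i ^+ 2.
Proof. by rewrite sqr_sqrtr// sumr_ge0// => i _; rewrite sqr_ge0. Qed.

Lemma coord_le_enorm n (v : 'rV[R]_n) i : `|v 0 i| <= enorm v.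
Proof.
rewrite -ler_sqr ?nnegrE ?enorm_ge0// sqr_enorm real_normK ?num_real//.
rewrite (bigD1 i)//= lerDl sumr_ge0// => j _; exact: sqr_ge0.
Qed.

Lemma measurable_enorm n : measurable_fun setT (@enorm R n).
Proof.
apply: measurableT_comp.
  by apply: continuous_measurable_fun => x; exact: sqrt_continuous.
by apply: measurable_sum => i; apply: measurable_funX; exact: measurable_coord.
Qed.

Lemma enorm_le n (v : 'rV[R]_n) (M : R) : 0 <= M -> (forall i, `|v 0 i| <= M) ->
  enorm v <= n%:R * M.
Proof.
move=> M0 vM; rewrite -ler_sqr ?nnegrE ?enorm_ge0 ?mulr_ge0// sqr_enorm.
apply: (@le_trans _ _ (\sum_(i < n) M ^+ 2)).
  by apply: ler_sum => i _; rewrite -real_normK ?num_real// ler_sqr.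
rewrite sumr_const card_ord -[leLHS]mulr_natl exprMn ler_wpM2r ?sqr_ge0//.
rewrite -natrX ler_nat; case: (n) => // n'; exact: leq_pmulr.
Qed.

Lemma coord_le_norm n (v : 'rV[R]_n) i : `|v 0 i| <= `|v|.
Proof.
rewrite [leRHS]mx_normrE.
exact: (le_bigmax _ (fun ij : 'I_1 * 'I_n => `|v ij.1 ij.2|) (ord0, i)).
Qed.

(** The coefficients of the vector fields that make up the Grushin gradient. *)
Definition grushin_weight (i : 'I_m + 'I_k) (z : space) : R :=
  if i is inr _ then enorm z.1 `^ gamma else 1.

Definition grushin_grad2 f (z : space) : R :=
  \sum_i (grushin_weight i z ^+ 2 * partial i f z ^+ 2).

Lemma sqr_znorm_grushin_grad f z :
  znorm (grushin_grad gamma f z) ^+ 2 = grushin_grad2 f z.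
Proof.
rewrite /znorm sqr_sqrtr ?addr_ge0 ?sqr_ge0// !sqr_enorm /grushin_grad2.
rewrite big_sumType/=; congr (_ + _).
  by apply: eq_bigr => i _; rewrite mxE expr1n mul1r.
by apply: eq_bigr => i _; rewrite !mxE exprMn.
Qed.

Lemma grushin_weight_ge0 i z : 0 <= grushin_weight i z.
Proof. by case: i => i //=; exact: powR_ge0. Qed.

Lemma measurable_grushin_weight i :
  measurable_fun setT (grushin_weight i).
Proof.
case: i => i /=; first exact: measurable_cst.
apply: (measurableT_comp (measurable_powR _)).
by apply: measurableT_comp => //; exact: measurable_enorm.
Qed.

Lemma grushin_weight_line i (s : R) z :
  grushin_weight i (z + s *: dir i) = grushin_weight i z.
Proof. by case: i => i //=; rewrite scaler0 addr0. Qed.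

Lemma grushin_weight_bounded i (M : R) :
  exists C, forall z, `|z| <= M -> grushin_weight i z <= C.
Proof.
case: i => i /=; first by exists 1.
exists ((m%:R * `|M|) `^ gamma) => z zM.
apply: ge0_ler_powR; rewrite ?nnegrE ?mulr_ge0 ?enorm_ge0 ?(ltW gamma_gt0)//.
apply: enorm_le => // j; apply: (le_trans (coord_le_norm _ _)).
by rewrite (le_trans _ (le_trans zM (ler_norm M)))// le_max lexx.
Qed.

Definition grushin_energy f : \bar R :=
  (\int[mu]_z (grushin_grad2 f z)%:E)%E.

Lemma grushin_grad2_ge0 f z : 0 <= grushin_grad2 f z.
Proof. by apply: sumr_ge0 => i _; rewrite mulr_ge0 ?sqr_ge0. Qed.

Lemma C1c_measurable f : C1c f -> measurable_fun setT f.
Proof. by move=> cf; apply: continuous_space_measurable; case: cf. Qed.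

Lemma C1c_measurable_partial f i : C1c f -> measurable_fun setT (partial i f).
Proof. by move=> cf; apply: continuous_space_measurable; case: cf. Qed.

Lemma measurable_grushin_grad2 f : C1c f ->
  measurable_fun setT (grushin_grad2 f).
Proof.
move=> cf; apply: measurable_sum => i; apply: measurable_funM.
  by apply: measurable_funX; exact: measurable_grushin_weight.
by apply: measurable_funX; exact: C1c_measurable_partial.
Qed.

Lemma grushin_energy_ge0 f : (0 <= grushin_energy f)%E.
Proof.
by apply: integral_ge0 => z _; rewrite lee_fin grushin_grad2_ge0.
Qed.

Lemma partial_le_energy f i : C1c f ->
  (\int[mu]_z (grushin_weight i z ^+ 2 * partial i f z ^+ 2)%:E <=
   grushin_energy f)%E.
Proof.
move=> cf; apply: ge0_le_integralR.
- apply: measurable_funM; apply: measurable_funX.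
    exact: measurable_grushin_weight.
  exact: C1c_measurable_partial.
- exact: measurable_grushin_grad2.
- by move=> z; rewrite mulr_ge0 ?sqr_ge0.
- move=> z; rewrite /grushin_grad2 (bigD1 i)//= lerDl sumr_ge0// => j _.
  by rewrite mulr_ge0 ?sqr_ge0.
Qed.

Notation dist2 f h := (transl mu (cst (1 : R)) f h).

Lemma dist2D f h h' : measurable_fun setT f ->
  (dist2 f (h + h')%R <= 2%:E * (dist2 f h + dist2 f h'))%E.
Proof.
move=> mf.
have m1 : measurable_fun setT (cst (1 : R) : space -> R).
  exact: measurable_cst.
have mT h1 := measurable_transl h1 m1 mf.
have -> : (dist2 f h' = \int[mu]_z
    (1 * (f (z + h + h')%R - f (z + h)%R) ^+ 2)%:E)%E.
  exact/esym/(transl_translate mu_shift h' h m1).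
rewrite -ge0_integralRD; last 4 first.
- exact: mT.
- exact: (measurable_fun_translate h (mT h')).
- by move=> z; rewrite mulr_ge0 ?sqr_ge0.
- by move=> z; rewrite mulr_ge0 ?sqr_ge0.
rewrite -ge0_integralRZ//; last 2 first.
- apply: measurable_funD; first exact: mT.
  exact: (measurable_fun_translate h (mT h')).
- by move=> z; rewrite addr_ge0// mulr_ge0 ?sqr_ge0.
apply: ge0_le_integralR.
- exact: mT.
- apply: measurable_funM => //; apply: measurable_funD; first exact: mT.
  exact: (measurable_fun_translate h (mT h')).
- by move=> z; rewrite mulr_ge0 ?sqr_ge0.
- move=> z /=; rewrite !mul1r addrA -subr_ge0.
  set a := f (z + h + h'); set b := f (z + h); set c := f z.
  have -> : 2 * ((b - c) ^+ 2 + (a - b) ^+ 2) - (a - c) ^+ 2 =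
    (a - b - (b - c)) ^+ 2 by ring.
  exact: sqr_ge0.
Qed.

Lemma dist2_sum f (c : 'I_m + 'I_k -> space) (A : \bar R) s :
  measurable_fun setT f -> (0 <= A)%E -> (forall i, (dist2 f (c i) <= A)%E) ->
  (dist2 f (\sum_(i <- s) c i)%R <= (4 ^+ size s)%:E * A)%E.
Proof.
move=> mf A0 cA; elim: s => [|i s ih] /=.
  rewrite big_nil expr0 mul1e (_ : dist2 f 0 = 0%E)//.
  by apply: integral0_eq => z _; rewrite addr0 subrr expr0n/= mulr0.
rewrite big_cons; apply: (le_trans (dist2D _ _ mf)).
apply: (@le_trans _ _ (2%:E * (A + (4 ^+ size s)%:E * A))%E).
  by apply: lee_wpmul2l => //; apply: leeD; [exact: cA|exact: ih].
rewrite -{1}[A]mul1e -ge0_muleDl ?lee_fin ?exprn_ge0// muleA.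
apply: lee_wpmul2r => //; rewrite -EFinD -EFinM lee_fin exprS.
have : 1 <= 4 ^+ size s :> R by rewrite exprn_ege1// ler1n.
lra.
Qed.

Lemma dist2_x f a (t : R) : C1c f ->
  (dist2 f (t *: dir (inl a)) <= (t ^+ 2)%:E * grushin_energy f)%E.
Proof.
move=> cf; apply: le_trans.
  apply: (transl_le_partial mu_shift mu_bounded) => //.
  by move=> M; exists 1.
apply: lee_wpmul2l; first by rewrite lee_fin sqr_ge0.
apply: le_trans (partial_le_energy (inl a) cf).
apply: le_of_eq.
by apply: eq_integral => z _ /=; rewrite expr1n.
Qed.

(** Moving by [r ^ (1 + gamma)] in a direction [y_b] costs only [r]: far from
    [x = 0] because the coefficient [|x| ^ gamma] is large there, and near [x = 0]
    because a detour of length [r] in the direction [x_1] leads far from it. *)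
Lemma dist2_y (m_ge1 : (1 <= m)%N) f b (r t : R) : C1c f -> 0 < r ->
  `|t| <= r `^ (1 + gamma) ->
  (dist2 f (t *: dir (inr b)) <= (28 * r ^+ 2)%:E * grushin_energy f)%E.
Proof.
move=> cf r0 tr.
have mf := C1c_measurable cf.
pose a0 : 'I_m := Ordinal m_ge1.
pose S := [set z : space | (r <= `|z.1 0 a0|)%R].
pose chi : space -> R := \1_S.
pose chic (z : space) : R := 1 - chi z.
have chiE z : chi z = (r <= `|z.1 0 a0|)%R%:R.
  rewrite /chi indicE; congr (nat_of_bool _)%:R.
  by apply/idP/idP; rewrite inE.
have chi0 z : 0 <= chi z by rewrite chiE.
have chic0 z : 0 <= chic z by rewrite /chic chiE subr_ge0; case: (r <= _)%R.
have mchi : measurable_fun setT chi.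
  apply: measurable_indic.
  rewrite (_ : S = (fun z : space => `|z.1 0 a0|) @^-1` `[r, +oo[); last first.
    by apply/seteqP; split => z; rewrite /S/= in_itv/= andbT.
  rewrite -[X in measurable X]setTI.
  apply: (measurableT_comp (@normr_measurable R setT)) => //.
  exact: (measurableT_comp (measurable_coord a0) measurable_fst).
have mchic : measurable_fun setT chic by exact: measurable_funB.
have chi_line (s : R) z : chi (z + s *: dir (inr b)) = chi z.
  by rewrite !chiE /= scaler0 addr0.
pose g : space := t *: dir (inr b).
(* On the part [|x_1| >= r] the coefficient of d/dy is at least r^gamma. *)
have far : (transl mu chi f g <= (r ^+ 2)%:E * grushin_energy f)%E.
  apply: (@le_trans _ _
      ((t ^+ 2)%:E * \int[mu]_z (chi z * partial (inr b) f z ^+ 2)%:E)%E).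
    apply: (transl_le_partial mu_shift mu_bounded) => //.
    by move=> M; exists 1 => z _; rewrite chiE; case: (r <= _)%R.
  apply: (@le_trans _ _ ((r ^+ 2)%:E * \int[mu]_z
      (grushin_weight (inr b) z ^+ 2 * partial (inr b) f z ^+ 2)%:E)%E).
    have mp := C1c_measurable_partial (inr b) cf.
    have mw := measurable_grushin_weight (inr b).
    rewrite -ge0_integralRZ ?sqr_ge0//; last 2 first.
    - by apply: measurable_funM => //; exact: measurable_funX.
    - by move=> z; rewrite mulr_ge0 ?sqr_ge0.
    rewrite -ge0_integralRZ ?sqr_ge0//; last 2 first.
    - by apply: measurable_funM; exact: measurable_funX.
    - by move=> z; rewrite mulr_ge0 ?sqr_ge0.
    apply: ge0_le_integralR.
    - do 2 (apply: measurable_funM => //); exact: measurable_funX.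
    - by apply: measurable_funM => //; apply: measurable_funM; exact: measurable_funX.
    - by move=> z; rewrite mulr_ge0 ?sqr_ge0// mulr_ge0 ?sqr_ge0.
    - move=> z /=; rewrite (mulrA (t ^+ 2)) (mulrA (r ^+ 2)).
      apply: ler_wpM2r; rewrite ?sqr_ge0// chiE.
      have [rz|_] := leP r `|z.1 0 a0|; last first.
        by rewrite mulr0 mulr_ge0 ?sqr_ge0.
      rewrite mulr1 -exprMn -[leLHS]real_normK ?num_real//.
      rewrite ler_sqr ?nnegrE ?mulr_ge0 ?powR_ge0 ?(ltW r0)//.
      apply: (le_trans tr).
      rewrite powRD; last by rewrite (gt_eqF r0) implybT.
      rewrite powRr1 ?(ltW r0)// ler_wpM2l ?(ltW r0)//.
      apply: ge0_ler_powR; rewrite ?nnegrE ?enorm_ge0 ?(ltW gamma_gt0) ?(ltW r0)//.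
      by rewrite (le_trans rz)// coord_le_enorm.
  by apply: lee_wpmul2l; [rewrite lee_fin sqr_ge0|exact: partial_le_energy].
(* Points with [|x_1| < r] leave that strip when moved by [2 r] along x_1. *)
pose e : space := (2 * r) *: dir (inl a0).
have m1 : measurable_fun setT (cst (1 : R) : space -> R).
  exact: measurable_cst.
have near_le : (transl mu chic f g <=
    3%:E * (dist2 f e + transl mu chi f g + dist2 f e))%E.
  rewrite -{1}(transl_translate mu_shift e g m1 _ mf)//.
  rewrite -(transl_translate mu_shift g e mchi _ mf)//.
  have mA := measurable_fun_translate g (measurable_transl e m1 mf).
  have mB := measurable_fun_translate e (measurable_transl g mchi mf).
  have mC := measurable_transl e m1 mf.
  rewrite -ge0_integralRD; last 4 first.
  - exact: mA.
  - exact: mB.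
  - by move=> z; rewrite mulr_ge0 ?sqr_ge0.
  - by move=> z; rewrite mulr_ge0 ?sqr_ge0.
  rewrite -ge0_integralRD; last 4 first.
  - by apply: measurable_funD; [exact: mA|exact: mB].
  - exact: mC.
  - by move=> z; rewrite addr_ge0// mulr_ge0 ?sqr_ge0.
  - by move=> z; rewrite mulr_ge0 ?sqr_ge0.
  have mABC := measurable_funD (measurable_funD mA mB) mC.
  rewrite -ge0_integralRZ//; last first.
    by move=> z; rewrite !addr_ge0// mulr_ge0 ?sqr_ge0.
  apply: ge0_le_integralR.
  - exact: measurable_transl.
  - by apply: measurable_funM => //; exact: mABC.
  - by move=> z; rewrite mulr_ge0 ?sqr_ge0.
  - move=> z /=; rewrite !mul1r (addrAC z g e).
    set p := f (z + e + g); set q := f (z + g); set u := f (z + e).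
    have [zr|zr] := leP r `|z.1 0 a0|.
      rewrite /chic chiE zr subrr mul0r mulr_ge0// !addr_ge0 ?sqr_ge0//.
      by rewrite mulr_ge0 ?sqr_ge0.
    have -> : chic z = 1 by rewrite /chic chiE leNgt zr subr0.
    have -> : chi (z + e) = 1.
      have -> : chi (z + e) = (r <= `|z.1 0 a0 + 2 * r|)%R%:R.
        by rewrite chiE /= !mxE !eqxx mulr1.
      have -> // : r <= `|z.1 0 a0 + 2 * r|.
      by move: zr; rewrite ltr_norml => /andP[? ?]; rewrite ger0_norm; lra.
    rewrite !mul1r -subr_ge0.
    have -> : 3 * ((p - q) ^+ 2 + (p - u) ^+ 2 + (u - f z) ^+ 2) - (q - f z) ^+ 2
      = ((p - q) + (p - u)) ^+ 2 + ((p - q) + (u - f z)) ^+ 2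
        + ((p - u) - (u - f z)) ^+ 2 by ring.
    by rewrite !addr_ge0 ?sqr_ge0.
have e_le : (dist2 f e <= (4 * r ^+ 2)%:E * grushin_energy f)%E.
  apply: (le_trans (dist2_x a0 (2 * r) cf)).
  by rewrite exprMn (_ : 2 ^+ 2 = 4 :> R)//; ring.
have -> : (dist2 f g = transl mu chi f g + transl mu chic f g)%E.
  rewrite -ge0_integralRD; last 4 first.
  - exact: measurable_transl.
  - exact: measurable_transl.
  - by move=> z; rewrite mulr_ge0 ?sqr_ge0.
  - by move=> z; rewrite mulr_ge0 ?sqr_ge0.
  apply: eq_integral => z _; rewrite /chic /=; congr EFin; ring.
have G0 := grushin_energy_ge0 f.
have r20 : 0 <= r ^+ 2 by exact: sqr_ge0.
apply: le_trans (leeD far (le_trans near_le (lee_wpmul2l _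
  (leeD (leeD e_le far) e_le)))) _ => //.
have r24 : 0 <= 4 * r ^+ 2 by rewrite mulr_ge0.
rewrite EFin_muleDl// EFin_muleDl ?addr_ge0// muleA -EFinM.
rewrite EFin_muleDl ?mulr_ge0 ?addr_ge0 ?(ltW r0)//.
rewrite (_ : _ + _ = 28 * r ^+ 2)//; ring.
Qed.

(** The box is adapted to the dilations that scale [x] by [r] and [y] by
    [r ^ (1 + gamma)], under which the Grushin gradient is homogeneous. *)
Definition grushin_box (r : R) : set space :=
  [set h : space | (forall a, (`|h.1 0 a| <= r)%R) /\
                   (forall b, (`|h.2 0 b| <= r `^ (1 + gamma))%R)].

(** The translation is a sequence of moves along the axes, each of which costs a
    multiple of [r] by [dist2_x] or [dist2_y]. *)
Lemma dist2_box (m_ge1 : (1 <= m)%N) f (r : R) h : C1c f -> 0 < r ->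
  grushin_box r h ->
  (dist2 f h <= (4 ^+ (m + k) * 28 * r ^+ 2)%:E * grushin_energy f)%E.
Proof.
move=> cf r0 [h1 h2].
pose c i := (match i with inl a => h.1 0 a | inr b => h.2 0 b end) *: dir i.
have -> : h = \sum_i c i.
  have sumE (F : 'I_m + 'I_k -> space) s :
      \sum_(i <- s) F i = (\sum_(i <- s) (F i).1, \sum_(i <- s) (F i).2).
    by elim: s => [|i s ih]; rewrite ?big_nil// !big_cons ih.
  rewrite sumE !big_sumType/= [LHS]surjective_pairing; congr pair.
    rewrite [X in _ + X]big1 ?addr0 => [|b _]; last by rewrite scaler0.
    exact: row_sum_delta.
  rewrite [X in X + _]big1 ?add0r => [|a _]; last by rewrite scaler0.
  exact: row_sum_delta.
pose A := ((28 * r ^+ 2)%:E * grushin_energy f)%E.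
have A0 : (0 <= A)%E.
  by rewrite mule_ge0 ?grushin_energy_ge0// lee_fin mulr_ge0 ?sqr_ge0.
have cA i : (dist2 f (c i) <= A)%E.
  rewrite /c; case: i => [a|b]; last by apply: dist2_y => //; exact: h2.
  apply: (le_trans (dist2_x a _ cf)); apply: lee_wpmul2r.
    exact: grushin_energy_ge0.
  rewrite lee_fin -real_normK ?num_real//.
  have : `|h.1 0 a| ^+ 2 <= r ^+ 2 by rewrite ler_sqr ?nnegrE// ltW.
  by have := sqr_ge0 r; lra.
apply: (le_trans (dist2_sum _ (C1c_measurable cf) A0 cA)).
rewrite /A muleA -EFinM -mulrA.
apply: le_of_eq; congr (_%:E * _)%E.
by congr (4 ^+ _ * _); rewrite -sum1_size sum1_card card_sum !card_ord.
Qed.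

End grushin_translation.

(** * The Sobolev inequality for the Grushin gradient *)

Section truncation.
Context {R : realType}.
Implicit Types x t : R.

Definition sqpos x : R := Num.max 0 x ^+ 2.

(** [sqpos] is not twice differentiable at [0]; the quadratic bound on the
    remainder treats all points alike. *)
Lemma is_derive_quadratic (f : R -> R) (x d : R) :
  (forall h, `|f (h + x) - f x - d * h| <= h ^+ 2) -> is_derive x 1 f d.
Proof.
move=> fd.
suff H : (fun h => h^-1 *: ((f \o shift x) (h *: 1) - f x)) @ 0^' --> d.
  by split; [apply/cvg_ex; exists d; exact: H|apply: cvg_lim => //; exact: H].
apply/cvgrPdist_le => e e0; near=> h.
have h0 : h != 0 by near: h; exact: nbhs_dnbhs_neq.
have he : `|h| <= e.
  near: h; apply: nbhs_dnbhs; apply: filterS (nbhsx_ballx (0 : R) e e0) => y.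
  by rewrite /ball/= sub0r normrN => /ltW.
rewrite /= [h *: 1]mulr1 /GRing.scale/=; apply: le_trans he.
set q := f (h + x) - f x.
rewrite -(ler_pM2r (x := `|h|)) ?normr_gt0// -normrM.
rewrite mulrBl mulrAC mulVf// mul1r -opprB.
by rewrite normrN (le_trans (fd h))// -normrM ler_norm.
Unshelve. all: by end_near. Qed.

Lemma is_derive_sqpos x : is_derive x 1 sqpos (2 * Num.max 0 x).
Proof.
apply: is_derive_quadratic => h; rewrite /sqpos ler_norml.
by have [hx|hx] := leP (h + x) 0; have [x0|x0] := leP x 0; nra.
Qed.

(** A step of class C^1 from [0] to [1] inside the interval from [1] to [2]: the
    second difference of [sqpos], so that its slope is a tent. *)
Definition step t : R :=
  2 * (sqpos (t - 1) - 2 * sqpos (t - 3 / 2) + sqpos (t - 2)).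

Definition step' t : R := 4 *
  (Num.max 0 (t - 1) - 2 * Num.max 0 (t - 3 / 2) + Num.max 0 (t - 2)).

Lemma is_derive_step t : is_derive t 1 step (step' t).
Proof.
have D (c : R) : is_derive t 1 (fun t => sqpos (t - c)) (2 * Num.max 0 (t - c)).
  rewrite -[_ * _]mulr1; apply: (@is_derive1_comp _ sqpos (fun t => t - c)).
    exact: is_derive_sqpos.
  by apply: is_derive_eq; rewrite subr0.
have := is_deriveZ 2 (is_deriveD (is_deriveB (D 1) (is_deriveZ 2 (D (3 / 2)))) (D 2)).
move=> H; apply: (is_derive_eq H).
rewrite /step' /GRing.scale/=; ring.
Qed.

Lemma continuous_step' : continuous step'.
Proof.
have cm (c : R) : continuous (fun t => Num.max 0 (t - c)).
  move=> x; apply: (@continuous_max _ R (cst (0 : R)) (fun t : R => t - c) x).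
    exact: cst_continuous.
  by apply: cvgB; [exact: cvg_id|exact: cvg_cst].
move=> x; apply: cvgM; first exact: cvg_cst.
apply: cvgD; last exact: cm.
apply: cvgB; first exact: cm.
by apply: cvgM; [exact: cvg_cst|exact: cm].
Qed.

Lemma step0 t : t <= 1 -> step t = 0.
Proof.
by move=> t1; rewrite /step /sqpos !max_l; lra.
Qed.

Lemma step1 t : 2 <= t -> step t = 1.
Proof. by move=> t2; rewrite /step /sqpos !max_r; try lra; field. Qed.

Lemma sqr_step'_le t : step' t ^+ 2 <= 4 * ((1 < t) && (t < 2))%R%:R.
Proof.
have [t1|t1] := leP t 1.
  by rewrite /step' !max_l; try lra; rewrite /= !mulr0 subr0 addr0 mulr0 expr0n.
have [t2|t2] := leP 2 t.
  rewrite /step' !max_r; try lra.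
  by rewrite mulr0 (_ : 4 * _ = 0 :> R) ?expr0n//; field.
rewrite mulr1 (_ : 4 = 2 ^+ 2 :> R); last by ring.
rewrite -[leLHS]real_normK ?num_real// ler_sqr ?nnegrE// ler_norml /step'.
rewrite (max_r (x := 0) (y := t - 1)); last lra.
rewrite (max_l (x := 0) (y := t - 2)); last lra.
by have [h|h] := leP (t - 3 / 2) 0; lra.
Qed.

End truncation.

(** If [S > 2 e], then [S <= 2 D S ^ theta], which bounds [S]. *)
Lemma sublinear_bound (R : realType) (S e D theta : R) :
  0 <= S -> 0 <= e -> 0 <= D -> 0 < theta -> theta < 1 -> S <= e + D * S `^ theta ->
  S <= 2 * e + (2 * D) `^ (1 - theta)^-1.
Proof.
move=> S0 e0 D0 th0 th1 SD.
have [Se|eS] := leP S (2 * e).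
  by rewrite (le_trans Se)// lerDl powR_ge0.
have [|Spos] := leP S 0.
  move=> Sle; have Se0 : S = 0 by apply/eqP; rewrite eq_le Sle.
  by rewrite Se0 addr_ge0 ?powR_ge0 ?mulr_ge0.
have h : S `^ (1 - theta) <= 2 * D.
  rewrite powRB; last by rewrite gt_eqF// implybT.
  rewrite powRr1// ler_pdivrMr ?powR_gt0//.
  by lra.
have -> : S = (S `^ (1 - theta)) `^ (1 - theta)^-1.
  by rewrite -powRrM mulfV ?powRr1// subr_eq0 gt_eqF.
have : (S `^ (1 - theta)) `^ (1 - theta)^-1 <= (2 * D) `^ (1 - theta)^-1.
  by apply: ge0_ler_powR; rewrite ?nnegrE ?powR_ge0 ?mulr_ge0// invr_ge0 subr_ge0 ltW.
lra.
Qed.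

(** Both sides are compared with the measure of [S], computed from its sections
    in either direction. *)
Lemma tonelli_double_count d1 d2 (T1 : measurableType d1)
    (T2 : measurableType d2) (R : realType)
    (m1 : {sigma_finite_measure set T1 -> \bar R})
    (m2 : {sigma_finite_measure set T2 -> \bar R})
    (S : set (T1 * T2)) (A : set T1) (B : set T2) (c X : \bar R) :
  measurable S -> measurable A -> measurable B -> (0 <= c)%E -> (0 <= X)%E ->
  (forall x, A x -> (c <= m2 (xsection S x))%E) ->
  (forall y, B y -> (m1 (ysection S y) <= X)%E) ->
  (forall p, S p -> B p.2) -> (c * m1 A <= X * m2 B)%E.
Proof.
move=> mS mA mB c0 X0 cS SX SB.
have mF : measurable_fun setT (fun p : T1 * T2 => (\1_S p : R)%:E).
  by apply/measurable_EFinP; exact: measurable_indic.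
have F0 (p : T1 * T2) : (0 <= (\1_S p : R)%:E)%E by rewrite lee_fin.
have := @fubini_tonelli _ _ _ _ _ m1 m2 _ mF F0.
under eq_integral => x _.
  rewrite (_ : (\int[m2]_y _)%E = m2 (xsection S x)); last first.
    transitivity (\int[m2]_y (\1_(xsection S x) y : R)%:E)%E.
      by apply: eq_integral => h _; congr EFin; rewrite !indicE mem_xsection.
    by rewrite integral_indic ?setIT//; exact: measurable_xsection.
  over.
under [RHS]eq_integral => y _.
  rewrite (_ : (\int[m1]_x _)%E = m1 (ysection S y)); last first.
    transitivity (\int[m1]_x (\1_(ysection S y) x : R)%:E)%E.
      by apply: eq_integral => h _; congr EFin; rewrite !indicE mem_ysection.
    by rewrite integral_indic ?setIT//; exact: measurable_ysection.
  over.
move=> E.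
have mA1 : measurable_fun setT (fun x => (\1_A x : R)%:E).
  by apply/measurable_EFinP; exact: measurable_indic.
have mB1 : measurable_fun setT (fun x => (\1_B x : R)%:E).
  by apply/measurable_EFinP; exact: measurable_indic.
apply: (@le_trans _ _ (\int[m1]_x m2 (xsection S x))%E).
  rewrite -[in leLHS](setIT A) -integral_indic//.
  rewrite -ge0_integralZl//.
  apply: ge0_le_integral => //.
  - by move=> x _; rewrite mule_ge0// lee_fin.
  - exact: emeasurable_funM.
  - exact: measurable_fun_xsection.
  move=> x _; rewrite indicE; have [/set_mem Ax|_] := boolP (x \in A).
    by rewrite mule1; exact: cS.
  by rewrite mule0.
rewrite E -[in leRHS](setIT B) -integral_indic//.
rewrite -ge0_integralZl//.
apply: ge0_le_integral => //.
- exact: measurable_fun_ysection.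
- exact: emeasurable_funM.
move=> y _; rewrite indicE; have [/set_mem By|By] := boolP (y \in B).
  by rewrite mule1; exact: SX.
rewrite (_ : ysection S y = set0) ?measure0 ?mule0//.
apply/seteqP; split => // x; rewrite /ysection/= inE => /SB/=.
by move: By; rewrite notin_setE.
Qed.

Section sobolev.
Context {R : realType} {m k : nat}.
Local Notation space := ('rV[R]_m * 'rV[R]_k)%type.
Local Notation dir i := (direction R i).
Variable mu : {sigma_finite_measure set space -> \bar R}.
Hypothesis mu_shift : forall (h : space) (A : set space), measurable A ->
  mu ((fun z : space => z + h) @^-1` A) = mu A.
Hypothesis mu_bounded : forall M : R,
  (mu [set z : space | (`|z| <= M)%R] < +oo)%E.
Variable gamma : R.
Hypothesis gamma_gt0 : 0 < gamma.
Hypothesis m_ge1 : (1 <= m)%N.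
Hypothesis N_ge3 : (3 <= m + k)%N.
Local Notation Ng := (homogeneous_dim m k gamma).
Hypothesis mu_box : forall r : R, 0 < r ->
  mu (@grushin_box R m k gamma r) = (2 ^+ (m + k) * r `^ Ng)%:E.
Implicit Types (f g w : space -> R) (z h : space).
Local Notation G := (grushin_energy mu gamma).
Notation dist2 f h := (transl mu (cst (1 : R)) f h).

Lemma homogeneous_dim_gt2 : 2 < Ng.
Proof.
rewrite /homogeneous_dim.
have : (3 <= m%:R + k%:R :> R) by rewrite -natrD ler_nat.
have : 0 <= gamma * k%:R by rewrite mulr_ge0// ltW.
by rewrite mulrDl mul1r; lra.
Qed.

Local Notation s := (Ng / (Ng - 2)).

Lemma sobolev_exp_gt0 : 0 < s.
Proof. by have := homogeneous_dim_gt2; move=> ?; rewrite divr_gt0; lra. Qed.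

Lemma sobolev_theta : [/\ 0 < 2 / Ng, 2 / Ng < 1 & s = (1 - 2 / Ng)^-1].
Proof.
have Ng2 := homogeneous_dim_gt2; have Ng0 : 0 < Ng by lra.
split; [by rewrite divr_gt0|by rewrite ltr_pdivrMr ?mul1r|].
by field; rewrite !gt_eqF//; lra.
Qed.

Lemma sobolev_exp_theta : s * (2 / Ng) = s - 1.
Proof.
by have Ng2 := homogeneous_dim_gt2; field; rewrite !gt_eqF//; lra.
Qed.

Lemma measurable_grushin_box r : measurable (@grushin_box R m k gamma r).
Proof.
pose A := \bigcap_(a in [set: 'I_m]) [set v : 'rV[R]_m | (`|v 0 a| <= r)%R].
pose B := \bigcap_(b in [set: 'I_k])
  [set v : 'rV[R]_k | (`|v 0 b| <= r `^ (1 + gamma))%R].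
have cm n (i : 'I_n) (c : R) : measurable [set v : 'rV[R]_n | (`|v 0 i| <= c)%R].
  rewrite (_ : mkset _ = (fun v : 'rV[R]_n => `|v 0 i|) @^-1` `]-oo, c]).
    rewrite -[X in measurable X]setTI.
    apply: (measurableT_comp (@normr_measurable R setT)) => //.
    exact: measurable_coord.
  by apply/seteqP; split => v /=; rewrite in_itv.
rewrite (_ : grushin_box _ _ = A `*` B).
  by apply: measurableX; apply: fin_bigcap_measurable => // i _; exact: cm.
apply/seteqP; split => [h [h1 h2]|h [h1 h2]].
  by split=> i _; [exact: h1|exact: h2].
by split=> i; [exact: h1|exact: h2].
Qed.

(** The box of radius [r] is twice as large as [A0], so that at least half of its
    vectors move a given point of [A1] out of [A0], where [f] drops from at least
    [1] to [0].  Averaged over the box, this bounds the measure of [A1] by the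
    norm of the differences of [f]. *)
Lemma level_separation f (A1 A0 : set space) (r : R) (a0 : R) :
  C1c f -> measurable A1 -> measurable A0 ->
  (forall z, A1 z -> 1 <= f z) -> (forall z, ~ A0 z -> f z = 0) ->
  mu A0 = a0%:E -> 0 < r -> 2 ^+ (m + k) * r `^ Ng = 2 * a0 -> 0 < a0 ->
  (mu A1 <= (2 * (4 ^+ (m + k) * 28 * r ^+ 2))%:E * G f)%E.
Proof.
move=> cf mA1 mA0 fA1 fA0 muA0 r0 rE a00.
pose B := @grushin_box R m k gamma r.
have mB : measurable B by exact: measurable_grushin_box.
pose T := [set p : space * space | [/\ A1 p.1, B p.2 & ~ A0 (p.1 + p.2)%R]].
have mT : measurable T.
  rewrite (_ : T = (A1 `*` B) `&` ((fun p : space * space => p.1 + p.2) @^-1` (~` A0))).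
    apply: measurableI; first exact: measurableX.
    rewrite -[X in measurable X]setTI; apply: measurable_add_pair => //.
    exact: measurableC.
  by apply/seteqP; split => p /=; [case|case=> -[]].
have sub_shift z : measurable ((fun h : space => h + z) @^-1` A0).
  by rewrite -[X in measurable X]setTI; apply: measurable_shift.
have lower z : A1 z -> (a0%:E <= mu (xsection T z))%E.
  move=> A1z.
  have -> : xsection T z = B `\` ((fun h : space => h + z) @^-1` A0).
    apply/seteqP; split => h.
      by rewrite /xsection/= inE => -[_ Bh /=]; rewrite addrC.
    by case => Bh /= A0h; rewrite /xsection/= inE; split => //=; rewrite addrC.
  rewrite -(@leeD2rE R a0%:E)//.
  have -> : (a0%:E + a0%:E = mu B)%E by rewrite mu_box// rE -EFinD; congr EFin; ring.
  rewrite -[X in (_ <= _ + X)%E]muA0 -(mu_shift z mA0).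
  rewrite -measureU; last 3 first.
  - by apply: measurableD => //; exact: sub_shift.
  - exact: sub_shift.
  - by apply/seteqP; split => h // [[_ ?]].
  apply: le_measure; rewrite ?inE.
  - exact: mB.
  - apply: measurableU; last exact: sub_shift.
    by apply: measurableD => //; exact: sub_shift.
  move=> h Bh; have [A0h|A0h] := pselect (A0 (h + z)); first by right.
  by left.
pose X := ((4 ^+ (m + k) * 28 * r ^+ 2)%:E * G f)%E.
have X0 : (0 <= X)%E.
  apply: mule_ge0; last exact: grushin_energy_ge0.
  by rewrite lee_fin mulr_ge0 ?sqr_ge0// mulr_ge0 ?exprn_ge0.
have upper h : B h -> (mu (ysection T h) <= X)%E.
  move=> Bh.
  apply: le_trans (dist2_box mu_shift mu_bounded gamma_gt0 m_ge1 cf r0 Bh).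
  have mTh : measurable (ysection T h) by exact: measurable_ysection.
  rewrite -[in leLHS](setIT (ysection T h)) -integral_indic; last 2 first.
  - exact: measurableT.
  - exact: mTh.
  apply: ge0_le_integralR.
  - exact: measurable_indic.
  - apply: measurable_transl; first exact: measurable_cst.
    exact: C1c_measurable.
  - by move=> z; rewrite indicE.
  - move=> z /=; rewrite indicE.
    have [|_] := boolP (z \in _); last by rewrite mulr_ge0 ?sqr_ge0.
    rewrite inE /ysection/= inE => -[/= A1z _ A0z].
    by rewrite (fA0 _ A0z) sub0r sqrrN mul1r exprn_ege1//; exact: fA1.
have a0E : (0 <= a0%:E)%E by rewrite lee_fin ltW.
have TB p : T p -> B p.2 by case.
have := tonelli_double_count mT mA1 mB a0E X0 lower upper TB.
rewrite mu_box// rE (mulrC 2) EFinM (muleC X) -muleA lee_pmul2l ?lte_fin//.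
by rewrite /X muleA -EFinM.
Qed.

Section levels.
Variable u : space -> R.
Hypothesis cu : C1c u.

Definition band (a b : R) : set space :=
  [set z : space | (a < u z ^+ 2 <= b)%R].

Definition above (a : R) : set space := [set z : space | (a < u z ^+ 2)%R].

Lemma measurable_sqr_u : measurable_fun setT (fun z : space => u z ^+ 2).
Proof. by apply: measurable_funX; exact: C1c_measurable. Qed.

Lemma measurable_band a b : measurable (band a b).
Proof.
rewrite (_ : band a b = (fun z => u z ^+ 2) @^-1` `]a, b]).
  by rewrite -[X in measurable X]setTI; apply: measurable_sqr_u.
by apply/seteqP; split => z /=; rewrite in_itv.
Qed.

Lemma measurable_above a : measurable (above a).
Proof.
rewrite (_ : above a = (fun z => u z ^+ 2) @^-1` `]a, +oo[).
  by rewrite -[X in measurable X]setTI; apply: measurable_sqr_u.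
by apply/seteqP; split => z /=; rewrite in_itv/= andbT.
Qed.

Definition band_energy (a b : R) : \bar R :=
  (\int[mu]_z (\1_(band a b) z * grushin_grad2 gamma u z)%:E)%E.

Lemma band_energy_ge0 a b : (0 <= band_energy a b)%E.
Proof.
by apply: integral_ge0 => z _; rewrite lee_fin mulr_ge0 ?grushin_grad2_ge0.
Qed.

Lemma measurable_band_grad a b : measurable_fun setT
  (fun z : space => \1_(band a b) z * grushin_grad2 gamma u z).
Proof.
apply: measurable_funM; first by apply: measurable_indic; exact: measurable_band.
exact: measurable_grushin_grad2.
Qed.

Lemma C1c_step (l : R) : 0 < l -> C1c (fun z => step (u z ^+ 2 / l)) /\
  forall i z, partial i (fun z => step (u z ^+ 2 / l)) z =
    step' (u z ^+ 2 / l) * (2 * u z / l) * partial i u z.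
Proof.
move=> l0.
pose Phi := fun x : R => step (x ^+ 2 / l).
pose Phi' := fun x : R => step' (x ^+ 2 / l) * (2 * x / l).
have dPhi (x : R) : is_derive x 1 Phi (Phi' x).
  apply: (@is_derive1_comp _ step (fun x => x ^+ 2 / l)).
    exact: is_derive_step.
  have := is_deriveZ l^-1 (is_deriveX 2 (is_derive_id x (1 : R))).
  rewrite (_ : _ \*: _ = fun x : R => x ^+ 2 / l); last first.
    by apply/funext => y; rewrite /= /GRing.scale/= mulrC.
  by move=> H; apply: (is_derive_eq H); rewrite /GRing.scale/= mulr1 expr1 mulrC.
have cPhi' : continuous Phi'.
  move=> x; apply: cvgM; last first.
    by apply: cvgMl; apply: cvgMr; exact: cvg_id.
  apply: (@continuous_comp _ _ _ (fun x : R => x ^+ 2 / l) step').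
    by apply: cvgMl; exact: exprn_continuous.
  exact: continuous_step'.
have Phi0 : Phi 0 = 0.
  by rewrite /Phi expr0n/= mul0r step0.
exact: (C1c_comp dPhi cPhi' Phi0 cu).
Qed.

(** The truncation varies only where [l < u ^ 2 < 2 l], and there the square of
    the derivative of [step (u ^ 2 / l)] in [u] is at most [4 (2 u / l) ^ 2]. *)
Lemma energy_step_le (l : R) : 0 < l ->
  (G (fun z => step (u z ^+ 2 / l)) <= (32 / l)%:E * band_energy l (2 * l))%E.
Proof.
move=> l0.
have [cv vE] := C1c_step l0.
rewrite -ge0_integralRZ; last 3 first.
- exact: measurable_band_grad.
- by rewrite divr_ge0 ?ltW.
- by move=> z; rewrite mulr_ge0 ?grushin_grad2_ge0.
apply: ge0_le_integralR.
- by apply: measurable_grushin_grad2; exact: cv.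
- by apply: measurable_funM => //; exact: measurable_band_grad.
- by move=> z; exact: grushin_grad2_ge0.
- move=> z /=; rewrite /grushin_grad2 !mulr_sumr; apply: ler_sum => i _.
  rewrite (vE i z); set d := step' _ * _.
  set w := grushin_weight gamma i z; set p := partial i u z.
  have -> : w ^+ 2 * (d * p) ^+ 2 = d ^+ 2 * (w * p) ^+ 2 by ring.
  have -> : 32 / l * (\1_(band l (2 * l)) z * (w ^+ 2 * p ^+ 2)) =
    32 / l * \1_(band l (2 * l)) z * (w * p) ^+ 2 by ring.
  apply: ler_wpM2r; first exact: sqr_ge0.
  rewrite /d exprMn.
  have := sqr_step'_le (u z ^+ 2 / l).
  rewrite ltr_pdivlMr// ltr_pdivrMr// mul1r => hs.
  rewrite indicE.
  have [hb|hb] := boolP ((l < u z ^+ 2) && (u z ^+ 2 < 2 * l)).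
    have -> : z \in band l (2 * l).
      by rewrite inE /band/=; case/andP: hb => -> /ltW ->.
    rewrite mulr1; rewrite hb mulr1 in hs.
    case/andP: hb => _ /ltW ub.
    have : (2 * u z / l) ^+ 2 <= 8 / l.
      rewrite exprMn exprVn exprMn ler_pdivrMr ?exprn_gt0//.
      rewrite (_ : 8 / l * l ^+ 2 = 8 * l); last by field; rewrite gt_eqF.
      lra.
    move=> hu; rewrite (_ : 32 / l = 4 * (8 / l)); last by ring.
    by apply: ler_pM => //; exact: sqr_ge0.
  rewrite (negbTE hb) mulr0 in hs.
  have -> : step' (u z ^+ 2 / l) ^+ 2 = 0 by apply/eqP; rewrite eq_le hs sqr_ge0.
  by rewrite mul0r mulr_ge0 ?divr_ge0 ?(ltW l0).
Qed.

Definition level_cst : R := 64 * (4 ^+ (m + k) * 28).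

Lemma level_cst_ge0 : 0 <= level_cst.
Proof. by rewrite /level_cst !mulr_ge0// exprn_ge0. Qed.

Lemma le_above (a b : R) : a <= b -> above b `<=` above a.
Proof. by move=> ab z; exact: le_lt_trans. Qed.

(** [level_separation] for the truncation of [u ^ 2] between the levels [l] and
    [2 l]: the radius of the box is a multiple of [a0 ^ (1 / Ng)]. *)
Lemma level_le (l a0 : R) : 0 < l -> mu (above l) = a0%:E ->
  (mu (above (2 * l)) <=
   (level_cst * a0 `^ (2 / Ng) / l)%:E * band_energy l (2 * l))%E.
Proof.
move=> l0 muA.
have l2 : l <= 2 * l by lra.
have Ng2 := homogeneous_dim_gt2.
have a0_ge0 : 0 <= a0 by rewrite -lee_fin -muA measure_ge0.
have [a00|] := ltP 0 a0; last first.
  move=> a0_le0; have a0E : a0 = 0 by apply/eqP; rewrite eq_le a0_le0.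
  apply: (@le_trans _ _ (mu (above l))).
    by apply: le_measure; rewrite ?inE; [exact: measurable_above..|exact: le_above].
  rewrite muA a0E; apply: mule_ge0; last exact: band_energy_ge0.
  by rewrite lee_fin mulr_ge0 ?invr_ge0 ?(ltW l0)// mulr_ge0 ?powR_ge0 ?level_cst_ge0.
pose r := (2 * a0 / 2 ^+ (m + k)) `^ Ng^-1.
have q0 : 0 < 2 * a0 / 2 ^+ (m + k) by rewrite divr_gt0 ?mulr_gt0 ?exprn_gt0.
have r0 : 0 < r by exact: powR_gt0.
have rE : 2 ^+ (m + k) * r `^ Ng = 2 * a0.
  rewrite -powRrM mulVf ?powRr1 ?(ltW q0)//; last by rewrite gt_eqF//; lra.
  by rewrite mulrC divfK// expf_neq0.
have r2 : r ^+ 2 <= a0 `^ (2 / Ng).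
  rewrite -powR_mulrn ?(ltW r0)// -powRrM (mulrC Ng^-1).
  apply: ge0_ler_powR; rewrite ?nnegrE ?(ltW q0)//.
    by rewrite divr_ge0//; lra.
  rewrite ler_pdivrMr ?exprn_gt0// mulrC ler_wpM2l//.
  by case: (m + k)%N N_ge3 => // n _; rewrite exprS ler_peMr// exprn_ege1// ler1n.
have [cv _] := C1c_step l0.
apply: (le_trans (level_separation cv (measurable_above (2 * l))
  (measurable_above l) _ _ muA r0 rE a00)).
- move=> z; rewrite /above/= => uz; rewrite step1// ler_pdivlMr//.
  exact: ltW.
- move=> z /negP; rewrite /above/= -leNgt => uz; rewrite step0//.
  by rewrite ler_pdivrMr// mul1r.
apply: (@le_trans _ _ ((2 * (4 ^+ (m + k) * 28 * r ^+ 2))%:E *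
    ((32 / l)%:E * band_energy l (2 * l)))%E).
  apply: lee_wpmul2l; last exact: energy_step_le.
  by rewrite lee_fin mulr_ge0// mulr_ge0 ?sqr_ge0// mulr_ge0 ?exprn_ge0.
rewrite muleA -EFinM; apply: lee_wpmul2r; first exact: band_energy_ge0.
rewrite lee_fin /level_cst.
rewrite (_ : _ * (32 / l) = 64 * (4 ^+ (m + k) * 28) * r ^+ 2 / l); last by ring.
apply: ler_wpM2r; first by rewrite invr_ge0 ltW.
by apply: ler_wpM2l => //; exact: level_cst_ge0.
Qed.

Lemma band_energyD (a b c : R) : a <= b -> b <= c ->
  (band_energy a b + band_energy b c = band_energy a c)%E.
Proof.
move=> ab bc; rewrite -ge0_integralRD; last 4 first.
- exact: measurable_band_grad.
- exact: measurable_band_grad.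
- by move=> z; rewrite mulr_ge0 ?grushin_grad2_ge0.
- by move=> z; rewrite mulr_ge0 ?grushin_grad2_ge0.
apply: eq_integral => z _; rewrite -mulrDl; congr (_ * _)%:E.
have bE x y : \1_(band x y) z = (x < u z ^+ 2 <= y)%R%:R :> R.
  rewrite indicE; congr (nat_of_bool _)%:R; apply/idP/idP; by rewrite inE.
rewrite !bE -natrD; congr (_%:R).
have [h1|h1] := leP (u z ^+ 2) b.
  by rewrite (le_trans h1 bc) !andbT addn0.
by rewrite (le_lt_trans ab h1) andbF add0n.
Qed.

Lemma sum_band_energy (l : R) n : 0 <= l ->
  (\sum_(j < n) band_energy (2 ^+ j * l) (2 ^+ j.+1 * l) <= G u)%E.
Proof.
move=> l0.
have -> : (\sum_(j < n) band_energy (2 ^+ j * l) (2 ^+ j.+1 * l) =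
    band_energy l (2 ^+ n * l))%E.
  elim: n => [|n ih].
    rewrite big_ord0 mul1r; apply/esym/integral0_eq => z _.
    rewrite indicE memNset ?mul0r// /band/= => /andP[h1].
    by rewrite leNgt h1.
  rewrite big_ord_recr/= ih band_energyD//.
    by rewrite ler_peMl// exprn_ege1// ler1n.
  by rewrite ler_wpM2r// exprS ler_peMl ?exprn_ge0// ler1n.
apply: ge0_le_integralR.
- exact: measurable_band_grad.
- exact: measurable_grushin_grad2.
- by move=> z; rewrite mulr_ge0 ?grushin_grad2_ge0.
- by move=> z; rewrite ler_piMl ?grushin_grad2_ge0.
Qed.

Lemma above_lty (l : R) : 0 <= l -> (mu (above l) < +oo)%E.
Proof.
move=> l0; have [M [_ _ _ uM]] := C1c_bounded cu.
apply: le_lt_trans (mu_bounded M); apply: le_measure; rewrite ?inE.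
- exact: measurable_above.
- exact: measurable_norm_le.
move=> z; rewrite /above/= => luz; rewrite leNgt; apply/negP => /uM uz0.
by move: luz; rewrite uz0 expr0n/= ltNge l0.
Qed.

(** Where [2 ^ j l < u ^ 2 <= 2 ^ (j + 1) l], the summand of index [j] suffices. *)
Lemma layer_cake (s l : R) n z : 0 < s -> 0 < l -> u z ^+ 2 <= 2 ^+ n * l ->
  (u z ^+ 2) `^ s <= l `^ s * \1_(above 0) z +
    \sum_(j < n) (2 `^ s * (2 ^+ j * l) `^ s * \1_(above (2 ^+ j * l)) z).
Proof.
move=> s0 l0; have aE a : \1_(above a) z = (a < u z ^+ 2)%R%:R :> R.
  by rewrite indicE; congr (nat_of_bool _)%:R; apply/idP/idP; rewrite inE.
elim: n => [|n ih].
  rewrite mul1r big_ord0 addr0 aE => ul.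
  have [u0|u0] := ltP 0 (u z ^+ 2).
    by rewrite mulr1; apply: ge0_ler_powR; rewrite ?nnegrE ?(ltW s0) ?(ltW l0) ?(ltW u0).
  have -> : u z ^+ 2 = 0 by apply/eqP; rewrite eq_le u0 sqr_ge0.
  by rewrite powR0 ?mulr0// gt_eqF.
rewrite big_ord_recr/= => ul.
have [uln|uln] := leP (u z ^+ 2) (2 ^+ n * l).
  by rewrite (le_trans (ih uln))// addrA lerDl !mulr_ge0 ?powR_ge0.
rewrite (aE (2 ^+ n * l)) uln mulr1 -powRM ?mulr_ge0 ?exprn_ge0 ?(ltW l0)//.
apply: (@le_trans _ _ ((2 * (2 ^+ n * l)) `^ s)).
  apply: ge0_ler_powR; rewrite ?nnegrE ?(ltW s0) ?sqr_ge0//.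
    by rewrite !mulr_ge0 ?exprn_ge0 ?(ltW l0).
  by rewrite mulrA -exprS.
rewrite addrA lerDr addr_ge0 ?mulr_ge0 ?powR_ge0// sumr_ge0// => j _.
by rewrite !mulr_ge0 ?powR_ge0.
Qed.

Definition chain_cst : R := 2 `^ s * level_cst.

(** The levels [2^j l] of [u ^ 2] satisfy a recursion in which only the energy
    of [u] between two consecutive levels enters, so that the sum of the
    recursions costs the energy of [u] once. *)
Lemma sum_levels (l e : R) n : 0 < l -> (G u <= e%:E)%E ->
  let S := \sum_(j < n) (2 ^+ j * l) `^ s * fine (mu (above (2 ^+ j * l))) in
  S <= l `^ s * fine (mu (above 0)) + chain_cst * e * S `^ (2 / Ng).
Proof.
move=> l0 Ge; case: n => [|n]; set S := (X in let _ := X in _); move=> /=.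
  have e0 : 0 <= e by rewrite -lee_fin (le_trans _ Ge)// grushin_energy_ge0.
  rewrite /S big_ord0 addr_ge0 ?mulr_ge0 ?powR_ge0 ?fine_ge0 ?measure_ge0//.
have Ng2 := homogeneous_dim_gt2.
have s0 := sobolev_exp_gt0.
have [th0 th1 thE] := sobolev_theta.
pose lam j := 2 ^+ j * l.
have lam0 j : 0 < lam j by rewrite mulr_gt0 ?exprn_gt0.
pose a j := fine (mu (above (lam j))).
have aE j : mu (above (lam j)) = (a j)%:E.
  by rewrite fineK// ge0_fin_numE ?measure_ge0// above_lty// ltW.
have a0 j : 0 <= a j by rewrite fine_ge0 ?measure_ge0.
pose g j := fine (band_energy (lam j) (lam j.+1)).
have gE j : band_energy (lam j) (lam j.+1) = (g j)%:E.
  rewrite fineK// ge0_fin_numE ?band_energy_ge0//.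
  apply: (@le_lt_trans _ _ e%:E); last exact: ltry.
  apply: le_trans Ge; apply: le_trans (sum_band_energy j.+1 (ltW l0)).
  rewrite big_ord_recr/= leeDr// sume_ge0// => i _; exact: band_energy_ge0.
have g0 j : 0 <= g j by rewrite fine_ge0 ?band_energy_ge0.
have sumg : \sum_(j < n) g j <= e.
  rewrite -lee_fin -sumEFin; under eq_bigr do rewrite -gE.
  exact: le_trans (sum_band_energy n (ltW l0)) Ge.
pose b j := lam j `^ s * a j.
have b0 j : 0 <= b j by rewrite mulr_ge0 ?powR_ge0.
have SE : S = \sum_(j < n.+1) b j by [].
have S0 : 0 <= S by rewrite SE sumr_ge0.
have bS j : (j <= n)%N -> b j <= S.
  by move=> jn; rewrite SE (bigD1 (Ordinal (jn : (j < n.+1)%N)))//= lerDl sumr_ge0.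
have step_b j : b j.+1 <= chain_cst * (b j `^ (2 / Ng) * g j).
  have lamS : lam j.+1 = 2 * lam j by rewrite /lam exprS mulrA.
  have := level_le (lam0 j) (aE j); rewrite -lamS aE gE -EFinM lee_fin => h.
  rewrite /b; apply: (le_trans (ler_wpM2l (powR_ge0 _ _) h)).
  rewrite lamS powRM ?(ltW (lam0 j))// powRM ?powR_ge0// /chain_cst.
  have -> : (lam j `^ s) `^ (2 / Ng) = lam j `^ s / lam j.
    rewrite -powRrM sobolev_exp_theta powRB ?(gt_eqF (lam0 j)) ?implybT//.
    by rewrite powRr1 ?(ltW (lam0 j)).
  by apply: le_of_eq; ring.
rewrite {1}SE big_ord_recl; apply: lerD.
  rewrite /b /lam mul1r ler_wpM2l ?powR_ge0//.
  rewrite /a /lam mul1r fine_le ?ge0_fin_numE ?measure_ge0 ?above_lty//.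
  - exact: ltW.
  - apply: le_measure; rewrite ?inE; [exact: measurable_above..|].
    by apply: le_above; exact: ltW.
apply: (@le_trans _ _ (\sum_(j < n) chain_cst * (S `^ (2 / Ng) * g j))).
  apply: ler_sum => j _; apply: (le_trans (step_b j)).
  rewrite ler_wpM2l ?mulr_ge0 ?powR_ge0 ?level_cst_ge0// ler_wpM2r//.
  apply: ge0_ler_powR; rewrite ?nnegrE ?bS ?(ltnW (ltn_ord j))//.
  by have [/ltW] := sobolev_theta.
rewrite -mulr_sumr -mulr_sumr -mulrA ler_wpM2l ?mulr_ge0 ?powR_ge0 ?level_cst_ge0//.
by rewrite mulrC ler_wpM2r ?powR_ge0.
Qed.

Definition sobolev_cst : R := 2 `^ s * (2 * chain_cst) `^ s.

(** The left-hand side is at most a multiple of the sum [S] over the levels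
    [2 ^ j l], which [sum_levels] bounds in terms of itself, up to the measure of
    the support of [u] times [l ^ s]. *)
Lemma sobolev_sqr (e : R) : (G u <= e%:E)%E ->
  (\int[mu]_z ((u z ^+ 2) `^ s)%:E <= (sobolev_cst * e `^ s)%:E)%E.
Proof.
move=> Ge; have Ng2 := homogeneous_dim_gt2.
have s0 := sobolev_exp_gt0.
have [th0 th1 thE] := sobolev_theta.
have e0 : 0 <= e by rewrite -lee_fin (le_trans _ Ge)// grushin_energy_ge0.
have c0 : 0 <= chain_cst by rewrite mulr_ge0 ?powR_ge0 ?level_cst_ge0.
have [M [M0 uM _ _]] := C1c_bounded cu.
pose M0' := fine (mu (above 0)).
have M0E : mu (above 0) = M0'%:E.
  by rewrite fineK// ge0_fin_numE ?measure_ge0 ?above_lty.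
have M0'0 : 0 <= M0' by rewrite fine_ge0 ?measure_ge0.
apply/lee_addgt0Pr => d d0.
pose K := 1 + 2 `^ s * 2.
have K0 : 0 < K by rewrite /K ltr_pwDl// mulr_ge0 ?powR_ge0.
(* The first level is so low that its contribution is at most [d]. *)
pose l := (d / (K * (M0' + 1))) `^ s^-1.
have d'0 : 0 < d / (K * (M0' + 1)) by rewrite divr_gt0// mulr_gt0// ltr_wpDl.
have l0 : 0 < l by exact: powR_gt0.
have lE : l `^ s = d / (K * (M0' + 1)).
  by rewrite -powRrM mulVf ?powRr1 ?(ltW d'0)// gt_eqF.
have [n Mn] : exists n, M ^+ 2 <= 2 ^+ n * l.
  exists (Num.bound (M ^+ 2 / l)).
  rewrite -ler_pdivrMr//; apply/ltW/(lt_le_trans (archi_boundP _)).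
    by rewrite divr_ge0 ?sqr_ge0// ltW.
  by rewrite -natrX ler_nat ltnW// ltn_expl.
pose S := \sum_(j < n) (2 ^+ j * l) `^ s * fine (mu (above (2 ^+ j * l))).
have S0 : 0 <= S.
  by apply: sumr_ge0 => j _; rewrite mulr_ge0 ?powR_ge0 ?fine_ge0 ?measure_ge0.
have SM : S <= 2 * (l `^ s * M0') + (2 * (chain_cst * e)) `^ s.
  rewrite {2}thE; apply: sublinear_bound => //.
  - by rewrite mulr_ge0 ?powR_ge0.
  - by rewrite mulr_ge0.
  - exact: sum_levels.
apply: (@le_trans _ _ (l `^ s * M0' + 2 `^ s * S)%:E).
  have mI a : measurable_fun setT (\1_(above a) : space -> R).
    by apply: measurable_indic; exact: measurable_above.
  apply: (@le_trans _ _ (\int[mu]_z (l `^ s * \1_(above 0) z + \sum_(j < n)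
      (2 `^ s * (2 ^+ j * l) `^ s * \1_(above (2 ^+ j * l)) z))%:E)%E).
    apply: ge0_le_integralR.
    - by apply: (measurableT_comp (measurable_powR s)); exact: measurable_sqr_u.
    - apply: measurable_funD; first exact: measurable_funM.
      by apply: measurable_sum => j; exact: measurable_funM.
    - by move=> z; exact: powR_ge0.
    - move=> z; apply: layer_cake => //; apply: le_trans Mn.
      by rewrite -real_normK ?num_real// ler_sqr ?nnegrE.
  have iI a : (\int[mu]_z (\1_(above a) z : R)%:E = mu (above a))%E.
    rewrite integral_indic; first by rewrite setIT.
      exact: measurableT.
    exact: measurable_above.
  have mterm j : measurable_fun setT (fun z : space =>
      2 `^ s * (2 ^+ j * l) `^ s * \1_(above (2 ^+ j * l)) z).
    exact: measurable_funM.
  have term0 j z :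
      0 <= 2 `^ s * (2 ^+ j * l) `^ s * \1_(above (2 ^+ j * l)) z :> R.
    by rewrite !mulr_ge0 ?powR_ge0.
  rewrite ge0_integralRD; last 4 first.
  - exact: measurable_funM.
  - by apply: measurable_sum => j; exact: mterm.
  - by move=> z; rewrite mulr_ge0 ?powR_ge0.
  - by move=> z; apply: sumr_ge0 => j _; exact: term0.
  rewrite EFinD; apply: leeD.
    rewrite (ge0_integralRZ _ (mI 0) (powR_ge0 _ _)); last first.
      by move=> z; rewrite indicE.
    by rewrite iI M0E.
  under eq_integral do rewrite -sumEFin.
  rewrite ge0_integral_sum//; last 2 first.
  - by move=> j; apply/measurable_EFinP; exact: mterm.
  - by move=> j z _; rewrite lee_fin term0.
  rewrite /S mulr_sumr -sumEFin; apply: lee_sum => j _.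
  rewrite (ge0_integralRZ _ (mI _)) ?mulr_ge0 ?powR_ge0//.
  have lam0 : 0 <= 2 ^+ j * l by rewrite mulr_ge0 ?exprn_ge0 ?(ltW l0).
  have aE : mu (above (2 ^+ j * l)) = (fine (mu (above (2 ^+ j * l))))%:E.
    by rewrite fineK// ge0_fin_numE ?measure_ge0 ?above_lty.
  by rewrite [X in (_ * X)%E]iI [X in (_ * X)%E]aE -EFinM mulrA.
rewrite -EFinD lee_fin.
have h1 : K * (l `^ s * M0') <= d.
  have M1 : 0 < M0' + 1 by rewrite ltr_wpDl.
  rewrite lE (_ : K * _ = d * (M0' / (M0' + 1))); last first.
    by field; rewrite !gt_eqF.
  by rewrite ler_piMr ?(ltW d0)// ler_pdivrMr// mul1r lerDl.
have h2 : 2 `^ s * (2 * (chain_cst * e)) `^ s = sobolev_cst * e `^ s.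
  by rewrite /sobolev_cst mulrA powRM ?mulr_ge0// mulrA.
rewrite -h2; apply: (@le_trans _ _ (l `^ s * M0' +
    2 `^ s * (2 * (l `^ s * M0') + (2 * (chain_cst * e)) `^ s))).
  by rewrite lerD2l ler_wpM2l ?powR_ge0.
rewrite mulrDr addrA addrC lerD2l; apply: le_trans h1.
by rewrite /K; apply: le_of_eq; ring.
Qed.

End levels.

End sobolev.

(** * Weighted Lebesgue spaces *)

Section fatou_bound.
Context d (T : measurableType d) (R : realType) (mu : {measure set T -> \bar R}).

Lemma fatou_bound (F_ : nat -> T -> R) (F : T -> R) (c : \bar R) :
  (forall n, measurable_fun setT (F_ n)) -> measurable_fun setT F ->
  (forall n x, 0 <= F_ n x) -> (forall x, 0 <= F x) ->
  (\forall x \ae mu, F_ n x @[n --> \oo] --> F x) ->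
  (\forall n \near \oo, (\int[mu]_x (F_ n x)%:E <= c)%E) ->
  (\int[mu]_x (F x)%:E <= c)%E.
Proof.
move=> mF_ mF F_0 F0 FF Fc.
have mE n : measurable_fun setT (EFin \o F_ n) by exact/measurable_EFinP.
apply: (@le_trans _ _ (\int[mu]_x limn_einf (fun n => (F_ n x)%:E))%E).
  apply: le_of_eq.
  apply: ae_eq_integral => //.
  - exact/measurable_EFinP.
  - apply: (measurableT_comp (f := -%E)) => //.
    apply: (@measurable_fun_limn_esup _ _ _ setT (fun n x => - (F_ n x)%:E)%E).
    by move=> n; apply: (measurableT_comp (f := -%E)) => //; exact: mE.
  - apply: filterS FF => x Fx _; apply/esym.
    by apply: (cvg_limn_einf_sup _).1; apply: cvg_EFin; [exact: nearW|exact: Fx].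
have E0 n x : setT x -> (0 <= (EFin \o F_ n) x)%E by rewrite /= lee_fin.
apply: (le_trans (@fatou _ _ _ mu setT measurableT _ mE E0)).
case: Fc => n0 _ Fc; rewrite limn_einf_lim.
apply: lime_le; first exact: is_cvg_einfs.
apply: nearW => n; apply: le_trans (Fc (maxn n n0) _); last exact: leq_maxr.
by apply: ereal_inf_lbound; exists (maxn n n0) => //=; exact: leq_maxl.
Qed.

End fatou_bound.

Lemma cvg_powR (R : realType) (p : R) (x_ : nat -> R) (x : R) : 0 < p ->
  (forall n, 0 <= x_ n) -> x_ n @[n --> \oo] --> x ->
  x_ n `^ p @[n --> \oo] --> x `^ p.
Proof.
move=> p0 x_0 xx.
have x0 : 0 <= x by apply: (cvgr_to_ge xx); exact: nearW.
have [xpos|] := ltP 0 x.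
  suff cp : {for x, continuous (fun a : R => a `^ p)}.
    exact: (cvg_comp _ _ xx cp).
  apply/differentiable_continuous/derivable1_diffP.
  by apply: derivable_powR; rewrite in_itv/= xpos.
move=> xle0; have {xle0 x0} x0 : x = 0 by apply/eqP; rewrite eq_le xle0.
rewrite x0 powR0 ?gt_eqF//; rewrite x0 in xx.
apply/cvgrPdist_lt => e e0.
have t0 : 0 < e `^ p^-1 by exact: powR_gt0.
move/cvgrPdist_lt : xx => /(_ _ t0); apply: filterS => n.
rewrite !sub0r !normrN !ger0_norm ?powR_ge0// => xe.
rewrite [ltRHS](_ : e = (e `^ p^-1) `^ p); last first.
  by rewrite -powRrM mulVf ?gt_eqF// powRr1 ?ltW.
by apply: gt0_ltr_powR; rewrite ?nnegrE ?(ltW t0).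
Qed.

Section weighted_Lp.
Context d (T : measurableType d) (R : realType).
Variable mu : {measure set T -> \bar R}.
Variables (Q : T -> R) (p : R).
Hypothesis mQ : measurable_fun setT Q.
Hypothesis Q_gt0 : forall x, 0 < Q x.
Hypothesis p_gt0 : 0 < p.
Implicit Types u v f : T -> R.

(** The [p]-th power of the norm of the space. *)
Definition Lp_mass u : \bar R := (\int[mu]_x (Q x * `|u x| `^ p)%:E)%E.

Lemma Lp_mass_ge0 u : (0 <= Lp_mass u)%E.
Proof.
by apply: integral_ge0 => x _; rewrite lee_fin mulr_ge0 ?powR_ge0 ?(ltW (Q_gt0 x)).
Qed.

Lemma measurable_Lp_density u : measurable_fun setT u ->
  measurable_fun setT (fun x => Q x * `|u x| `^ p).
Proof.
move=> mu'; apply: measurable_funM => //.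
apply: (measurableT_comp (measurable_powR p)).
exact: measurableT_comp.
Qed.

Lemma Lp_density_ge0 u x : 0 <= Q x * `|u x| `^ p.
Proof. by rewrite mulr_ge0 ?powR_ge0 ?(ltW (Q_gt0 x)). Qed.

Lemma powR_sum3_le (a b c : R) : 0 <= a -> 0 <= b -> 0 <= c ->
  (a + b + c) `^ p <= 3 `^ p * (a `^ p + b `^ p + c `^ p).
Proof.
move=> a0 b0 c0.
pose M := Num.max a (Num.max b c).
have M0 : 0 <= M by rewrite /M le_max a0.
have abcM : a + b + c <= 3 * M.
  have aM : a <= M by rewrite /M le_max lexx.
  have bM : b <= M by rewrite /M !le_max lexx orbT.
  have cM : c <= M by rewrite /M !le_max lexx !orbT.
  lra.
apply: (@le_trans _ _ ((3 * M) `^ p)).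
  by apply: ge0_ler_powR; rewrite ?nnegrE ?addr_ge0 ?mulr_ge0 ?(ltW p_gt0).
rewrite powRM// ler_wpM2l ?powR_ge0//.
have pa := powR_ge0 a p; have pb := powR_ge0 b p; have pc := powR_ge0 c p.
rewrite /M; have [_|_] := leP b c; have [_|_] := leP a _; lra.
Qed.

Lemma Lp_mass3 u v f (a : T -> R) : measurable_fun setT u ->
  measurable_fun setT v -> measurable_fun setT f ->
  (forall x, `|a x| <= `|u x| + `|v x| + `|f x|) -> measurable_fun setT a ->
  (Lp_mass a <= (3 `^ p)%:E * (Lp_mass u + Lp_mass v + Lp_mass f))%E.
Proof.
move=> mu' mv mf auvf ma.
have := (measurable_Lp_density mu', measurable_Lp_density mv,
  measurable_Lp_density mf) => -[[m1 m2] m3].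
rewrite -ge0_integralRD//; try by move=> x; exact: Lp_density_ge0.
rewrite -ge0_integralRD//; last 3 first.
- exact: measurable_funD.
- by move=> x; rewrite addr_ge0 ?Lp_density_ge0.
- by move=> x; exact: Lp_density_ge0.
rewrite -ge0_integralRZ ?powR_ge0//; last 2 first.
- by apply: measurable_funD => //; exact: measurable_funD.
- by move=> x; rewrite !addr_ge0 ?Lp_density_ge0.
apply: ge0_le_integralR.
- exact: measurable_Lp_density.
- by apply: measurable_funM => //; apply: measurable_funD => //; exact: measurable_funD.
- by move=> x; exact: Lp_density_ge0.
- move=> x; rewrite -!mulrDr mulrCA ler_wpM2l ?(ltW (Q_gt0 x))//.
  apply: le_trans (powR_sum3_le _ _ _) => //.
  by apply: ge0_ler_powR; rewrite ?nnegrE ?addr_ge0 ?(ltW p_gt0).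
Qed.

Lemma Lp_mass_eq0 u : measurable_fun setT u -> Lp_mass u = 0%E ->
  \forall x \ae mu, u x = 0.
Proof.
move=> mu' u0.
have : ae_eq mu setT (fun x => (Q x * `|u x| `^ p)%:E) (cst 0%E).
  apply/ae_eq_integral_abs => //.
    by apply/measurable_EFinP; exact: measurable_Lp_density.
  rewrite -u0; apply: eq_integral => x _ /=.
  by rewrite ger0_norm// Lp_density_ge0.
apply: filterS => x /(_ I) [] /eqP.
rewrite mulf_eq0 (gt_eqF (Q_gt0 x))/= powR_eq0 normr_eq0 => /andP[/eqP].
by [].
Qed.

Lemma Lp_mass0 : Lp_mass (cst 0) = 0%E.
Proof.
apply: integral0_eq => x _ /=.
by rewrite normr0 powR0 ?mulr0// gt_eqF.
Qed.

Lemma Lp_massZ (c : R) u : measurable_fun setT u ->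
  Lp_mass (fun x => c * u x) = ((`|c| `^ p)%:E * Lp_mass u)%E.
Proof.
move=> mu'; rewrite -ge0_integralRZ ?powR_ge0//; last 2 first.
- exact: measurable_Lp_density.
- by move=> x; exact: Lp_density_ge0.
by apply: eq_integral => x _; rewrite normrM powRM// mulrCA.
Qed.

(** A rate for which [2 ^ (n p) * fast n] is summable. *)
Definition fast (n : nat) : R := (2 ^- n) `^ p * (1 / (2 ^ n.+1)%:R).

(** Consecutive distances that decay fast enough make a sequence converge at
    almost every point: the sum over [n] of
    [2 ^ (n p) Q |u (n + 1) - u n| ^ p] is integrable, hence finite almost
    everywhere, and there the increments decay geometrically. *)
Lemma fast_cvg (u : nat -> T -> R) : (forall n, measurable_fun setT (u n)) ->
  (forall n, (Lp_mass (u n.+1 \- u n)%R <= (fast n)%:E)%E) ->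
  exists2 f : T -> R, measurable_fun setT f &
    \forall x \ae mu, u n x @[n --> \oo] --> f x.
Proof.
move=> mu' ufast.
pose D n x := (2 ^+ n) `^ p * (Q x * `|u n.+1 x - u n x| `^ p).
have D0 n x : 0 <= D n x.
  by rewrite mulr_ge0 ?powR_ge0// mulr_ge0 ?powR_ge0 ?(ltW (Q_gt0 x)).
have mdens n : measurable_fun setT (fun x => Q x * `|u n.+1 x - u n x| `^ p).
  by apply: (@measurable_Lp_density (u n.+1 \- u n)); exact: measurable_funB.
have mD n : measurable_fun setT (D n) by exact: measurable_funM.
have mDE n : measurable_fun setT (fun x => (D n x)%:E) by exact/measurable_EFinP.
pose h x : \bar R := (\sum_(0 <= n <oo) (D n x)%:E)%E.
have h0 x : (0 <= h x)%E.
  by apply: nneseries_ge0 => n _ _; rewrite lee_fin.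
have hint : (\int[mu]_x h x <= 1)%E.
  rewrite integral_nneseries//; last by move=> n x _; rewrite lee_fin.
  have <- : (\sum_(0 <= n <oo) (1 / (2 ^ (n + 1))%:R : R)%:E = 1)%E.
    have := @cvg_geometric_eseries_half R 1 0; rewrite divr1 => /cvg_lim <-//.
  apply: lee_nneseries => n _.
    by move=> _; apply: integral_ge0 => x _; rewrite lee_fin.
  rewrite ge0_integralRZ ?powR_ge0//; last first.
    by move=> x; exact: (Lp_density_ge0 (u n.+1 \- u n)).
  apply: (le_trans (lee_wpmul2l _ (ufast n))); first by rewrite lee_fin powR_ge0.
  rewrite -EFinM lee_fin /fast mulrA -powRM ?exprn_ge0 ?invr_ge0 ?exprn_ge0//.
  by rewrite mulfV ?expf_neq0// powR1 mul1r addn1.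
have mh : measurable_fun setT h.
  by apply: ge0_emeasurable_sum => // n x _ _; rewrite lee_fin.
have ih : mu.-integrable setT h.
  apply/integrableP; split => //.
  under eq_integral do rewrite gee0_abs//.
  by rewrite (le_lt_trans hint)// ltry.
have ucvg : \forall x \ae mu, cvgn (u ^~ x).
  apply: filterS (integrable_ae measurableT ih) => x /(_ I) hx.
  have Dh n : D n x <= fine (h x).
    rewrite -lee_fin fineK//.
    apply: le_trans (nneseries_lim_ge n.+1 _).
      rewrite big_nat_recr//= leeDr// sume_ge0// => i _.
      by rewrite lee_fin.
    by move=> i _ _; rewrite lee_fin.
  have H0 : 0 <= fine (h x) by rewrite (le_trans (D0 0%N x)).
  pose L := (fine (h x) / Q x) `^ p^-1.
  have incr n : `|u n.+1 x - u n x| <= L * 2 ^- n.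
    rewrite ler_pdivlMr ?exprn_gt0//.
    have t0 : 0 <= `|u n.+1 x - u n x| * 2 ^+ n by rewrite mulr_ge0 ?exprn_ge0.
    rewrite [leLHS](_ : _ = ((`|u n.+1 x - u n x| * 2 ^+ n) `^ p) `^ p^-1); last first.
      by rewrite -powRrM mulfV ?gt_eqF// powRr1.
    apply: ge0_ler_powR.
    - by rewrite invr_ge0 ltW.
    - by rewrite nnegrE powR_ge0.
    - by rewrite nnegrE divr_ge0// ltW.
    rewrite ler_pdivlMr// powRM ?exprn_ge0//.
    apply: le_trans (Dh n); rewrite /D; apply: le_of_eq.
    by ring.
  have cs : cvgn (series (telescope (u ^~ x))).
    apply: normed_cvg.
    apply: (@series_le_cvg _ _ (geometric L 2^-1)).
    - by move=> n; exact: normr_ge0.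
    - by move=> n; rewrite /= mulr_ge0 ?powR_ge0 ?exprn_ge0 ?invr_ge0.
    - by move=> n; rewrite /= exprVn; exact: incr.
    - by apply: is_cvg_geometric_series; rewrite ger0_norm ?invf_lt1 ?ltr1n ?invr_ge0.
  rewrite (_ : u ^~ x = fun n => u 0%N x + series (telescope (u ^~ x)) n).
    by apply: is_cvgD => //; exact: is_cvg_cst.
  by apply/funext => n; exact: (eq_sum_telescope (u ^~ x)).
case: ucvg => A [mA A0 uA].
pose v n x := u n x * \1_(~` A) x.
have mv n : measurable_fun setT (v n).
  by apply: measurable_funM => //; apply: measurable_indic; exact: measurableC.
have vcvg x : cvgn (v ^~ x).
  have [Ax|Ax] := pselect (A x).
    rewrite (_ : v ^~ x = cst 0); first exact: is_cvg_cst.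
    by apply/funext => n; rewrite /v indicE memNset ?mulr0//; apply.
  rewrite (_ : v ^~ x = u ^~ x).
    by apply: contrapT => /uA.
  by apply/funext => n; rewrite /v indicE mem_set ?mulr1.
exists (fun x => limn (v ^~ x)).
  by apply: (@measurable_fun_cvg _ _ _ _ v) => // x _; exact: vcvg.
exists A; split => // x /=; apply: contra_notP => Ax.
have <- : v ^~ x = u ^~ x.
  by apply/funext => n; rewrite /v indicE mem_set ?mulr1.
exact: vcvg.
Qed.

End weighted_Lp.

(** * Maps from a completion into a weighted Lebesgue space *)

Section completion_embedding.
Context d (T : measurableType d) (R : realType).
Variable mu : {measure set T -> \bar R}.
Variables (Q : T -> R) (p : R).
Hypothesis mQ : measurable_fun setT Q.
Hypothesis Q_gt0 : forall x, 0 < Q x.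
Hypothesis p_gt0 : 0 < p.
Variables (dom : set (T -> R)) (E : completeNormedModType R).
Variables (iota : (T -> R) -> E) (K : R).
Hypothesis K_ge0 : 0 <= K.
Hypothesis dom_nonempty : dom (cst 0).
Hypothesis dom_lin : forall (a : R) u v, dom u -> dom v ->
  dom (fun x => a * u x + v x).
Hypothesis dom_measurable : forall u, dom u -> measurable_fun setT u.
Hypothesis iota_lin : forall (a : R) u v, dom u -> dom v ->
  iota (fun x => a * u x + v x) = a *: iota u + iota v.
Hypothesis iota_dense : closure (iota @` dom) = setT.
Local Notation mass := (Lp_mass mu Q p).
Hypothesis mass_le : forall u, dom u -> (mass u <= (K * `|iota u| `^ p)%:E)%E.
Implicit Types (e : E) (u v f : T -> R).

Lemma iota_approx e (t : R) : 0 < t -> exists2 u, dom u & `|e - iota u| < t.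
Proof.
move=> t0; have : closure (iota @` dom) e by rewrite iota_dense.
move=> /(_ (ball e t)) [|x [[u du <-]]]; first exact: nbhsx_ballx.
by rewrite -ball_normE/= => ?; exists u.
Qed.

Lemma dom_sub u v : dom u -> dom v ->
  dom (u \- v) /\ iota (u \- v) = iota u - iota v.
Proof.
move=> du dv; have -> : u \- v = (fun x => -1 * v x + u x).
  by apply/funext => x /=; rewrite mulN1r addrC.
by split; [exact: dom_lin|rewrite iota_lin// scaleN1r addrC].
Qed.

Lemma powR_small (C e : R) : 0 <= C -> 0 < e ->
  exists2 t : R, 0 < t & C * t `^ p <= e.
Proof.
move=> C0 e0; have C1 : 0 < C + 1 by rewrite ltr_wpDl.
have q0 : 0 < e / (C + 1) by rewrite divr_gt0.
exists ((e / (C + 1)) `^ p^-1); first exact: powR_gt0.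
rewrite -powRrM mulVf ?gt_eqF// powRr1 ?(ltW q0)//.
by rewrite mulrCA ler_piMr ?(ltW e0)// ler_pdivrMr// mul1r lerDl.
Qed.

Lemma mass_eq0 u (C : R) : 0 <= C -> measurable_fun setT u ->
  (forall t, 0 < t -> (mass u <= (C * t `^ p)%:E)%E) ->
  \forall x \ae mu, u x = 0.
Proof.
move=> C0 mu' uC; apply: (@Lp_mass_eq0 _ _ _ mu Q p) => //.
apply/eqP; rewrite eq_le Lp_mass_ge0// andbT.
apply/lee_addgt0Pr => e e0; rewrite add0e.
have [t t0 te] := powR_small C0 e0.
by rewrite (le_trans (uC t t0))// lee_fin.
Qed.

(** The function that corresponds to [e] is characterised by its distances to
    the functions of [dom], which have to be the expected ones.  With a
    strict inequality for [t] the property passes to limits in [e] at once. *)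
Definition represents e f := measurable_fun setT f /\
  forall u (t : R), dom u -> `|e - iota u| < t ->
    (mass (f \- u)%R <= (K * t `^ p)%:E)%E.

(** Approximations of an element with these errors have distances of the rate
    [fast]. *)
Definition delta (n : nat) : R := (fast p n / (K + 1)) `^ p^-1 / 2.

Lemma fast_gt0 n : 0 < fast p n.
Proof.
by rewrite mulr_gt0 ?powR_gt0 ?invr_gt0 ?exprn_gt0// divr_gt0// ltr0n expn_gt0.
Qed.

Lemma fast_le n : fast p n.+1 <= fast p n.
Proof.
rewrite /fast; apply: ler_pM; rewrite ?powR_ge0 ?divr_ge0//.
  apply: ge0_ler_powR; rewrite ?nnegrE ?invr_ge0 ?exprn_ge0 ?(ltW p_gt0)//.
  by rewrite lef_pV2 ?posrE ?exprn_gt0// ler_weXn2l// ler1n.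
rewrite !div1r lef_pV2 ?posrE ?ltr0n ?expn_gt0// ler_nat.
by rewrite leq_exp2l.
Qed.

Lemma fast_le1 n : fast p n <= 2 ^- n.
Proof.
rewrite /fast -[leRHS]mul1r; apply: ler_pM; rewrite ?powR_ge0 ?divr_ge0//.
  apply: (@le_trans _ _ (1 `^ p)); last by rewrite powR1.
  apply: ge0_ler_powR.
  - exact: ltW.
  - by rewrite nnegrE invr_ge0 exprn_ge0.
  - by rewrite nnegrE.
  by rewrite invf_le1 ?exprn_gt0// exprn_ege1// ler1n.
rewrite div1r lef_pV2 ?posrE ?exprn_gt0 ?ltr0n ?expn_gt0//.
by rewrite -natrX ler_nat leq_exp2l.
Qed.

Lemma delta_gt0 n : 0 < delta n.
Proof.
by rewrite divr_gt0// powR_gt0// divr_gt0 ?fast_gt0// ltr_wpDl.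
Qed.

Lemma delta_mass n (t : R) : t <= 2 * delta n -> 0 <= t -> K * t `^ p <= fast p n.
Proof.
move=> td t0; have K1 : 0 < K + 1 by rewrite ltr_wpDl.
have q0 : 0 < fast p n / (K + 1) by rewrite divr_gt0 ?fast_gt0.
apply: (@le_trans _ _ (K * (fast p n / (K + 1)))).
  apply: ler_wpM2l => //.
  have {td} : t <= (fast p n / (K + 1)) `^ p^-1.
    by rewrite (le_trans td)// /delta mulrC divfK.
  move=> td; rewrite [leRHS](_ : _ = ((fast p n / (K + 1)) `^ p^-1) `^ p).
    by apply: ge0_ler_powR; rewrite ?nnegrE ?powR_ge0// ltW.
  by rewrite -powRrM mulVf ?gt_eqF// powRr1 ?ltW.
by rewrite mulrCA ler_piMr ?(ltW (fast_gt0 n))// ler_pdivrMr// mul1r lerDl.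
Qed.

Lemma delta_le n : delta n.+1 <= delta n.
Proof.
have K1 : 0 < K + 1 by rewrite ltr_wpDl.
rewrite ler_wpM2r ?invr_ge0//; apply: ge0_ler_powR.
- by rewrite invr_ge0 ltW.
- by rewrite nnegrE divr_ge0 ?(ltW K1) ?(ltW (fast_gt0 _)).
- by rewrite nnegrE divr_ge0 ?(ltW K1) ?(ltW (fast_gt0 _)).
by rewrite ler_wpM2r ?fast_le// invr_ge0 ltW.
Qed.

Lemma delta_le_geo n : delta n <= 2 ^- n.
Proof.
have K1 : 0 < K + 1 by rewrite ltr_wpDl.
apply: (@le_trans _ _ ((fast p n / (K + 1)) `^ p^-1)).
  by rewrite ler_pdivrMr// ler_peMr ?powR_ge0// ler1n.
apply: (@le_trans _ _ (((2 ^- n) `^ p) `^ p^-1)).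
  apply: ge0_ler_powR.
  - by rewrite invr_ge0 ltW.
  - by rewrite nnegrE divr_ge0 ?(ltW K1) ?(ltW (fast_gt0 _)).
  - by rewrite nnegrE powR_ge0.
  rewrite ler_pdivrMr// /fast; apply: ler_wpM2l; first exact: powR_ge0.
  rewrite (@le_trans _ _ 1)// ?lerDr// div1r invf_le1 ?ltr0n ?expn_gt0//.
  by rewrite ler1n expn_gt0.
by rewrite -powRrM mulfV ?powRr1 ?gt_eqF// invr_ge0 exprn_ge0.
Qed.

(** The limit of a fast sequence of approximations of [e]; the bounds on the
    distances pass to it by Fatou's lemma. *)
Lemma represents_exists e : exists (f : T -> R) (u_ : nat -> T -> R), [/\ represents e f,
  (forall n, dom (u_ n)), (iota (u_ n) @[n --> \oo] --> e) &
  \forall x \ae mu, u_ n x @[n --> \oo] --> f x].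
Proof.
have /choice[u_ u_P] : forall n, exists u, dom u /\ `|e - iota u| < delta n.
  by move=> n; have [u du ue] := iota_approx e (delta_gt0 n); exists u.
have du n : dom (u_ n) by have [] := u_P n.
have ue n : `|e - iota (u_ n)| < delta n by have [] := u_P n.
have dist n i : (n <= i)%N -> `|e - iota (u_ i)| < delta n.
  move=> ni; apply: (lt_le_trans (ue i)).
  elim: i ni => [|i ih]; first by rewrite leqn0 => /eqP ->.
  rewrite leq_eqVlt => /predU1P[->//|ni].
  exact: le_trans (delta_le i) (ih ni).
have mu_ n : measurable_fun setT (u_ n) by exact: dom_measurable.
have ufast n : (mass (u_ n.+1 \- u_ n)%R <= (fast p n)%:E)%E.
  have [dd iE] := dom_sub (du n.+1) (du n).
  apply: (le_trans (mass_le dd)); rewrite lee_fin iE; apply: delta_mass => //.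
  have := dist n n.+1 (leqnSn n); have := ue n.
  have : `|iota (u_ n.+1) - iota (u_ n)| <=
      `|e - iota (u_ n.+1)| + `|e - iota (u_ n)|.
    rewrite (_ : iota _ - iota (u_ n) =
      (e - iota (u_ n)) - (e - iota (u_ n.+1))); last first.
      by rewrite opprB [RHS]addrC subrKA.
    by rewrite (le_trans (ler_normB _ _))// addrC.
  lra.
have [f mf uf] := fast_cvg mQ Q_gt0 p_gt0 mu_ ufast.
have ucvg : iota (u_ n) @[n --> \oo] --> e.
  apply/cvgrPdist_lt => t t0.
  have : 2 ^- n @[n --> \oo] --> (0 : R).
    under eq_fun do rewrite -exprVn.
    by apply: cvg_expr; rewrite ger0_norm ?invf_lt1 ?ltr1n ?invr_ge0.
  move/cvgrPdist_lt => /(_ t t0); apply: filterS => n.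
  rewrite sub0r normrN ger0_norm ?invr_ge0 ?exprn_ge0// => nt.
  by rewrite (lt_trans (ue n))// (le_lt_trans (delta_le_geo n)).
exists f, u_; split => //; split => // u t dut eut.
have mfu : measurable_fun setT (f \- u).
  by apply: measurable_funB => //; exact: dom_measurable.
apply: (@fatou_bound _ _ _ mu (fun n x => Q x * `|(u_ n \- u) x| `^ p)).
- move=> n; apply: measurable_Lp_density => //.
  by apply: measurable_funB => //; exact: dom_measurable.
- exact: measurable_Lp_density.
- by move=> n x; rewrite mulr_ge0 ?powR_ge0 ?(ltW (Q_gt0 x)).
- by move=> x; rewrite mulr_ge0 ?powR_ge0 ?(ltW (Q_gt0 x)).
- apply: filterS uf => x ux; apply: cvgM; first exact: cvg_cst.
  apply: cvg_powR => //; apply: cvg_norm; apply: cvgB; first exact: ux.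
  exact: cvg_cst.
have : \forall n \near \oo, `|iota (u_ n) - iota u| < t.
  have /cvgrPdist_lt : iota (u_ n) - iota u @[n --> \oo] --> e - iota u.
    by apply: cvgB => //; exact: cvg_cst.
  move=> /(_ (t - `|e - iota u|)); rewrite subr_gt0 => /(_ eut).
  apply: filterS => n hn.
  have := ler_normB (e - iota u) (e - iota u - (iota (u_ n) - iota u)).
  by rewrite opprB addrC subrK; lra.
apply: filterS => n nt; have [dd iE] := dom_sub (du n) dut.
apply: (le_trans (mass_le dd)); rewrite lee_fin iE ler_wpM2l//.
by apply: ge0_ler_powR; rewrite ?nnegrE ?(ltW p_gt0) ?(ltW nt)// (le_trans _ (ltW nt)).
Qed.

(** The difference of both sides has a small distance to a function of [dom] that
    is close to [a *: e + e'], hence no mass. *)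
Lemma represents_lin (a : R) e e' f f' f'' :
  represents e f -> represents e' f' -> represents (a *: e + e') f'' ->
  \forall x \ae mu, f'' x = a * f x + f' x.
Proof.
move=> [mf ef] [mf' ef'] [mf'' ef''].
pose C := 3 `^ p * (K * (`|a| + 1) `^ p + `|a| `^ p * K + K).
have C0 : 0 <= C.
  by rewrite mulr_ge0 ?powR_ge0// !addr_ge0// mulr_ge0 ?powR_ge0.
pose w x := f'' x - (a * f x + f' x).
have mw : measurable_fun setT w.
  by apply: measurable_funB => //; apply: measurable_funD => //; exact: measurable_funM.
suff : \forall x \ae mu, w x = 0.
  by apply: filterS => x /eqP; rewrite subr_eq0 => /eqP.
apply: (mass_eq0 C0 mw) => t t0.
have [u du eu] := iota_approx e t0; have [v dv ev] := iota_approx e' t0.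
have duv := dom_lin a du dv.
have h1 : `|a *: e + e' - iota (fun x => a * u x + v x)| < (`|a| + 1) * t.
  rewrite iota_lin// opprD addrACA -scalerBr.
  apply: (le_lt_trans (ler_normD _ _)); rewrite normrZ mulrDl mul1r.
  by apply: ler_ltD => //; rewrite ler_wpM2l// ltW.
have m1 : measurable_fun setT (f'' \- (fun x => a * u x + v x)).
  by apply: measurable_funB => //; exact: dom_measurable.
have m2 : measurable_fun setT (f \- u).
  by apply: measurable_funB => //; exact: dom_measurable.
have m3 : measurable_fun setT (f' \- v).
  by apply: measurable_funB => //; exact: dom_measurable.
have m2a : measurable_fun setT (fun x => a * (f \- u) x) by exact: measurable_funM.
apply: (le_trans (@Lp_mass3 _ _ _ mu Q p mQ Q_gt0 p_gt0 _ _ _ w m1 m2a m3 _ mw)).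
  move=> x /=; rewrite /w.
  rewrite (_ : f'' x - (a * f x + f' x) =
    (f'' x - (a * u x + v x)) - a * (f x - u x) - (f' x - v x)).
    by rewrite (le_trans (ler_normB _ _))// lerD2r ler_normB.
  ring.
rewrite Lp_massZ//.
have k1 := ef'' _ _ duv h1; have k2 := ef _ _ du eu; have k3 := ef' _ _ dv ev.
apply: (@le_trans _ _ ((3 `^ p)%:E * ((K * ((`|a| + 1) * t) `^ p)%:E +
    (`|a| `^ p)%:E * (K * t `^ p)%:E + (K * t `^ p)%:E))%E).
  apply: lee_wpmul2l; first by rewrite lee_fin powR_ge0.
  apply: leeD k3; apply: leeD k1 _; apply: lee_wpmul2l k2.
  by rewrite lee_fin powR_ge0.
rewrite [leLHS](_ : _ = (3 `^ p * (K * ((`|a| + 1) * t) `^ p +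
    `|a| `^ p * (K * t `^ p) + K * t `^ p))%:E)//.
rewrite lee_fin /C powRM ?addr_ge0 ?(ltW t0)//.
by apply: le_of_eq; ring.
Qed.

Lemma represents_dom u : dom u -> represents (iota u) u.
Proof.
move=> du; split; first exact: dom_measurable.
move=> v t dv uv; have [dd iE] := dom_sub du dv.
apply: (le_trans (mass_le dd)); rewrite lee_fin iE ler_wpM2l//.
by apply: ge0_ler_powR; rewrite ?nnegrE ?(ltW p_gt0) ?(ltW uv)// (le_trans _ (ltW uv)).
Qed.

Lemma iota0 : iota (cst 0) = 0.
Proof.
have := iota_lin (-1) dom_nonempty dom_nonempty.
rewrite scaleN1r addNr (_ : (fun _ => _) = cst 0)//.
by apply/funext => x /=; rewrite mulr0 addr0.
Qed.

Lemma represents_unique e f f' : represents e f -> represents e f' ->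
  \forall x \ae mu, f x = f' x.
Proof.
move=> ef ef'.
have z0 : represents 0 (cst 0) by rewrite -iota0; exact: represents_dom.
have := @represents_lin 1 e 0 f (cst 0) f' ef z0.
rewrite scale1r addr0 => /(_ ef'); apply: filterS => x ->.
by rewrite mul1r addr0.
Qed.

Lemma represents_bounded e f : represents e f ->
  (mass f <= (K * (2 * `|e|) `^ p)%:E)%E.
Proof.
move=> [mf ef].
have small (t : R) : `|e| < t -> (mass f <= (K * t `^ p)%:E)%E.
  move=> et; have := ef (cst 0) t dom_nonempty.
  rewrite iota0 subr0 => /(_ et).
  by rewrite (_ : f \- cst 0 = f)//; apply/funext => x /=; rewrite subr0.
have [e0|e0] := ltP 0 `|e|; first by apply: small; lra.
have {}e0 : `|e| = 0 by apply/eqP; rewrite eq_le e0 normr_ge0.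
rewrite e0 mulr0 powR0 ?gt_eqF// mulr0.
apply/lee_addgt0Pr => r r0; rewrite add0e.
have [t t0 td] := powR_small K_ge0 r0.
by rewrite (le_trans (small t _)) ?e0// lee_fin.
Qed.

Theorem embedding_exists : exists J : E -> T -> R, [/\
  forall e, represents e (J e),
  forall (a : R) e e', \forall x \ae mu, J (a *: e + e') x = a * J e x + J e' x &
  forall u, dom u -> \forall x \ae mu, J (iota u) x = u x].
Proof.
have /choice[J JP] : forall e, exists f, represents e f.
  by move=> e; have [f [_ [ef _ _ _]]] := represents_exists e; exists f.
exists J; split => //.
- by move=> a e e'; apply: represents_lin; exact: JP.
- by move=> u du; apply: (represents_unique (JP _)); exact: represents_dom.
Qed.

(** Injectivity amounts to closability of the norm: a Cauchy sequence of [dom]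
    that tends to [0] almost everywhere has to tend to [0] in norm. *)
Lemma represents_injective (closable : forall (u_ : nat -> T -> R) e,
    (forall n, dom (u_ n)) -> iota (u_ n) @[n --> \oo] --> e ->
    (\forall x \ae mu, u_ n x @[n --> \oo] --> 0) -> e = 0) e f :
  represents e f -> (\forall x \ae mu, f x = 0) -> e = 0.
Proof.
move=> ef f0; have [g [u_ [eg du ue ug]]] := represents_exists e.
apply: (closable u_ e du ue).
apply: filterS3 f0 (represents_unique ef eg) ug => x fx gx.
by rewrite -gx fx.
Qed.

(** Functions of [dom] that approximate [e_ n] within [delta n] inherit the bound
    on the sequence, and the errors vanish in the limit. *)
Lemma compact_extraction (precompact : forall (u_ : nat -> T -> R) (M : R),
    (forall n, dom (u_ n)) -> (forall n, `|iota (u_ n)| <= M) ->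
    exists2 s : nat -> nat, {homo s : i j / (i < j)%N} &
      forall i j, (i <= j)%N ->
        (mass (u_ (s i) \- u_ (s j))%R <= (fast p i)%:E)%E)
  (J : E -> T -> R) (JP : forall e, represents e (J e)) (e_ : nat -> E) (M : R) :
  (forall n, `|e_ n| <= M) ->
  exists2 s : nat -> nat, {homo s : i j / (i < j)%N} &
  exists g : T -> R, [/\ measurable_fun setT g, (mass g < +oo)%E &
    forall n, (mass (J (e_ (s n)) \- g)%R <=
               (3 `^ p * (2 * 2 ^- n))%:E)%E].
Proof.
move=> eM.
have /choice[u_ u_P] : forall n, exists u, dom u /\ `|e_ n - iota u| < delta n.
  by move=> n; have [u du ue] := iota_approx (e_ n) (delta_gt0 n); exists u.
have du n : dom (u_ n) by have [] := u_P n.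
have mu_ n : measurable_fun setT (u_ n) by exact: dom_measurable.
have uM n : `|iota (u_ n)| <= M + 1.
  have := ler_normB (e_ n) (e_ n - iota (u_ n)).
  rewrite opprB addrC subrK => h; apply: (le_trans h); apply: lerD => //.
  have [_ /ltW h1] := u_P n; apply: (le_trans h1).
  apply: (le_trans (delta_le_geo n)).
  by rewrite invf_le1 ?exprn_gt0// exprn_ege1// ler1n.
have [s shomo sfast] := precompact u_ (M + 1) du uM.
have sge n : (n <= s n)%N.
  by elim: n => // n ih; apply: (leq_ltn_trans ih); exact: shomo.
have sstep n : (mass (u_ (s n.+1) \- u_ (s n))%R <= (fast p n)%:E)%E.
  have -> : mass (u_ (s n.+1) \- u_ (s n)) = mass (u_ (s n) \- u_ (s n.+1)).
    by apply: eq_integral => x _ /=; rewrite distrC.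
  by apply: sfast.
have [g mg ug] := fast_cvg mQ Q_gt0 p_gt0 (fun n => mu_ (s n)) sstep.
have limg n : (mass (u_ (s n) \- g)%R <= (fast p n)%:E)%E.
  apply: (@fatou_bound _ _ _ mu (fun j x => Q x * `|(u_ (s n) \- u_ (s j)) x| `^ p)).
  - by move=> j; apply: measurable_Lp_density => //; exact: measurable_funB.
  - by apply: measurable_Lp_density => //; exact: measurable_funB.
  - by move=> j x; rewrite mulr_ge0 ?powR_ge0 ?(ltW (Q_gt0 x)).
  - by move=> x; rewrite mulr_ge0 ?powR_ge0 ?(ltW (Q_gt0 x)).
  - apply: filterS ug => x ux; apply: cvgM; first exact: cvg_cst.
    apply: cvg_powR => //; apply: cvg_norm; apply: cvgB; last exact: ux.
    exact: cvg_cst.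
  by exists n => // j /= nj; exact: sfast.
have tri (w v : T -> R) : measurable_fun setT w -> measurable_fun setT v ->
    (mass (w \+ v)%R <= (3 `^ p)%:E * (mass w + mass v))%E.
  move=> mw mv.
  have m0 : measurable_fun setT (cst (0 : R) : T -> R) by exact: measurable_cst.
  have mwv : measurable_fun setT (w \+ v) by exact: measurable_funD.
  have := @Lp_mass3 _ _ _ mu Q p mQ Q_gt0 p_gt0 w v (cst 0) (w \+ v) mw mv m0.
  rewrite Lp_mass0// adde0; apply => // x /=.
  by rewrite normr0 addr0 ler_normD.
exists s => //; exists g; split => //.
- have -> : g = u_ (s 0%N) \+ (fun x => - 1 * (u_ (s 0%N) \- g) x).
    by apply/funext => x /=; ring.
  have m1 : measurable_fun setT (u_ (s 0%N) \- g) by exact: measurable_funB.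
  apply: (le_lt_trans (tri _ _ (mu_ _) _)); first exact: measurable_funM.
  rewrite Lp_massZ// normrN1 powR1 mul1e.
  apply: lte_mul_pinfty; rewrite ?lee_fin ?powR_ge0//.
  apply: lte_add_pinfty.
    by rewrite (le_lt_trans (mass_le (du _)))// ltry.
  by rewrite (le_lt_trans (limg 0%N))// ltry.
move=> n.
have -> : J (e_ (s n)) \- g = (J (e_ (s n)) \- u_ (s n)) \+ (u_ (s n) \- g).
  by apply/funext => x /=; rewrite subrKA.
have [mJ Ju] := JP (e_ (s n)).
apply: (le_trans (tri _ _ _ _)); [exact: measurable_funB|exact: measurable_funB|].
rewrite EFinM; apply: lee_wpmul2l; first by rewrite lee_fin powR_ge0.
rewrite mulrDl mul1r EFinD; apply: leeD.
  have [dun /(Ju _ _ dun) h] := u_P (s n); apply: (le_trans h).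
  rewrite lee_fin; apply: (@le_trans _ _ (fast p (s n))).
    by apply: delta_mass; rewrite ?(ltW (delta_gt0 _))// ler_peMl ?(ltW (delta_gt0 _))// ler1n.
  apply: (le_trans (fast_le1 _)).
  by rewrite lef_pV2 ?posrE ?exprn_gt0// ler_weXn2l// ler1n.
by apply: (le_trans (limg n)); rewrite lee_fin fast_le1.
Qed.

End completion_embedding.

(** * Closability of the energy *)

Section closability.
Context {R : realType} {m k : nat}.
Local Notation space := ('rV[R]_m * 'rV[R]_k)%type.
Local Notation dir i := (direction R i).
Variable mu : {sigma_finite_measure set space -> \bar R}.
Hypothesis mu_shift : forall (h : space) (A : set space), measurable A ->
  mu ((fun z : space => z + h) @^-1` A) = mu A.
Hypothesis mu_bounded : forall M : R, (mu [set z : space | (`|z| <= M)%R] < +oo)%E.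
Variable gamma : R.
Hypothesis gamma_gt0 : 0 < gamma.
Variable V : space -> R.
Hypothesis mV : measurable_fun setT V.
Hypothesis V_ge0 : forall z, 0 <= V z.
Implicit Types (f g w : space -> R) (z h : space).

Definition full_energy f : \bar R :=
  (\int[mu]_z (grushin_grad2 gamma f z + V z * f z ^+ 2)%:E)%E.

Lemma ae_translate (P : space -> Prop) h : (\forall z \ae mu, P z) ->
  \forall z \ae mu, P (z + h).
Proof.
case=> N [mN N0 PN]; exists ((fun z => z + h) @^-1` N); split.
- by rewrite -[X in measurable X]setTI; apply: (measurable_shift h).
- by rewrite mu_shift.
- by move=> z Pz; exact: PN.
Qed.

Lemma measurable_potential f : C1c f ->
  measurable_fun setT (fun z => V z * f z ^+ 2).
Proof.
move=> cf; apply: measurable_funM => //; apply: measurable_funX.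
exact: C1c_measurable.
Qed.

Lemma full_energyE f : C1c f -> (full_energy f = grushin_energy mu gamma f +
  \int[mu]_z (V z * f z ^+ 2)%:E)%E.
Proof.
move=> cf; rewrite -ge0_integralRD//.
- exact: measurable_grushin_grad2.
- exact: measurable_potential.
- by move=> z; exact: grushin_grad2_ge0.
- by move=> z; rewrite mulr_ge0 ?sqr_ge0.
Qed.

(** The integrand of the energy with difference quotients of step [2^-j] in
    place of derivatives: in this form it passes to pointwise limits. *)
Definition quotient2 (j : nat) f z : R :=
  \sum_i (grushin_weight gamma i z ^+ 2 *
    (2 ^+ j * (f (z + (1 / 2 ^+ j) *: dir i) - f z)) ^+ 2).

Lemma quotient2_ge0 j f z : 0 <= quotient2 j f z.
Proof. by apply: sumr_ge0 => i _; rewrite mulr_ge0 ?sqr_ge0. Qed.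

Lemma measurable_quotient2_term j f i : measurable_fun setT f ->
  measurable_fun setT (fun z => grushin_weight gamma i z ^+ 2 *
    (2 ^+ j * (f (z + (1 / 2 ^+ j) *: dir i) - f z)) ^+ 2).
Proof.
move=> mf; apply: measurable_funM; apply: measurable_funX.
  exact: measurable_grushin_weight.
apply: measurable_funM; first exact: measurable_cst.
by apply: measurable_funB; [exact: measurable_fun_translate|exact: mf].
Qed.

Lemma measurable_quotient2 j f : measurable_fun setT f ->
  measurable_fun setT (quotient2 j f).
Proof.
by move=> mf; apply: measurable_sum => i; exact: measurable_quotient2_term.
Qed.

Lemma ge0_integralR_sum (I : finType) (F : I -> space -> R) :
  (forall i, measurable_fun setT (F i)) -> (forall i z, 0 <= F i z) ->
  (\int[mu]_z (\sum_i F i z)%:E = \sum_i \int[mu]_z (F i z)%:E)%E.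
Proof.
move=> mF F0; under eq_integral do rewrite -sumEFin.
rewrite ge0_integral_sum//.
- by move=> i; exact/measurable_EFinP.
- by move=> i z _; rewrite lee_fin.
Qed.

Lemma quotient2_le j f : C1c f ->
  (\int[mu]_z (quotient2 j f z)%:E <= grushin_energy mu gamma f)%E.
Proof.
move=> cf; have mf := C1c_measurable cf.
have mW i : measurable_fun setT (fun z : space => grushin_weight gamma i z ^+ 2).
  by apply: measurable_funX; exact: measurable_grushin_weight.
rewrite ge0_integralR_sum; last 2 first.
- by move=> i; exact: measurable_quotient2_term.
- by move=> i z; rewrite mulr_ge0 ?sqr_ge0.
rewrite [leRHS]ge0_integralR_sum; last 2 first.
- move=> i; apply: measurable_funM; first exact: mW.
  by apply: measurable_funX; exact: C1c_measurable_partial.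
- by move=> i z; rewrite mulr_ge0 ?sqr_ge0.
apply: lee_sum => i _.
have j0 : 0 <= (2 ^+ j) ^+ 2 :> R by exact: sqr_ge0.
have -> : (\int[mu]_z (grushin_weight gamma i z ^+ 2 *
    (2 ^+ j * (f (z + (1 / 2 ^+ j) *: dir i)%R - f z)) ^+ 2)%:E =
    ((2 ^+ j) ^+ 2)%:E * transl mu (fun z => grushin_weight gamma i z ^+ 2)%R f
      ((1 / 2 ^+ j) *: dir i)%R)%E.
  rewrite -ge0_integralRZ//; last 2 first.
  - exact: measurable_transl.
  - by move=> z; rewrite mulr_ge0 ?sqr_ge0.
  by apply: eq_integral => z _; rewrite exprMn mulrCA.
apply: le_trans.
  apply: lee_wpmul2l; first by rewrite lee_fin.
  apply: (transl_le_partial mu_shift mu_bounded) => //.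
  - by move=> z; exact: sqr_ge0.
  - move=> M; have [C WC] := grushin_weight_bounded gamma_gt0 i M.
    exists (C ^+ 2) => z zM; rewrite ler_sqr ?nnegrE ?grushin_weight_ge0 ?WC//.
    by rewrite (le_trans _ (WC z zM))// grushin_weight_ge0.
  - by move=> s z; rewrite grushin_weight_line.
rewrite muleA -EFinM -exprMn mulrCA mul1r mulfV ?expf_neq0// expr1n mul1e//.
Qed.

(** Fatou's lemma is applied twice: along the sequence, for difference quotients
    of a fixed step, and then as this step tends to [0]. *)
Lemma full_energy_lsc (f_ : nat -> space -> R) f (c : \bar R) :
  (forall n, C1c (f_ n)) -> C1c f ->
  (\forall z \ae mu, f_ n z @[n --> \oo] --> f z) ->
  (\forall n \near \oo, (full_energy (f_ n) <= c)%E) ->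
  (full_energy f <= c)%E.
Proof.
move=> cf_ cf ff fc.
have m_ j g : C1c g ->
    measurable_fun setT (fun z => quotient2 j g z + V z * g z ^+ 2).
  move=> cg; apply: measurable_funD; last exact: measurable_potential.
  by apply: measurable_quotient2; exact: C1c_measurable.
have pos j g z : 0 <= quotient2 j g z + V z * g z ^+ 2.
  by rewrite addr_ge0 ?quotient2_ge0// mulr_ge0 ?sqr_ge0.
have step j : (\int[mu]_z (quotient2 j f z + V z * f z ^+ 2)%:E <= c)%E.
  apply: (@fatou_bound _ _ _ mu (fun n z => quotient2 j (f_ n) z + V z * f_ n z ^+ 2)).
  - by move=> n; exact: m_.
  - exact: m_.
  - by move=> n z; exact: pos.
  - by move=> z; exact: pos.
  - have ffi : \forall z \ae mu, forall i : 'I_m + 'I_k,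
        f_ n (z + (1 / 2 ^+ j) *: dir i) @[n --> \oo] -->
        f (z + (1 / 2 ^+ j) *: dir i).
      have : forall i : 'I_m + 'I_k, \forall z \ae mu,
          f_ n (z + (1 / 2 ^+ j) *: dir i) @[n --> \oo] -->
          f (z + (1 / 2 ^+ j) *: dir i).
        by move=> i; exact: (ae_translate _ ff).
      exact: filter_forall.
    apply: filterS2 ff ffi => z fz fzi.
    have sq (a_ : nat -> R) (a : R) : a_ n @[n --> \oo] --> a ->
        a_ n ^+ 2 @[n --> \oo] --> a ^+ 2.
      move=> aa; under eq_fun do rewrite expr2.
      by rewrite expr2; apply: cvgM.
    apply: cvgD.
      apply: cvg_big => [|i _]; first exact: add_continuous.
      apply: cvgM; first exact: cvg_cst.
      apply: sq; apply: cvgM; first exact: cvg_cst.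
      by apply: cvgB; [exact: fzi|exact: fz].
    by apply: cvgM; [exact: cvg_cst|exact: sq].
  - apply: filterS fc => n; apply: le_trans; rewrite full_energyE//.
    rewrite ge0_integralRD//.
    + by apply: leeD => //; exact: quotient2_le.
    + by apply: measurable_quotient2; exact: C1c_measurable.
    + exact: measurable_potential.
    + by move=> z; exact: quotient2_ge0.
    + by move=> z; rewrite mulr_ge0 ?sqr_ge0.
apply: (@fatou_bound _ _ _ mu (fun j z => quotient2 j f z + V z * f z ^+ 2)).
- by move=> j; exact: m_.
- apply: measurable_funD; last exact: measurable_potential.
  exact: measurable_grushin_grad2.
- by move=> j z; exact: pos.
- by move=> z; rewrite addr_ge0 ?grushin_grad2_ge0// mulr_ge0 ?sqr_ge0.
- apply: aeW => z; apply: cvgD; last exact: cvg_cst.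
  apply: cvg_big => [|i _]; first exact: add_continuous.
  apply: cvgM; first exact: cvg_cst.
  have df : derivable f z (dir i) by exact: C1c_derivable.
  have := @dyadic_quotient_cvg _ _ f z (dir i) 1 df.
  rewrite mul1r => dq; under eq_fun do rewrite expr2.
  by rewrite expr2; apply: cvgM; exact: dq.
- exact: nearW.
Qed.

End closability.

(** * Local compactness *)

Lemma cover_indicator (R : realType) (T : Type) (I : finType) (t : I -> R)
    (C : I -> set T) (z : T) (i : I) :
  (forall i, 0 <= t i) -> C i z -> t i <= \sum_j t j * \1_(C j) z.
Proof.
move=> t0 Cz; rewrite (bigD1 i)//= indicE mem_set// mulr1 lerDl.
by apply: sumr_ge0 => j _; rewrite mulr_ge0.
Qed.

Section rellich.
Context {R : realType} {m k : nat}.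
Local Notation space := ('rV[R]_m * 'rV[R]_k)%type.
Variable mu : {sigma_finite_measure set space -> \bar R}.
Hypothesis mu_shift : forall (h : space) (A : set space), measurable A ->
  mu ((fun z : space => z + h) @^-1` A) = mu A.
Hypothesis mu_bounded : forall M : R, (mu [set z : space | (`|z| <= M)%R] < +oo)%E.
Variable gamma : R.
Hypothesis gamma_gt0 : 0 < gamma.
Hypothesis m_ge1 : (1 <= m)%N.
Local Notation Ng := (homogeneous_dim m k gamma).
Hypothesis mu_box : forall r : R, 0 < r ->
  mu (@grushin_box R m k gamma r) = (2 ^+ (m + k) * r `^ Ng)%:E.
Local Notation G := (grushin_energy mu gamma).
Local Notation box := (@grushin_box R m k gamma).
Implicit Types (f g w : space -> R) (z h : space).

Lemma bounded_integrable (C : set space) w (M : R) : measurable C ->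
  (mu C < +oo)%E -> measurable_fun setT w -> (forall z, `|w z| <= M) ->
  mu.-integrable C (EFin \o w).
Proof.
move=> mC Coo mw wM; apply: measurable_bounded_integrable => //.
  exact: measurable_funTS.
exists M; split; first exact: num_real.
by move=> N MN z _ /=; rewrite (le_trans (wM z))// ltW.
Qed.

(** Integrate [a ^ 2 - 2 a w <= (a - w) ^ 2] over [C] and complete the square. *)
Lemma local_mean (C : set space) w (M v a : R) : measurable C -> mu C = v%:E ->
  0 < v -> measurable_fun setT w -> (forall z, `|w z| <= M) ->
  ((v / 2 * a ^+ 2)%:E <= \int[mu]_(y in C) ((a - w y) ^+ 2)%:E +
     (2 / v * (\int[mu]_(y in C) w y)%R ^+ 2)%:E)%E.
Proof.
move=> mC Cv v0 mw wM.
have Coo : (mu C < +oo)%E by rewrite Cv ltry.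
have iw := bounded_integrable mC Coo mw wM.
have M0 : 0 <= M by apply: le_trans (wM point).
have maw : measurable_fun setT (fun y => (a - w y) ^+ 2).
  by apply: measurable_funX; apply: measurable_funB.
have iaw : mu.-integrable C (EFin \o (fun y => (a - w y) ^+ 2)).
  apply: (@bounded_integrable _ _ ((`|a| + M) ^+ 2)) => // z.
  rewrite normrX ler_sqr ?nnegrE ?addr_ge0//.
  by rewrite (le_trans (ler_normB _ _))// lerD2l.
have ia : mu.-integrable C (EFin \o (fun=> a ^+ 2)).
  by apply: (@bounded_integrable _ _ (a ^+ 2)) => // z; rewrite ger0_norm ?sqr_ge0.
have i2w : mu.-integrable C (EFin \o (fun y => 2 * a * w y)).
  apply: (@bounded_integrable _ _ (`|2 * a| * M)) => //.
    exact: measurable_funM.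
  by move=> z; rewrite normrM ler_wpM2l.
have il : mu.-integrable C (EFin \o (fun y => a ^+ 2 - 2 * a * w y)).
  apply: (@bounded_integrable _ _ (a ^+ 2 + `|2 * a| * M)) => //.
    by apply: measurable_funB => //; exact: measurable_funM.
  move=> z; rewrite (le_trans (ler_normB _ _))// lerD//.
    by rewrite ger0_norm ?sqr_ge0.
  by rewrite normrM ler_wpM2l.
have := @le_Rintegral _ _ _ mu C _ _ mC il iaw.
have -> : \int[mu]_(y in C) (a ^+ 2 - 2 * a * w y) =
    a ^+ 2 * v - 2 * a * \int[mu]_(y in C) w y.
  rewrite (RintegralB mC ia i2w) (RintegralZl _ mC iw).
  by rewrite (Rintegral_cst mu mC) [X in fine X]Cv.
set S := \int[mu]_(y in C) w y => H.
have -> : (\int[mu]_(y in C) ((a - w y) ^+ 2)%:E =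
    (\int[mu]_(y in C) (a - w y) ^+ 2)%R%:E)%E.
  by rewrite /Rintegral fineK//; exact: integrable_fin_num.
rewrite -EFinD lee_fin.
apply: (@le_trans _ _ (a ^+ 2 * v - 2 * a * S + 2 / v * S ^+ 2)); last first.
  by rewrite lerD2r; apply: H => y _; rewrite sqrrB; have := sqr_ge0 (w y); lra.
rewrite -subr_ge0.
rewrite (_ : _ - _ = v / 2 * (a - 2 / v * S) ^+ 2).
  by rewrite mulr_ge0 ?sqr_ge0// divr_ge0 ?(ltW v0).
by field; rewrite gt_eqF.
Qed.

Lemma measurable_double_diff w r : measurable_fun setT w ->
  measurable_fun setT (fun p : space * space =>
    \1_(box r) p.2 * (w (p.1 + p.2) - w p.1) ^+ 2).
Proof.
move=> mw.
have mB : measurable_fun setT (\1_(box r) : space -> R).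
  by apply: measurable_indic; exact: measurable_grushin_box.
apply: measurable_funM; first exact: (measurableT_comp mB measurable_snd).
apply: measurable_funX; apply: measurable_funB.
  by apply: (measurableT_comp mw); exact: measurable_add_pair.
exact: (measurableT_comp mw measurable_fst).
Qed.

Definition box_oscillation r w z : \bar R :=
  (\int[mu]_h (\1_(box r) h * (w (z + h)%R - w z) ^+ 2)%:E)%E.

Lemma double_diff_ge0 r w (p : space * space) :
  (0 <= (\1_(box r) p.2 * (w (p.1 + p.2)%R - w p.1) ^+ 2)%:E)%E.
Proof. by rewrite lee_fin mulr_ge0 ?sqr_ge0. Qed.

Lemma box_oscillation_ge0 r w z : (0 <= box_oscillation r w z)%E.
Proof. by apply: integral_ge0 => h _; exact: (double_diff_ge0 r w (z, h)). Qed.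

Lemma measurable_box_oscillation r w : measurable_fun setT w ->
  measurable_fun setT (box_oscillation r w).
Proof.
move=> mw.
have mF : measurable_fun setT (fun p : space * space =>
    (\1_(box r) p.2 * (w (p.1 + p.2)%R - w p.1) ^+ 2)%:E).
  by apply/measurable_EFinP; exact: measurable_double_diff.
exact: (measurable_fun_fubini_tonelli_F _ mF (double_diff_ge0 r w)).
Qed.

Definition rellich_cst : R := 2 `^ Ng * (2 * (4 ^+ (m + k) * 28)).

(** By Tonelli's theorem this is the integral over the box of the norms of the
    differences of [w], all of which [dist2_box] bounds. *)
Lemma integral_box_oscillation r w : 0 < r -> C1c w ->
  (\int[mu]_z box_oscillation r w z <=
   (2 ^+ (m + k) * r `^ Ng * (4 ^+ (m + k) * 28 * r ^+ 2))%:E * G w)%E.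
Proof.
move=> r0 cw; have mw := C1c_measurable cw.
have mB : measurable (box r) by exact: measurable_grushin_box.
have mF : measurable_fun setT (fun p : space * space =>
    (\1_(box r) p.2 * (w (p.1 + p.2)%R - w p.1) ^+ 2)%:E).
  by apply/measurable_EFinP; exact: measurable_double_diff.
rewrite (fubini_tonelli _ mF (double_diff_ge0 r w))/=.
have G0 : (0 <= G w)%E by exact: grushin_energy_ge0.
pose X := ((4 ^+ (m + k) * 28 * r ^+ 2)%:E * G w)%E.
have c0 : 0 <= 4 ^+ (m + k) * 28 * r ^+ 2.
  by rewrite mulr_ge0 ?sqr_ge0// mulr_ge0 ?exprn_ge0.
have X0 : (0 <= X)%E by rewrite mule_ge0// lee_fin.
apply: (@le_trans _ _ (\int[mu]_h (X * (\1_(box r) h)%:E))%E).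
  apply: ge0_le_integral => //.
  - by move=> h _; apply: integral_ge0 => z _; exact: (double_diff_ge0 r w (z, h)).
  - exact: (measurable_fun_fubini_tonelli_G _ mF (double_diff_ge0 r w)).
  - apply: emeasurable_funM => //.
    by apply/measurable_EFinP; exact: measurable_indic.
  move=> h _; rewrite indicE; have [|_] := boolP (h \in _); last first.
    by rewrite mule0; rewrite integral0_eq// => z _; rewrite mul0r.
  move=> /set_mem Bh; rewrite mule1.
  apply: le_trans (dist2_box mu_shift mu_bounded gamma_gt0 m_ge1 cw r0 Bh).
  by apply: le_of_eq.
rewrite ge0_integralZl//; last first.
  by apply/measurable_EFinP; exact: measurable_indic.
have -> : (\int[mu]_h (\1_(box r) h)%:E = (2 ^+ (m + k) * r `^ Ng)%:E)%E.
  by rewrite integral_indic// setIT; exact: mu_box.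
rewrite muleC muleA.
by apply: le_of_eq.
Qed.

Lemma measurable_translate_set h (A : set space) : measurable A ->
  measurable ((fun z : space => z + h) @^-1` A).
Proof. by move=> mA; rewrite -[X in measurable X]setTI; apply: measurable_shift. Qed.

Definition cell (r : R) (c : space) : set space :=
  (fun z : space => z + - c) @^-1` box (r / 2).

Lemma cell_diff r c z y : 0 < r -> cell r c z -> cell r c y -> box r (y - z).
Proof.
move=> r0 [/= z1 z2] [/= y1 y2].
have -> : y - z = (y - c) - (z - c) by rewrite opprB addrA subrK.
split=> i /=.
  rewrite !mxE; rewrite (le_trans (ler_normB _ _))// [leRHS](splitr r) lerD//.
    by have := y1 i; rewrite !mxE.
  by have := z1 i; rewrite !mxE.
rewrite !mxE; rewrite (le_trans (ler_normB _ _))//.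
have h : (r / 2) `^ (1 + gamma) <= r `^ (1 + gamma) / 2.
  rewrite powRM ?(ltW r0)//; apply: ler_wpM2l; first exact: powR_ge0.
  rewrite -[leRHS](@powRr1 _ 2^-1)// ger_powR ?lerDl ?(ltW gamma_gt0)//.
  by rewrite invr_gt0 ltr0n/= invf_le1// ler1n.
have := y2 i; have := z2 i; rewrite !mxE; move: h.
by set p := (r / 2) `^ _; set q := r `^ _; lra.
Qed.

Lemma le_box_oscillation r c w z : 0 < r -> measurable_fun setT w -> cell r c z ->
  (\int[mu]_(y in cell r c) ((w z - w y) ^+ 2)%:E <= box_oscillation r w z)%E.
Proof.
move=> r0 mw cz.
have mB : measurable_fun setT (\1_(box r) : space -> R).
  by apply: measurable_indic; exact: measurable_grushin_box.
pose F (y : space) : R := \1_(box r) (y - z) * (w y - w z) ^+ 2.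
have mF : measurable_fun setT F.
  apply: measurable_funM; first exact: (measurable_fun_translate (- z) mB).
  by apply: measurable_funX; exact: measurable_funB.
have F0 y : 0 <= F y by rewrite mulr_ge0 ?sqr_ge0.
have -> : (box_oscillation r w z = \int[mu]_y (F y)%:E)%E.
  rewrite -(integral_translate mu_shift z mF F0).
  by apply: eq_integral => h _; rewrite /F addrK (addrC z).
have mC : measurable (cell r c).
  by apply: measurable_translate_set; exact: measurable_grushin_box.
rewrite integral_mkcond; apply: ge0_le_integral => //.
- move=> y _; rewrite patchE; case: ifP => // _.
  by rewrite lee_fin sqr_ge0.
- apply/(measurable_restrictT _ mC)/measurable_EFinP/measurable_funTS.
  by apply: measurable_funX; exact: measurable_funB.
- by apply/measurable_EFinP.
move=> y _; rewrite patchE; case: ifPn => [|_]; last by rewrite lee_fin.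
move=> /set_mem cy; rewrite lee_fin /F indicE mem_set ?mul1r.
  by rewrite -sqrrN opprB.
exact: (cell_diff r0 cz cy).
Qed.

Lemma rV_finite_net n (L d : R) : 0 < d ->
  exists (I : finType) (c : I -> 'rV[R]_n),
    forall v, `|v| <= L -> exists i, `|v - c i| < d.
Proof.
move=> d0.
have cpt : compact [set v : 'rV[R]_n | forall i, `[- L, L]%classic (v 0 i)].
  apply: (@rV_compact R n (fun=> `[- L, L]%classic)) => i.
  exact: segment_compact.
rewrite compact_cover in cpt.
have [||D _ Dcov] := cpt 'rV[R]_n setT (fun c => ball c d).
- by move=> c _; exact: ball_open.
- by move=> z _; exists z => //; exact: ballxx.
pose s : seq 'rV[R]_n := finmap.enum_fset D.
exists 'I_(size s), (fun i : 'I_(size s) => s`_i) => v vL; have [|c /= cD] := Dcov v.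
  by move=> i; rewrite /= in_itv/= -ler_norml (le_trans (coord_le_norm _ _)).
have cs : c \in s by exact: cD.
have ltc : (index c s < size s)%N by rewrite index_mem.
rewrite -ball_normE/= => cv; exists (Ordinal ltc).
by rewrite /= nth_index// distrC.
Qed.

Lemma finite_cells (L r : R) : 0 < r ->
  exists (I : finType) (c : I -> space),
    forall z, `|z| <= L -> exists i, cell r (c i) z.
Proof.
move=> r0; have r20 : 0 < r / 2 by rewrite divr_gt0.
have r30 : 0 < (r / 2) `^ (1 + gamma) by rewrite powR_gt0.
have [I1 [c1 I1P]] := @rV_finite_net m L _ r20.
have [I2 [c2 I2P]] := @rV_finite_net k L _ r30.
exists (I1 * I2)%type, (fun i => (c1 i.1, c2 i.2)) => z.
rewrite prod_normE ge_max => /andP[/I1P[i1 /ltW h1] /I2P[i2 /ltW h2]].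
exists (i1, i2); split => i /=; apply: le_trans (coord_le_norm _ _) _.
  exact: h1.
exact: h2.
Qed.

(** On a cell of radius [r / 2] the function differs from its mean by its
    oscillation at the scale [r], which costs a multiple of [r ^ 2] times the
    energy; finitely many cells cover the ball, and [r] is taken small. *)
Lemma rellich (L eta : R) : 0 < eta ->
  exists (I : finType) (C : I -> set space) (K : R), [/\ 0 <= K,
    forall i, measurable (C i), forall i, (mu (C i) < +oo)%E,
    forall i, exists M, C i `<=` [set z : space | (`|z| <= M)%R] &
    forall w, C1c w ->
      (\int[mu]_z (\1_[set z : space | (`|z| <= L)%R] z * w z ^+ 2)%:E <=
       eta%:E * G w + (K * \sum_i (\int[mu]_(y in C i) w y)%R ^+ 2)%:E)%E].
Proof.
move=> eta0.
have k0 : 0 < rellich_cst by rewrite mulr_gt0 ?powR_gt0// mulr_gt0// mulr_gt0 ?exprn_gt0.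
pose r := Num.sqrt (eta / rellich_cst).
have er0 : 0 < eta / rellich_cst by rewrite divr_gt0.
have r0 : 0 < r by rewrite sqrtr_gt0.
have [I [c Ic]] := @finite_cells L r r0.
pose v : R := 2 ^+ (m + k) * (r / 2) `^ Ng.
have r20 : 0 < r / 2 by rewrite divr_gt0.
have v0 : 0 < v by rewrite mulr_gt0 ?exprn_gt0 ?powR_gt0.
have mC i : measurable (cell r (c i)).
  by apply: measurable_translate_set; exact: measurable_grushin_box.
have Cv i : mu (cell r (c i)) = v%:E.
  by rewrite mu_shift ?mu_box//; exact: measurable_grushin_box.
exists I, (fun i => cell r (c i)), (4 / v); split.
- by rewrite divr_ge0// ltW.
- exact: mC.
- by move=> i; rewrite Cv ltry.
- move=> i; exists (`|c i| + (r / 2 + (r / 2) `^ (1 + gamma))) => z [/= z1 z2].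
  rewrite -(subrK (c i) z) addrC (le_trans (ler_normD _ _))// lerD2l.
  have p0 : 0 <= (r / 2) `^ (1 + gamma) by exact: powR_ge0.
  rewrite prod_normE ge_max; apply/andP; split; rewrite [leLHS]mx_normrE.
    apply/bigmax_leP; split=> [|[i1 i2] _]; first by rewrite addr_ge0// ltW.
    by rewrite (ord1 i1) (le_trans (z1 i2))// lerDl.
  apply/bigmax_leP; split=> [|[i1 i2] _]; first by rewrite addr_ge0// ltW.
  by rewrite (ord1 i1) (le_trans (z2 i2))// lerDr ltW.
move=> w cw; have mw := C1c_measurable cw.
have [M [M0 wM _ _]] := C1c_bounded cw.
pose S i := \int[mu]_(y in cell r (c i)) w y.
pose B := [set z : space | (`|z| <= L)%R].
have mB : measurable_fun setT (\1_B : space -> R).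
  by apply: measurable_indic; exact: measurable_norm_le.
pose T z : R := \sum_i (2 / v * S i ^+ 2) * \1_(cell r (c i)) z.
have t0 i : 0 <= 2 / v * S i ^+ 2 by rewrite mulr_ge0 ?sqr_ge0// divr_ge0// ltW.
have T0 z : 0 <= T z by apply: sumr_ge0 => i _; rewrite mulr_ge0.
have mTi i : measurable_fun setT
    (fun z : space => (2 / v * S i ^+ 2) * \1_(cell r (c i)) z).
  by apply: measurable_funM => //; exact: measurable_indic.
have mT : measurable_fun setT T by apply: measurable_sum => i; exact: mTi.
have mBw : measurable_fun setT (fun z : space => \1_B z * w z ^+ 2).
  by apply: measurable_funM => //; exact: measurable_funX.
have ptw z : ((v / 2 * (\1_B z * w z ^+ 2))%:E <= box_oscillation r w z + (T z)%:E)%E.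
  have [Bz|Bz] := pselect (B z); last first.
    rewrite indicE memNset// mul0r mulr0 adde_ge0// ?lee_fin//.
    exact: box_oscillation_ge0.
  rewrite indicE mem_set// mul1r; have [i ci] := Ic z Bz.
  apply: (le_trans (local_mean (w z) (mC i) (Cv i) v0 mw wM)); apply: leeD.
    exact: le_box_oscillation.
  by rewrite lee_fin; exact: (@cover_indicator _ _ _ _ (fun i => cell r (c i)) _ i t0).
have int : ((v / 2)%:E * \int[mu]_z (\1_B z * w z ^+ 2)%:E <=
    (2 ^+ (m + k) * r `^ Ng * (4 ^+ (m + k) * 28 * r ^+ 2))%:E * G w +
    (2 * \sum_i S i ^+ 2)%:E)%E.
  have vp : 0 <= v / 2 by rewrite divr_ge0// ltW.
  rewrite -ge0_integralRZ//; last by move=> z; rewrite mulr_ge0 ?sqr_ge0.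
  apply: (@le_trans _ _ (\int[mu]_z (box_oscillation r w z + (T z)%:E))%E).
    apply: ge0_le_integral => //.
    - by move=> z _; rewrite lee_fin mulr_ge0// mulr_ge0 ?sqr_ge0.
    - by apply/measurable_EFinP; exact: measurable_funM.
    - apply: emeasurable_funD; first exact: measurable_box_oscillation.
      exact/measurable_EFinP.
  rewrite ge0_integralD//; last 4 first.
  - by move=> z _; exact: box_oscillation_ge0.
  - exact: measurable_box_oscillation.
  - by move=> z _; rewrite lee_fin.
  - exact/measurable_EFinP.
  apply: leeD; first exact: integral_box_oscillation.
  rewrite ge0_integralR_sum//; last by move=> i z; rewrite mulr_ge0.
  rewrite mulr_sumr -sumEFin; apply: lee_sum => i _.
  rewrite ge0_integralRZ; [|exact: measurable_indic|exact: t0|by move=> z; rewrite indicE].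
  have -> : (\int[mu]_z (\1_(cell r (c i)) z)%:E = v%:E)%E.
    by rewrite integral_indic// setIT; exact: Cv.
  by rewrite -EFinM lee_fin; apply: le_of_eq; field; rewrite gt_eqF.
have v20 : 0 < v / 2 by rewrite divr_gt0.
rewrite -(@lee_pmul2l _ (v / 2)%:E)//; apply: (le_trans int).
rewrite [leRHS]ge0_muleDr; last 2 first.
- by rewrite mule_ge0 ?grushin_energy_ge0// lee_fin ltW.
- by rewrite lee_fin mulr_ge0 ?divr_ge0 ?(ltW v0)// sumr_ge0// => i _; rewrite sqr_ge0.
rewrite muleA -!EFinM.
have r2 : r ^+ 2 * rellich_cst = eta by rewrite sqr_sqrtr ?divfK ?gt_eqF// ltW.
have rv : v * 2 `^ Ng = 2 ^+ (m + k) * r `^ Ng.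
  rewrite /v -mulrA -powRM ?(ltW r20)//; congr (_ * _ `^ _); by field.
apply: leeD; last first.
  rewrite lee_fin; apply: le_of_eq; rewrite /S.
  by field; rewrite gt_eqF.
apply: lee_wpmul2r; first exact: grushin_energy_ge0.
rewrite lee_fin -rv -r2 /rellich_cst; apply: le_of_eq.
by field.
Qed.

End rellich.

(** * Extraction of a Cauchy subsequence *)

Section extraction.
Context {R : realType}.

Lemma ultra_bounded_cvg (U : set_system nat) (a : nat -> R) (M : R) :
  UltraFilter U -> (forall n, `|a n| <= M) -> exists l : R, a @ U --> l.
Proof.
move=> UU aM.
have aUM : (a @ U) `[- M, M]%classic.
  apply: (@filterS _ U _ setT) filterT => n _ /=.
  by rewrite in_itv/= -ler_norml.
have [l [_ cl]] := @segment_compact R (- M) M (a @ U) _ aUM.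
exists l => A nA; have [//|UA] := in_ultra_setVsetC (a @^-1` A) UU.
by have [x [/= Ax]] := cl (~` A) A UA nA.
Qed.

(** Along an ultrafilter finer than the cofinite one every bounded sequence of
    reals converges, which takes care of all the averages at once; a diagonal
    choice then leads to a subsequence. *)
Lemma cauchy_extraction (d : nat -> nat -> \bar R) (e_ : nat -> R) :
  (forall i, 0 < e_ i) ->
  (forall e : R, 0 < e -> exists (I : finType) (a : I -> nat -> R) (K : R),
    [/\ 0 <= K, forall i, exists M, forall n, `|a i n| <= M &
     forall p q, (d p q <= (e + K * \sum_i (a i p - a i q) ^+ 2)%:E)%E]) ->
  exists2 s : nat -> nat, {homo s : i j / (i < j)%N} &
    forall i j, (i <= j)%N -> (d (s i) (s j) <= (e_ i)%:E)%E.
Proof.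
move=> e_0 dH.
have [U [UU inftyU]] := @ultraFilterLemma nat (@eventually) _.
have [A AP] : exists A : nat -> set nat, forall i, U (A i) /\
    forall p q, A i p -> A i q -> (d p q <= (e_ i)%:E)%E.
  suff /choice : forall i, exists A, U A /\
      forall p q, A p -> A q -> (d p q <= (e_ i)%:E)%E by move=> [A]; exists A.
  move=> i; have ei0 : 0 < e_ i / 2 by rewrite divr_gt0.
  have [I [a [K [K0 aM dK]]]] := dH _ ei0.
  have /choice[l al] : forall i, exists l : R, a i @ U --> l.
    by move=> j; have [M jM] := aM j; exact: ultra_bounded_cvg jM.
  have N0 : 0 < 4 * (K + 1) * (#|I|%:R + 1) :> R.
    by rewrite mulr_gt0 ?ltr_wpDl// mulr_gt0// ltr_wpDl.
  pose t := Num.sqrt (e_ i / 2 / (4 * (K + 1) * (#|I|%:R + 1))).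
  have q0 : 0 < e_ i / 2 / (4 * (K + 1) * (#|I|%:R + 1)) by rewrite divr_gt0.
  have t0 : 0 < t by rewrite sqrtr_gt0.
  exists [set n | forall j, `|l j - a j n| < t]; split.
    apply: filter_forall => j; have /cvgrPdist_lt := al j.
    by apply.
  move=> p q /= pt qt; apply: (le_trans (dK p q)); rewrite lee_fin.
  rewrite [leRHS](splitr (e_ i)) lerD2l.
  have aj j : (a j p - a j q) ^+ 2 <= 4 * t ^+ 2.
    rewrite -[leLHS]real_normK ?num_real// (_ : 4 * t ^+ 2 = (2 * t) ^+ 2); last by ring.
    rewrite ler_sqr ?nnegrE ?mulr_ge0 ?(ltW t0)//.
    rewrite (_ : _ - _ = (l j - a j q) - (l j - a j p)); last by ring.
    rewrite (le_trans (ler_normB _ _))//.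
    by have := pt j; have := qt j; lra.
  apply: (@le_trans _ _ (K * (\sum_(j : I) 4 * t ^+ 2))).
    by apply: ler_wpM2l => //; apply: ler_sum.
  rewrite sumr_const -mulr_natr sqr_sqrtr ?(ltW q0)//.
  rewrite (_ : K * _ = e_ i / 2 * ((K / (K + 1)) * (#|I|%:R / (#|I|%:R + 1)))).
    rewrite ler_piMr ?(ltW ei0)// mulr_ile1 ?divr_ge0 ?addr_ge0//.
      by rewrite ler_pdivrMr ?ltr_wpDl// mul1r lerDl.
    by rewrite ler_pdivrMr ?ltr_wpDl// mul1r lerDl.
  by field; rewrite !gt_eqF// ltr_wpDl.
pose B n := [set q | forall i, (i <= n)%N -> A i q].
have UB n : U (B n).
  elim: n => [|n ih].
    by apply: filterS (AP 0%N).1 => q Aq i; rewrite leqn0 => /eqP ->.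
  apply: filterS2 ih (AP n.+1).1 => q Bq Aq i.
  by rewrite leq_eqVlt => /predU1P[->//|]; rewrite ltnS => /Bq.
have next (n q : nat) : exists q', (q < q')%N /\ B n q'.
  have : U (B n `&` [set q' | (q < q')%N]).
    apply: filterI; first exact: UB.
    by apply: inftyU; exists q.+1.
  by move=> /filter_ex[q' [Bq' qq']]; exists q'.
have /choice[nx nxP] : forall x : nat * nat,
    exists q', (x.2 < q')%N /\ B x.1 q'.
  by case=> n q; exact: next.
pose s := fix s n := if n is n'.+1 then nx (n, s n') else nx (0%N, 0%N).
have sB n : B n (s n).
  by case: n => [|n]; [exact: (nxP (0, 0)%N).2|exact: (nxP (n.+1, s n)).2].
exists s.
  by apply: homo_ltn => [|n]; [exact: ltn_trans|exact: (nxP (n.+1, s n)).1].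
move=> i j ij; apply: (AP i).2; first exact: (sB i).
exact: (sB j i ij).
Qed.

End extraction.

(** * The embedding under pointwise conditions on the weights *)

Lemma normr_powR2 (R : realType) (x s : R) : `|x| `^ (2 * s) = (x ^+ 2) `^ s.
Proof. by rewrite powRrM powR_mulrn// real_normK ?num_real. Qed.

Section grushin_embedding.
Context {R : realType} {m k : nat}.
Local Notation space := ('rV[R]_m * 'rV[R]_k)%type.
Variable mu : {sigma_finite_measure set space -> \bar R}.
Hypothesis mu_shift : forall (h : space) (A : set space), measurable A ->
  mu ((fun z : space => z + h) @^-1` A) = mu A.
Hypothesis mu_bounded : forall M : R, (mu [set z : space | (`|z| <= M)%R] < +oo)%E.
Variable gamma : R.
Hypothesis gamma_gt0 : 0 < gamma.
Hypothesis m_ge1 : (1 <= m)%N.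
Hypothesis N_ge3 : (3 <= m + k)%N.
Local Notation Ng := (homogeneous_dim m k gamma).
Hypothesis mu_box : forall r : R, 0 < r ->
  mu (@grushin_box R m k gamma r) = (2 ^+ (m + k) * r `^ Ng)%:E.
Variables (V Q : space -> R) (p : R).
Hypothesis mV : measurable_fun setT V.
Hypothesis V_gt0 : forall z, 0 < V z.
Hypothesis V_low : forall M : R, exists2 c : R, 0 < c &
  forall z, `|z| <= M -> c <= V z.
Hypothesis mQ : measurable_fun setT Q.
Hypothesis Q_gt0 : forall z, 0 < Q z.
Hypothesis p_gt0 : 0 < p.
Variables (dom : set (space -> R)) (E : completeNormedModType R).
Variable iota : (space -> R) -> E.
Hypothesis dom_nonempty : dom (cst 0).
Hypothesis dom_lin : forall (a : R) u v, dom u -> dom v ->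
  dom (fun x => a * u x + v x).
Hypothesis dom_C1c : forall u, dom u -> C1c u.
Hypothesis iota_lin : forall (a : R) u v, dom u -> dom v ->
  iota (fun x => a * u x + v x) = a *: iota u + iota v.
Hypothesis iota_dense : closure (iota @` dom) = setT.
Hypothesis iota_energy : forall u, dom u ->
  full_energy mu gamma V u = (`|iota u| ^+ 2)%:E.
Local Notation G := (grushin_energy mu gamma).
Local Notation mass := (Lp_mass mu Q p).
Local Notation s := (Ng / (Ng - 2)).
Local Notation pcrit := (critical_exponent m k gamma).
Implicit Types (u v w : space -> R) (z : space).

Lemma critical_exponentE : pcrit = 2 * s.
Proof. by rewrite /critical_exponent mulrA. Qed.

Let S := @sobolev_cst R m k gamma.

Lemma sobolev_cst_ge0 : 0 <= S.
Proof. by rewrite mulr_ge0 ?powR_ge0. Qed.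

Lemma V_ge0 z : 0 <= V z. Proof. exact: ltW. Qed.

Lemma dom_measurable u : dom u -> measurable_fun setT u.
Proof. by move=> du; apply: C1c_measurable; exact: dom_C1c. Qed.

Lemma dom_energy_le u : dom u -> (G u <= (`|iota u| ^+ 2)%:E)%E.
Proof.
move=> du; rewrite -iota_energy// full_energyE//; last exact: dom_C1c.
- by apply: leeDl; apply: integral_ge0 => z _; rewrite lee_fin mulr_ge0 ?sqr_ge0 ?V_ge0.
- exact: V_ge0.
Qed.

Lemma dom_potential_le u : dom u ->
  (\int[mu]_z (V z * u z ^+ 2)%:E <= (`|iota u| ^+ 2)%:E)%E.
Proof.
move=> du; rewrite -iota_energy// full_energyE//; last exact: dom_C1c.
- by apply: leeDr; exact: grushin_energy_ge0.
- exact: V_ge0.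
Qed.

Lemma dom_sobolev_le u : dom u ->
  (\int[mu]_z (`|u z| `^ pcrit)%:E <= (S * (`|iota u| ^+ 2) `^ s)%:E)%E.
Proof.
move=> du; under eq_integral do rewrite critical_exponentE normr_powR2.
apply: sobolev_sqr => //; first exact: dom_C1c.
exact: dom_energy_le.
Qed.

Lemma measurable_V2 u : dom u -> measurable_fun setT (fun z => V z * u z ^+ 2).
Proof.
by move=> du; apply: measurable_funM => //; apply: measurable_funX; exact: dom_measurable.
Qed.

Lemma measurable_crit u : dom u -> measurable_fun setT (fun z => `|u z| `^ pcrit).
Proof.
move=> du; apply: (measurableT_comp (measurable_powR pcrit)).
by apply: measurableT_comp => //; exact: dom_measurable.
Qed.

Lemma dom_sum_le u : dom u ->
  (\int[mu]_z (V z * u z ^+ 2 + `|u z| `^ pcrit)%:E <=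
   (`|iota u| ^+ 2 + S * (`|iota u| ^+ 2) `^ s)%:E)%E.
Proof.
move=> du; rewrite ge0_integralRD//; last 3 first.
- exact: measurable_V2.
- exact: measurable_crit.
- by move=> z; rewrite mulr_ge0 ?sqr_ge0 ?V_ge0.
by rewrite EFinD; apply: leeD; [exact: dom_potential_le|exact: dom_sobolev_le].
Qed.

Section continuous.
Variable A : R.
Hypothesis A_ge0 : 0 <= A.
Hypothesis Q_le : forall z (a : R), 0 <= a ->
  Q z * a `^ p <= A * (V z * a ^+ 2 + a `^ pcrit).

Definition embedding_cst := A * (1 + S).

Lemma embedding_cst_ge0 : 0 <= embedding_cst.
Proof. by rewrite mulr_ge0// addr_ge0 ?sobolev_cst_ge0. Qed.

Lemma mass_le_energy u : dom u ->
  (mass u <= (A * (`|iota u| ^+ 2 + S * (`|iota u| ^+ 2) `^ s))%:E)%E.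
Proof.
move=> du; rewrite EFinM.
apply: le_trans (lee_wpmul2l _ (dom_sum_le du)); rewrite ?lee_fin//.
have mD := measurable_funD (measurable_V2 du) (measurable_crit du).
rewrite -ge0_integralRZ//; last first.
  by move=> z; rewrite addr_ge0 ?powR_ge0// mulr_ge0 ?sqr_ge0 ?V_ge0.
apply: ge0_le_integralR.
- by apply: measurable_Lp_density => //; exact: dom_measurable.
- exact: measurable_funM.
- by move=> z; rewrite Lp_density_ge0.
- move=> z; apply: le_trans (Q_le z (normr_ge0 _)) _.
  by rewrite real_normK ?num_real.
Qed.

(** The two sides of the pointwise inequality scale differently in [u]; applying
    it to functions of norm [1] makes the estimate homogeneous. *)
Lemma mass_le_norm u : dom u -> (mass u <= (embedding_cst * `|iota u| `^ p)%:E)%E.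
Proof.
move=> du; have s0 : 0 < s by exact: sobolev_exp_gt0.
have [t0|] := ltP 0 `|iota u|; last first.
  move=> t0; have {}t0 : `|iota u| = 0 by apply/eqP; rewrite eq_le t0 normr_ge0.
  apply: (le_trans (mass_le_energy du)); rewrite t0 expr0n/= powR0 ?gt_eqF//.
  by rewrite powR0 ?gt_eqF// !mulr0 addr0 mulr0.
set t := `|iota u| in t0 *.
pose u1 z := t^-1 * u z + 0.
have du1 : dom u1 by exact: (dom_lin t^-1 du dom_nonempty).
have z0 : iota (cst 0) = 0 by exact: (iota0 dom_nonempty iota_lin).
have iu1 : `|iota u1| = 1.
  rewrite [iota u1](iota_lin t^-1 du dom_nonempty) z0 addr0 normrZ.
  by rewrite ger0_norm ?invr_ge0 ?(ltW t0)// mulVf// gt_eqF.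
have uE : u = fun z => t * u1 z.
  by apply/funext => z; rewrite /u1 addr0 mulrA mulfV ?mul1r// gt_eqF.
rewrite {1}uE Lp_massZ//; last exact: dom_measurable.
rewrite muleC EFinM (ger0_norm (ltW t0)).
apply: lee_wpmul2r; first by rewrite lee_fin powR_ge0.
apply: (le_trans (mass_le_energy du1)).
by rewrite iu1 expr1n powR1 mulr1.
Qed.

End continuous.

(** As [n] grows, [u_ i - u_ n] tends to [u_ i] almost everywhere and its energy
    stays small for large [i], so that the energy of [u_ i] is small. *)
Lemma dom_closable (u_ : nat -> space -> R) (e : E) :
  (forall n, dom (u_ n)) -> iota (u_ n) @[n --> \oo] --> e ->
  (\forall z \ae mu, u_ n z @[n --> \oo] --> 0) -> e = 0.
Proof.
move=> du ue u0.
suff : iota (u_ n) @[n --> \oo] --> (0 : E).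
  by move=> u0'; apply: cvg_unique ue u0'; exact: norm_hausdorff.
apply/cvgrPdist_le => eps eps0.
have /cvgrPdist_le/(_ (eps / 2)) := ue; rewrite divr_gt0// => /(_ isT) [n0 _ n0P].
exists n0 => // i /= n0i; rewrite sub0r normrN.
have : (full_energy mu gamma V (u_ i) <= (eps ^+ 2)%:E)%E.
  apply: (@full_energy_lsc _ _ _ mu mu_shift mu_bounded gamma gamma_gt0 V mV V_ge0
    (fun n => u_ i \- u_ n)).
  - by move=> n; apply: C1cB; exact: dom_C1c.
  - exact: dom_C1c.
  - apply: filterS u0 => z uz.
    rewrite -[X in _ --> X]subr0; apply: cvgB uz; exact: cvg_cst.
  exists n0 => // n /= n0n.
  have [dd iE] := dom_sub dom_lin iota_lin (du i) (du n).
  rewrite iota_energy// lee_fin ler_sqr ?nnegrE ?(ltW eps0)// iE.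
  have := n0P i n0i; have := n0P n n0n => h1 h2.
  rewrite (_ : _ - _ = (e - iota (u_ n)) - (e - iota (u_ i))); last first.
    by rewrite opprB [RHS]addrC subrKA.
  by rewrite (le_trans (ler_normB _ _))// [leRHS]splitr lerD.
by rewrite iota_energy// lee_fin ler_sqr ?nnegrE ?(ltW eps0).
Qed.

(** Up to a small multiple of what the energy controls, the mass is at most the
    square of the norm of L^2 on a ball, where local compactness applies. *)
Definition locally_small := forall eps : R, 0 < eps -> exists (A L : R), 0 <= A /\
  forall z (a : R), 0 <= a -> Q z * a `^ p <=
    eps * (V z * a ^+ 2 + a `^ pcrit) +
    A * (\1_[set z : space | `|z| <= L] z * a ^+ 2).

Section compact.
Hypothesis Q_small : locally_small.

(** [|u| <= 1 + u ^ 2], and [V] is bounded from below on the bounded set [C]. *)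
Lemma average_le (C : set space) (M c : R) u : measurable C -> (mu C < +oo)%E ->
  0 < c -> C `<=` [set z : space | (`|z| <= M)%R] ->
  (forall z, `|z| <= M -> c <= V z) -> dom u ->
  `|\int[mu]_(z in C) u z| <= fine (mu C) + c^-1 * `|iota u| ^+ 2.
Proof.
move=> mC Coo c0 CM cV du; have mu' := dom_measurable du.
have [B [B0 uB _ _]] := C1c_bounded (dom_C1c du).
have iu := bounded_integrable mC Coo mu' uB.
have mind : measurable_fun setT (\1_C : space -> R) by exact: measurable_indic.
rewrite -lee_fin EFin_normr_Rintegral//.
apply: (le_trans (le_abse_integral _ mC _)).
  by apply/measurable_EFinP; exact: measurable_funTS.
apply: (@le_trans _ _ (\int[mu]_z (\1_C z + c^-1 * (V z * u z ^+ 2))%:E)%E).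
  rewrite integral_mkcond; apply: ge0_le_integral => //.
  - by move=> z _; rewrite patchE; case: ifP.
  - apply/(measurable_restrictT _ mC); apply: measurable_funTS.
    by apply: measurableT_comp => //; exact/measurable_EFinP.
  - apply/measurable_EFinP; apply: measurable_funD => //.
    by apply: measurable_funM => //; exact: measurable_V2.
  move=> z _; rewrite patchE; case: ifPn => [zC|_]; last first.
    rewrite lee_fin addr_ge0// mulr_ge0 ?invr_ge0 ?(ltW c0)//.
    by rewrite mulr_ge0 ?sqr_ge0 ?V_ge0.
  rewrite /= lee_fin indicE zC.
  apply: (@le_trans _ _ (1 + u z ^+ 2)).
    rewrite -[u z ^+ 2]real_normK ?num_real//.
    by have := sqr_ge0 (`|u z| - 1); rewrite sqrrB1; have := normr_ge0 (u z); nra.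
  rewrite lerD2l mulrA -[leLHS]mul1r ler_wpM2r ?sqr_ge0//.
  by rewrite mulrC ler_pdivlMr// mul1r cV//; apply: CM; exact: set_mem.
rewrite ge0_integralRD//; last 2 first.
- by apply: measurable_funM => //; exact: measurable_V2.
- move=> z; rewrite mulr_ge0 ?invr_ge0 ?(ltW c0)//.
  by rewrite mulr_ge0 ?sqr_ge0 ?V_ge0.
rewrite EFinD integral_indic// setIT; apply: leeD.
  by rewrite fineK// ge0_fin_numE.
rewrite ge0_integralRZ; [|exact: measurable_V2|by rewrite invr_ge0 ltW|]; last first.
  by move=> z; rewrite mulr_ge0 ?sqr_ge0 ?V_ge0.
rewrite EFinM; apply: lee_wpmul2l; first by rewrite lee_fin invr_ge0 ltW.
exact: dom_potential_le.
Qed.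

(** The mass of a difference is small up to finitely many squared differences of
    integrals over bounded sets, and these integrals are bounded sequences. *)
Lemma dom_precompact (u_ : nat -> space -> R) (M : R) :
  (forall n, dom (u_ n)) -> (forall n, `|iota (u_ n)| <= M) ->
  exists2 s : nat -> nat, {homo s : i j / (i < j)%N} &
    forall i j, (i <= j)%N ->
      (mass (u_ (s i) \- u_ (s j))%R <= (fast p i)%:E)%E.
Proof.
move=> du uM.
apply: (@cauchy_extraction _ (fun i j => mass (u_ i \- u_ j)%R)).
  by move=> i; exact: fast_gt0.
move=> e e0.
pose B := (2 * M) ^+ 2 + S * ((2 * M) ^+ 2) `^ s.
have s0 : 0 < s by exact: sobolev_exp_gt0.
have B0 : 0 <= B by rewrite addr_ge0 ?sqr_ge0// mulr_ge0 ?powR_ge0 ?sobolev_cst_ge0.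
have B1 : 0 < B + 1 by rewrite ltr_wpDl.
have [A [L [A0 QA]]] := Q_small (divr_gt0 (divr_gt0 e0 (ltr0n R 2)) B1).
have AM1 : 0 < A * (2 * M) ^+ 2 + 1 by rewrite ltr_wpDl// mulr_ge0 ?sqr_ge0.
have [I [C [K [K0 mC Coo CM CK]]]] := @rellich _ _ _ mu mu_shift mu_bounded gamma
  gamma_gt0 m_ge1 mu_box L _ (divr_gt0 (divr_gt0 e0 (ltr0n R 2)) AM1).
exists I, (fun i n => \int[mu]_(y in C i) u_ n y), (A * K); split.
- exact: mulr_ge0.
- move=> i; have [M' CM'] := CM i; have [c c0 cV] := V_low M'.
  exists (fine (mu (C i)) + c^-1 * M ^+ 2) => n.
  apply: (le_trans (average_le (mC i) (Coo i) c0 CM' cV (du n))).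
  rewrite lerD2l ler_wpM2l ?invr_ge0 ?(ltW c0)//.
  by rewrite ler_sqr ?nnegrE// (le_trans _ (uM n)).
move=> i j; have [dd iE] := dom_sub dom_lin iota_lin (du i) (du j).
set w := (u_ i \- u_ j) in dd iE *.
have wM : `|iota w| <= 2 * M.
  by rewrite iE (le_trans (ler_normB _ _))// mulrDl mul1r lerD.
have M0 : 0 <= 2 * M by apply: le_trans wM.
have w2 : `|iota w| ^+ 2 <= (2 * M) ^+ 2 by rewrite ler_sqr ?nnegrE.
have mind : measurable_fun setT (\1_[set z : space | (`|z| <= L)%R] : space -> R).
  by apply: measurable_indic; exact: measurable_norm_le.
pose F z := V z * w z ^+ 2 + `|w z| `^ pcrit.
pose H z := \1_[set z : space | (`|z| <= L)%R] z * w z ^+ 2.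
have mF : measurable_fun setT F.
  by apply: measurable_funD; [exact: measurable_V2|exact: measurable_crit].
have mH : measurable_fun setT H.
  by apply: measurable_funM => //; apply: measurable_funX; exact: dom_measurable.
have F0 z : 0 <= F z.
  by rewrite addr_ge0 ?powR_ge0// mulr_ge0 ?sqr_ge0 ?V_ge0.
have H0 z : 0 <= H z by rewrite mulr_ge0 ?sqr_ge0.
have intF : (\int[mu]_z (F z)%:E <= B%:E)%E.
  apply: (le_trans (dom_sum_le dd)); rewrite lee_fin lerD//.
  rewrite ler_wpM2l ?sobolev_cst_ge0//.
  by apply: ge0_ler_powR; rewrite ?nnegrE ?sqr_ge0 ?(ltW s0).
have eB0 : 0 <= e / 2 / (B + 1) by rewrite !divr_ge0// ltW.
have massw : (mass w <= (e / 2 / (B + 1))%:E * \int[mu]_z (F z)%:E +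
    A%:E * \int[mu]_z (H z)%:E)%E.
  rewrite -ge0_integralRZ// -ge0_integralRZ// -ge0_integralRD//; last 4 first.
  - exact: measurable_funM.
  - exact: measurable_funM.
  - by move=> z; rewrite mulr_ge0.
  - by move=> z; rewrite mulr_ge0.
  apply: ge0_le_integralR.
  - by apply: measurable_Lp_density => //; exact: dom_measurable.
  - by apply: measurable_funD; exact: measurable_funM.
  - by move=> z; rewrite Lp_density_ge0.
  - move=> z; apply: le_trans (QA z _ (normr_ge0 _)) _.
    by rewrite real_normK ?num_real.
apply: (le_trans massw).
set P : R := \sum_i _.
have SP : \sum_i (\int[mu]_(y in C i) w y) ^+ 2 = P.
  apply: eq_bigr => l _; congr (_ ^+ 2).
  have bdd n : mu.-integrable (C l) (EFin \o u_ n).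
    have [b [_ ub _ _]] := C1c_bounded (dom_C1c (du n)).
    exact: bounded_integrable (mC l) (Coo l) (dom_measurable (du n)) ub.
  exact: (RintegralB (mC l) (bdd i) (bdd j)).
have intH : (\int[mu]_z (H z)%:E <=
    (e / 2 / (A * (2 * M) ^+ 2 + 1) * (2 * M) ^+ 2 + K * P)%:E)%E.
  apply: (le_trans (CK w (dom_C1c dd))); rewrite SP EFinD; apply: leeD => //.
  rewrite [leRHS]EFinM; apply: lee_wpmul2l.
    by rewrite lee_fin !divr_ge0// ltW.
  by rewrite (le_trans (dom_energy_le dd))// lee_fin.
apply: (le_trans (leeD (lee_wpmul2l _ intF) (lee_wpmul2l _ intH))); rewrite ?lee_fin//.
rewrite (mulrDr A) addrA (mulrA A K) lerD2r [leRHS]splitr.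
apply: lerD.
  rewrite (_ : _ * B = e / 2 * (B / (B + 1))).
    by rewrite ler_piMr ?divr_ge0 ?(ltW e0)// ler_pdivrMr// mul1r lerDl.
  by rewrite mulrAC mulrA.
rewrite (_ : A * _ = e / 2 * ((A * (2 * M) ^+ 2) / (A * (2 * M) ^+ 2 + 1))).
  by rewrite ler_piMr ?divr_ge0 ?(ltW e0)// ler_pdivrMr// mul1r lerDl.
by set X := (_ + 1)^-1; ring.
Qed.

End compact.

Theorem grushin_embedding (A : R) : 0 <= A ->
  (forall z (a : R), 0 <= a ->
     Q z * a `^ p <= A * (V z * a ^+ 2 + a `^ pcrit)) ->
  exists J : E -> space -> R,
  [/\ forall e, measurable_fun setT (J e),
      forall e, (mass (J e) <= (embedding_cst A * (2 * `|e|) `^ p)%:E)%E,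
      forall (a : R) e e', \forall z \ae mu, J (a *: e + e') z = a * J e z + J e' z,
      forall u, dom u -> \forall z \ae mu, J (iota u) z = u z &
      forall e, (\forall z \ae mu, J e z = 0) -> e = 0] /\
  (locally_small -> forall (e_ : nat -> E) (M : R), (forall n, `|e_ n| <= M) ->
    exists2 s : nat -> nat, {homo s : i j / (i < j)%N} &
    exists g : space -> R, [/\ measurable_fun setT g, (mass g < +oo)%E &
      forall n, (mass (J (e_ (s n)) \- g)%R <= (3 `^ p * (2 * 2 ^- n))%:E)%E]).
Proof.
move=> A0 QA; have K0 := embedding_cst_ge0 A0.
have massK := mass_le_norm A0 QA.
have [J [JP Jlin Jincl]] := embedding_exists mQ Q_gt0 p_gt0 K0 dom_nonempty dom_lin
  dom_measurable iota_lin iota_dense massK.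
exists J; split; first split.
- by move=> e; have [] := JP e.
- by move=> e; exact: (represents_bounded p_gt0 K0 dom_nonempty iota_lin (JP e)).
- exact: Jlin.
- exact: Jincl.
- move=> e; apply: (represents_injective mQ Q_gt0 p_gt0 K0 dom_nonempty dom_lin
    dom_measurable iota_lin iota_dense massK dom_closable (JP e)).
move=> small e_ M eM.
exact: (compact_extraction mQ Q_gt0 p_gt0 K0 dom_measurable iota_dense massK
  (dom_precompact small) JP eM).
Qed.

End grushin_embedding.

(** * Boxes and the Euclidean norm *)

Section lebesgue_box.
Context {R : realType} {m k : nat}.
Local Notation space := ('rV[R]_m * 'rV[R]_k)%type.
Local Notation mu := (lebesgue R m k).

Definition cube n (r : R) : set 'rV[R]_n := [set v | forall i, `|v 0 i| <= r].

Lemma measurable_cube n (r : R) : measurable (@cube n r).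
Proof.
rewrite (_ : cube r = \bigcap_(i in [set: 'I_n])
    ((fun v : 'rV[R]_n => v 0 i : measurableTypeR R) @^-1` `[- r, r]%classic)).
  apply: fin_bigcap_measurable => // i _.
  by rewrite -[X in measurable X]setTI; apply: measurable_coord.
apply/seteqP; split => [v vr i _|v vr i].
  by rewrite /= in_itv/= -ler_norml; exact: vr.
by have := vr i I; rewrite /= in_itv/= -ler_norml.
Qed.

Lemma lebesgue_rV_cube n (r : R) : 0 < r ->
  lebesgue_rV R n (cube r) = ((2 * r) ^+ n)%:E.
Proof.
move=> r0; rewrite (_ : cube r = [set v : 'rV[R]_n | forall i,
    (fun=> `[- r, r]%classic : set (measurableTypeR R)) i (v 0 i)]); last first.
  by apply/seteqP; split => v /= vr i; have := vr i; rewrite in_itv/= ler_norml.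
apply: etrans (@lebesgue_rV_box R n (fun=> `[- r, r]%classic) _) _ => [i|].
  exact: measurable_itv.
under eq_bigr => i _.
  rewrite lebesgue_measure_itv/= lte_fin (_ : - r < r); last by lra.
  rewrite -EFinB (_ : r - - r = 2 * r); last by ring.
  over.
by rewrite prodEFin prodr_const card_ord.
Qed.

Lemma lebesgue_box (gamma r : R) : 0 < r ->
  mu (@grushin_box R m k gamma r) =
  (2 ^+ (m + k) * r `^ homogeneous_dim m k gamma)%:E.
Proof.
move=> r0.
have -> : @grushin_box R m k gamma r = cube r `*` cube (r `^ (1 + gamma)).
  by apply/seteqP; split.
apply: etrans (product_measure1E _ _ _ _) _; [exact: measurable_cube..|].
apply: (@etrans _ _ (((2 * r) ^+ m)%:E * ((2 * r `^ (1 + gamma)) ^+ k)%:E)%E).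
  by congr (_ * _)%E; apply: lebesgue_rV_cube; rewrite ?powR_gt0.
rewrite -EFinM; congr EFin.
rewrite !exprMn mulrACA -exprD; congr (_ * _).
rewrite (addrC 1) /homogeneous_dim [RHS]powRD; last by rewrite (gt_eqF r0) implybT.
by rewrite powR_mulrn ?(ltW r0)// powRrM powR_mulrn ?powR_ge0.
Qed.

Lemma lebesgue_bounded (M : R) : (mu [set z : space | (`|z| <= M)%R] < +oo)%E.
Proof.
pose r := `|M| + 1; have r0 : 0 < r by rewrite ltr_wpDl.
have mr n : measurable (@cube n r) by exact: measurable_cube.
apply: (@le_lt_trans _ _ (mu (cube r `*` cube r))).
  apply: le_measure; rewrite ?inE.
  - exact: measurable_norm_le.
  - exact: measurableX.
  move=> z; rewrite /= prod_normE ge_max => /andP[z1 z2].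
  have Mr : M <= r by rewrite (le_trans (ler_norm M))// lerDl.
  by split => i; apply: le_trans (coord_le_norm _ _) _; exact: le_trans Mr.
rewrite [X in (X < _)%E](product_measure1E _ _ (mr m) (mr k)).
apply: (@le_lt_trans _ _ (((2 * r) ^+ m)%:E * ((2 * r) ^+ k)%:E)%E).
  apply: le_of_eq.
  by congr (_ * _)%E; apply: lebesgue_rV_cube.
by rewrite -EFinM ltry.
Qed.

End lebesgue_box.

Section euclidean_norm.
Context {R : realType} {m k : nat}.
Local Notation space := ('rV[R]_m * 'rV[R]_k)%type.
Implicit Type z : space.

Lemma znorm_ge0 z : 0 <= znorm z. Proof. exact: sqrtr_ge0. Qed.

Lemma measurable_znorm : measurable_fun setT (@znorm R m k).
Proof.
apply: measurableT_comp.
  by apply: continuous_measurable_fun => x; exact: sqrt_continuous.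
by apply: measurable_funD; apply: measurable_funX;
  apply: (measurableT_comp (@measurable_enorm R _)).
Qed.

Lemma enorm_le_znorm z : enorm z.1 <= znorm z /\ enorm z.2 <= znorm z.
Proof.
by split; rewrite -ler_sqr ?nnegrE ?enorm_ge0 ?znorm_ge0//
  [leRHS]sqr_sqrtr ?addr_ge0 ?sqr_ge0// ?lerDl ?lerDr sqr_ge0.
Qed.

Lemma norm_le_znorm z : `|z| <= znorm z.
Proof.
have [z1 z2] := enorm_le_znorm z.
rewrite prod_normE ge_max; apply/andP; split; rewrite [leLHS]mx_normrE.
  apply/bigmax_leP; split=> [|[i1 i2] _]; first exact: znorm_ge0.
  by rewrite (ord1 i1) (le_trans (coord_le_enorm _ _)).
apply/bigmax_leP; split=> [|[i1 i2] _]; first exact: znorm_ge0.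
by rewrite (ord1 i1) (le_trans (coord_le_enorm _ _)).
Qed.

Lemma znorm_le z (M : R) : 0 <= M -> `|z| <= M -> znorm z <= (m + k)%:R * M.
Proof.
move=> M0; rewrite prod_normE ge_max => /andP[z1 z2].
have e1 : enorm z.1 <= m%:R * M.
  by apply: enorm_le => // i; rewrite (le_trans (coord_le_norm _ _)).
have e2 : enorm z.2 <= k%:R * M.
  by apply: enorm_le => // i; rewrite (le_trans (coord_le_norm _ _)).
apply: (@le_trans _ _ (enorm z.1 + enorm z.2)); last by rewrite natrD mulrDl lerD.
rewrite -ler_sqr ?nnegrE ?addr_ge0 ?enorm_ge0 ?znorm_ge0//.
rewrite sqr_sqrtr ?addr_ge0 ?sqr_ge0// sqrrD.
by rewrite addrAC lerDl mulrn_wge0// mulr_ge0 ?enorm_ge0.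
Qed.

(** For either sign of [alpha], [(1 + |z|) ^ alpha <= (1 + |z|) ^ |alpha|], and
    the right-hand side increases with [|z|]. *)
Lemma decay_lower (C alpha M : R) : 0 < C -> exists2 c : R, 0 < c &
  forall z, `|z| <= M -> c <= C / (1 + znorm z) `^ alpha.
Proof.
move=> C0; pose D := 1 + (m + k)%:R * `|M|.
have D1 : 1 <= D by rewrite lerDl mulr_ge0.
have D0 : 0 < D by rewrite (lt_le_trans _ D1).
exists (C / D `^ `|alpha|); first by rewrite divr_gt0 ?powR_gt0.
move=> z zM; have z0 := znorm_ge0 z.
rewrite ler_wpM2l ?(ltW C0)// lef_pV2 ?posrE ?powR_gt0//; last by rewrite ltr_wpDr.
apply: (@le_trans _ _ ((1 + znorm z) `^ `|alpha|)).
  by apply: ler_powR; rewrite ?lerDl ?ler_norm.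
apply: ge0_ler_powR; rewrite ?nnegrE ?addr_ge0 ?(ltW D0)//.
by rewrite lerD2l znorm_le// (le_trans zM)// ler_norm.
Qed.

Lemma measurable_decay (C alpha : R) :
  measurable_fun setT (fun z : space => C / (1 + znorm z) `^ alpha).
Proof.
rewrite (_ : (fun _ => _) = (fun z : space => C * (1 + znorm z) `^ (- alpha))).
  apply: measurable_funM => //; apply: (measurableT_comp (measurable_powR _)).
  by apply: measurable_funD => //; exact: measurable_znorm.
by apply/funext => z; rewrite powRN.
Qed.

End euclidean_norm.

(** * Pointwise inequalities *)

Section pointwise.
Context {R : realType}.
Implicit Types a w alpha beta p b : R.

(** Both factors are at most the corresponding powers of the larger of [X] and
    [Y], whose product is this number itself. *)
Lemma powR_interpolation (X Y theta : R) : 0 <= X -> 0 <= Y ->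
  0 <= theta <= 1 -> X `^ theta * Y `^ (1 - theta) <= X + Y.
Proof.
move=> X0 Y0 /andP[t0 t1]; pose M := Num.max X Y.
have XM : X <= M by rewrite le_max lexx.
have YM : Y <= M by rewrite le_max lexx orbT.
have M0 : 0 <= M by exact: le_trans XM.
have MXY : M <= X + Y by rewrite ge_max lerDl lerDr X0 Y0.
apply: le_trans MXY.
have [M00|Mn0] := eqVneq M 0.
  have X00 : X = 0 by apply/eqP; rewrite eq_le X0 -M00 XM.
  have Y00 : Y = 0 by apply/eqP; rewrite eq_le Y0 -M00 YM.
  rewrite X00 Y00 M00 -[leRHS](mulr0 0) -powRD ?subrKC ?powRr1//.
  by rewrite oner_eq0.
apply: (@le_trans _ _ (M `^ theta * M `^ (1 - theta))).
  by apply: ler_pM; rewrite ?powR_ge0//; apply: ge0_ler_powR; rewrite ?nnegrE ?subr_ge0.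
by rewrite -powRD ?subrKC ?powRr1//; rewrite Mn0 implybT.
Qed.

(** [a ^ p] is the product of [(a ^ 2) ^ theta] and [(a ^ b) ^ (1 - theta)]. *)
Lemma weighted_young a w alpha beta p b (theta : R) : 0 <= a -> 1 <= w -> 0 < p ->
  0 <= theta <= 1 -> theta * alpha <= beta -> p = 2 * theta + b * (1 - theta) ->
  a `^ p / w `^ beta <= a ^+ 2 / w `^ alpha + a `^ b.
Proof.
move=> a0 w1 p0 t01 tab pE.
have w0 : 0 < w by rewrite (lt_le_trans _ w1).
have X0 : 0 <= a ^+ 2 / w `^ alpha by rewrite divr_ge0 ?sqr_ge0 ?powR_ge0.
have [a00|an0] := eqVneq a 0.
  by rewrite {1}a00 powR0 ?gt_eqF// mul0r addr_ge0// powR_ge0.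
apply: le_trans (powR_interpolation X0 (powR_ge0 _ _) t01).
rewrite -!powRN powRM ?sqr_ge0 ?powR_ge0// -powR_mulrn// -!powRrM.
rewrite [leRHS]mulrAC -powRD ?an0 ?implybT// -pE.
apply: ler_wpM2l; first exact: powR_ge0.
by apply: ler_powR => //; rewrite mulNr lerN2 mulrC.
Qed.

Lemma powR_large (c e : R) : 0 < c -> 0 < e ->
  forall x, (e^-1) `^ c^-1 <= x -> e^-1 <= x `^ c.
Proof.
move=> c0 e0 x xc.
have -> : e^-1 = ((e^-1) `^ c^-1) `^ c.
  by rewrite -powRrM mulVf ?gt_eqF// powRr1// invr_ge0 ltW.
by apply: ge0_ler_powR; rewrite ?nnegrE ?powR_ge0 ?(ltW c0)// (le_trans _ xc)// powR_ge0.
Qed.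

(** Away from a large ball the weight [w^-beta] is negligible against both [1]
    and [w^-alpha]; inside the ball [a^p] is negligible against [a^b] for large
    [a]. *)
Lemma weighted_small alpha beta p b (e : R) : alpha < beta -> 0 < beta ->
  2 <= p -> p < b -> 0 < e -> exists A L : R, 0 <= A /\
  forall w a, 1 <= w -> 0 <= a -> a `^ p / w `^ beta <=
    e * (a ^+ 2 / w `^ alpha + a `^ b) + A * (if w <= L then a ^+ 2 else 0).
Proof.
move=> ab b0 p2 pb e0; pose d := Num.min beta (beta - alpha).
have d0 : 0 < d by rewrite lt_min b0 subr_gt0.
have db : d <= beta by rewrite ge_min lexx.
have dba : d <= beta - alpha by rewrite ge_min lexx orbT.
pose A0 := (e^-1) `^ (b - p)^-1.
exists (A0 `^ (p - 2)), ((e^-1) `^ d^-1); split; first exact: powR_ge0.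
move=> w a w1 a0; have w0 : 0 < w by rewrite (lt_le_trans _ w1).
have p0 : 0 < p by rewrite (lt_le_trans _ p2).
have X0 : 0 <= a ^+ 2 / w `^ alpha by rewrite divr_ge0 ?sqr_ge0 ?powR_ge0.
have [->|an0] := eqVneq a 0.
  rewrite powR0 ?gt_eqF// mul0r; case: ifP => _; rewrite ?expr0n/= ?mulr0 ?mul0r ?add0r ?addr0.
    by rewrite mulr_ge0 ?powR_ge0 ?(ltW e0).
  by rewrite mulr_ge0 ?powR_ge0 ?(ltW e0).
have apos : 0 < a by rewrite lt_def an0.
case: ifPn => [wL|]; last first.
  rewrite -ltNge => /ltW/(powR_large d0 e0) wd; rewrite mulr0 addr0.
  have wdi : (w `^ d)^-1 <= e by rewrite invf_ple ?posrE ?powR_gt0.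
  have wb : (w `^ beta)^-1 <= e.
    by apply: le_trans wdi; rewrite lef_pV2 ?posrE ?powR_gt0//; exact: ler_powR.
  have wba : (w `^ beta)^-1 <= e / w `^ alpha.
    rewrite ler_pdivlMr ?powR_gt0// mulrC -powRN -powRD; last first.
      by rewrite (gt_eqF w0) implybT.
    apply: le_trans wdi; rewrite -powRN; apply: ler_powR => //.
    by move: dba; lra.
  have [a1|a1] := leP a 1.
    apply: (@le_trans _ _ (a ^+ 2 * (e / w `^ alpha))).
      apply: ler_pM; rewrite ?powR_ge0 ?invr_ge0 ?powR_ge0//.
      by rewrite -powR_mulrn//; apply: ger_powR; rewrite ?apos.
    by rewrite mulrCA ler_wpM2l ?(ltW e0)// lerDl powR_ge0.
  apply: (@le_trans _ _ (a `^ b * e)).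
    apply: ler_pM; rewrite ?powR_ge0 ?invr_ge0 ?powR_ge0//.
    by apply: ler_powR; rewrite ltW.
  by rewrite mulrC ler_wpM2l ?(ltW e0)// lerDr.
have wb1 : (w `^ beta)^-1 <= 1.
  rewrite invf_le1 ?powR_gt0// -[leLHS](powRr0 w); apply: ler_powR => //.
  exact: ltW.
apply: (@le_trans _ _ (a `^ p)); first by rewrite ler_piMr ?powR_ge0.
have [aA|aA] := leP A0 a.
  have bp0 : 0 < b - p by rewrite subr_gt0.
  have h := powR_large bp0 e0 aA.
  apply: (@le_trans _ _ (e * a `^ b)); last first.
    rewrite mulrDr -addrA [leRHS]addrCA lerDl addr_ge0 ?mulr_ge0 ?powR_ge0 ?(ltW e0)//.
    by rewrite invr_ge0 powR_ge0.
  rewrite -(subrK p b) powRD; last by rewrite an0 implybT.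
  by rewrite mulrA ler_peMl ?powR_ge0// -ler_pdivrMl// mulr1.
rewrite (@le_trans _ _ (A0 `^ (p - 2) * a ^+ 2))//; last first.
  by rewrite lerDr mulr_ge0 ?addr_ge0 ?powR_ge0 ?(ltW e0).
rewrite -{1}(subrK 2 p) [a `^ _]powRD; last by rewrite an0 implybT.
rewrite powR_mulrn// ler_wpM2r ?sqr_ge0//; apply: ge0_ler_powR.
- by rewrite subr_ge0.
- by rewrite nnegrE.
- by rewrite nnegrE powR_ge0.
exact: ltW.
Qed.

End pointwise.

(** * The energy domain *)

Section test_functions.
Context {R : realType} {m k : nat}.
Local Notation space := ('rV[R]_m * 'rV[R]_k)%type.
Local Notation dir i := (direction R i).
Implicit Types (u v : space -> R) (a : R).

Lemma partial_lin a u v i : (forall z, derivable u z (dir i)) ->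
  (forall z, derivable v z (dir i)) ->
  partial i (fun z => a * u z + v z) =
  (fun z => a * partial i u z + partial i v z).
Proof.
move=> du dv; apply/funext => z.
have da : derivable (a \*: u : space -> R) z (dir i) by exact: derivableZ.
by rewrite /partial [LHS](deriveD da (dv z)) deriveZ.
Qed.

Lemma foldr_partial_lin a u v s : smooth u -> smooth v ->
  foldr (@partial R m k) (fun z => a * u z + v z) s =
  (fun z => a * foldr (@partial R m k) u s z + foldr (@partial R m k) v s z).
Proof.
move=> su sv; elim: s => //= i s ->.
by apply: partial_lin; [have [_ /(_ i)] := su s|have [_ /(_ i)] := sv s].
Qed.

Lemma smooth_lin a u v : smooth u -> smooth v -> smooth (fun z => a * u z + v z).
Proof.
move=> su sv s; rewrite foldr_partial_lin//.
have [cu du] := su s; have [cv dv] := sv s; split.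
  move=> z; apply: cvgD; last exact: cv.
  by apply: cvgM; [exact: cvg_cst|exact: cu].
move=> i z; apply: (@derivableD _ _ _ (a \*: foldr (@partial R m k) u s : space -> R)).
  by apply: derivableZ; exact: du.
exact: dv.
Qed.

Lemma test_function_lin a u v : test_function u -> test_function v ->
  test_function (fun z => a * u z + v z).
Proof.
move=> [su cu] [sv cv]; split; first exact: smooth_lin.
apply: (subclosed_compact _ (compactU cu cv)); first exact: closed_closure.
rewrite -closureU; apply: closure_subset => z /= auv.
have [u0|] := eqVneq (u z) 0; last by left.
by right; move: auv; rewrite /= u0 mulr0 add0r.
Qed.

Lemma test_function0 : test_function (cst 0 : space -> R).
Proof.
have E s : foldr (@partial R m k) (cst 0 : space -> R) s = cst 0.
  elim: s => //= i s ->; apply/funext => z.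
  by rewrite /partial derive_cst.
split; first by move=> s; rewrite E; split; [exact: cst_continuous|move=> i z; exact: derivable_cst].
rewrite (_ : mkset _ = set0) ?closure0; first exact: compact0.
by apply/seteqP; split => z //=; rewrite eqxx.
Qed.

End test_functions.

Section energy_domain.
Context {R : realType} {m k : nat}.
Local Notation space := ('rV[R]_m * 'rV[R]_k)%type.
Local Notation mu := (@lebesgue_sf R m k).
Variables (gamma : R) (V V' : space -> R) (N : set space).
Hypothesis mN : measurable N.
Hypothesis N0 : mu N = 0%E.
Hypothesis V'E : forall z, ~ N z -> V' z = V z.
Hypothesis mV' : measurable_fun setT V'.
Hypothesis V'_ge0 : forall z, 0 <= V' z.
Implicit Types (u v : space -> R) (a : R).

Lemma energy_full u : energy gamma V u = full_energy mu gamma V' u.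
Proof.
apply: (@integral_modification _ _ _ mu N) => // z Nz.
by rewrite sqr_znorm_grushin_grad V'E.
Qed.

Lemma full_energy_ge0 u : (0 <= full_energy mu gamma V' u)%E.
Proof.
apply: integral_ge0 => z _.
by rewrite lee_fin addr_ge0 ?grushin_grad2_ge0// mulr_ge0 ?sqr_ge0.
Qed.

Lemma energy_domain0 : energy_domain gamma V (cst 0).
Proof.
split; first exact: test_function0.
rewrite energy_full /full_energy (eq_integral (cst 0%E)) ?integral0//.
move=> z _ /=; rewrite expr0n mulr0 addr0 /grushin_grad2 big1// => i _.
by rewrite /partial derive_cst expr0n mulr0.
Qed.

Lemma energy_domain_lin a u v : energy_domain gamma V u ->
  energy_domain gamma V v -> energy_domain gamma V (fun z => a * u z + v z).
Proof.
move=> [tu Eu] [tv Ev]; have tw := test_function_lin a tu tv.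
split=> //; rewrite energy_full in Eu; rewrite energy_full in Ev.
rewrite energy_full.
have [cu cv cw] : [/\ C1c u, C1c v & C1c (fun z => a * u z + v z)].
  by split; exact: test_function_C1c.
pose F (f : space -> R) z := grushin_grad2 gamma f z + V' z * f z ^+ 2.
have mF f : C1c f -> measurable_fun setT (F f).
  move=> cf; apply: measurable_funD; first exact: measurable_grushin_grad2.
  exact: measurable_potential.
have F0 f z : 0 <= F f z.
  by rewrite addr_ge0 ?grushin_grad2_ge0// mulr_ge0 ?sqr_ge0.
have sq2 (x y : R) : (a * x + y) ^+ 2 <= 2 * a ^+ 2 * x ^+ 2 + 2 * y ^+ 2.
  by have := sqr_ge0 (a * x - y); nra.
have a2 : 0 <= 2 * a ^+ 2 by rewrite mulr_ge0 ?sqr_ge0.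
apply: (@le_lt_trans _ _ (\int[mu]_z (2 * a ^+ 2 * F u z + 2 * F v z)%:E)%E).
  apply: ge0_le_integralR.
  - exact: mF.
  - by apply: measurable_funD; apply: measurable_funM => //; exact: mF.
  - exact: F0.
  move=> z; rewrite /F !mulrDr addrACA; apply: lerD.
    rewrite /grushin_grad2 !mulr_sumr -big_split/=; apply: ler_sum => i _.
    rewrite partial_lin; [|by move=> ?; exact: C1c_derivable..].
    apply: le_trans (ler_wpM2l (sqr_ge0 _) (sq2 _ _)) _.
    by apply: le_of_eq; ring.
  apply: le_trans (ler_wpM2l (V'_ge0 z) (sq2 _ _)) _.
  by apply: le_of_eq; ring.
rewrite ge0_integralRD; last 4 first.
- by apply: measurable_funM => //; exact: mF.
- by apply: measurable_funM => //; exact: mF.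
- by move=> z; rewrite mulr_ge0.
- by move=> z; rewrite mulr_ge0.
rewrite !ge0_integralRZ//; try exact: mF.
by apply: lte_add_pinfty; apply: lte_mul_pinfty; rewrite ?lee_fin.
Qed.

Lemma energy_domain_norm (E : completeNormedModType R) (iota : (space -> R) -> E) u :
  is_energy_completion gamma V iota -> energy_domain gamma V u ->
  full_energy mu gamma V' u = (`|iota u| ^+ 2)%:E.
Proof.
move=> [_ iso _] du; rewrite iso// /energy_norm sqr_sqrtr; last first.
  by rewrite fine_ge0// energy_full full_energy_ge0.
rewrite -energy_full fineK// ge0_fin_numE; first by case: du.
by rewrite energy_full full_energy_ge0.
Qed.

End energy_domain.

(** * Exponents *)

Section exponents.
Context {R : realType}.
Variables (m k : nat) (gamma alpha beta p : R).
Hypothesis gamma_gt0 : 0 < gamma.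
Hypothesis k_ge1 : (1 <= k)%N.
Hypothesis N_ge3 : (3 <= m + k)%N.
Local Notation N := ((m + k)%:R : R).
Local Notation b := (critical_exponent m k gamma).

Lemma critical_exponent_bounds : [/\ 3 <= N, 2 < b & (b - 2) * (N - 2) < 4].
Proof.
have N3 : 3 <= N by rewrite ler_nat.
have NgN : N < homogeneous_dim m k gamma.
  rewrite /homogeneous_dim natrD mulrDl mul1r addrCA -subr_gt0.
  rewrite (_ : _ - _ = gamma * k%:R); last by ring.
  by rewrite mulr_gt0// ltr0n.
rewrite /critical_exponent; set D := homogeneous_dim m k gamma in NgN *.
have D2 : 0 < D - 2 by lra.
have -> : 2 * D / (D - 2) = 2 + 4 / (D - 2) by field; rewrite gt_eqF.
split=> //; first by rewrite ltrDl divr_gt0.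
rewrite addrAC subrr add0r mulrAC ltr_pdivrMr//.
by lra.
Qed.

(** In the plane of the exponents of [|u|] and of the weight, the point
    [(p, beta)] lies above the segment from [(2, alpha)] to [(b, 0)]. *)
Definition above_segment := [/\ 2 <= p, p <= b & (b - p) / (b - 2) * alpha <= beta].

Lemma above_segment_le : alpha <= beta -> 0 <= beta -> 2 <= p -> p <= b ->
  above_segment.
Proof.
have [_ b2 _] := critical_exponent_bounds; move=> ab b0 p2 pb.
have t0 : 0 <= (b - p) / (b - 2) by rewrite divr_ge0//; lra.
have t1 : (b - p) / (b - 2) <= 1 by rewrite ler_pdivrMr; lra.
by split => //; have [a0|a0] := leP 0 alpha; nra.
Qed.

(** With [a] the larger of [2] and [alpha], the point [(p, beta)] lies above the
    line through [(2, a)] and [(2 N / (N - a), 0)].  This line passes above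
    [(2, alpha)], and above [(b, 0)] since [b < 2 N / (N - 2)]. *)
Lemma above_segment_lt : alpha <= N -> beta < N ->
  (p_underline m k alpha beta <= p%:E)%E -> p <= b -> above_segment.
Proof.
have [N3 b2 bN] := critical_exponent_bounds; move=> aN bN' + pb.
rewrite /p_underline !ge_max !lee_fin => /and3P[p2 pN pa]; split => //.
have b20 : 0 < b - 2 by rewrite subr_gt0.
(* For [alpha = N] the lower bound on [p] is infinite. *)
have aN' : alpha < N.
  rewrite lt_def aN andbT; apply/eqP => Na.
  move: pa; rewrite -Na subrr inver eqxx gt0_muley ?leye_eq//.
  by rewrite lte_fin mulr_gt0// subr_gt0.
have {}pN : 2 * (N - beta) <= p * (N - 2) by rewrite -ler_pdivrMr//; lra.
have {pa} pa : 2 * (N - beta) <= p * (N - alpha).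
  rewrite -ler_pdivrMr ?subr_gt0//; move: pa.
  by rewrite inver gt_eqF ?subr_gt0// -EFinM lee_fin.
rewrite mulrAC ler_pdivrMr//.
have pN' := ler_wpM2r (ltW b20) pN; have pa' := ler_wpM2r (ltW b20) pa.
have p20 : 0 <= p - 2 by rewrite subr_ge0.
have bp0 : 0 <= b - p by rewrite subr_ge0.
have [a2|a2] := leP alpha 2.
  have h1 := ler_wpM2l bp0 a2.
  have h2 : 0 <= (p - 2) * (4 - (b - 2) * (N - 2)).
    by rewrite mulr_ge0// subr_ge0 ltW.
  lra.
have h1 : (b - 2) * (N - alpha) <= (b - 2) * (N - 2).
  by rewrite ler_wpM2l ?(ltW b20)// lerD2l lerN2 ltW.
have h2 : 0 <= (p - 2) * (2 * alpha - (b - 2) * (N - alpha)).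
  by rewrite mulr_ge0// subr_ge0; lra.
lra.
Qed.

End exponents.

(** * The embedding theorem *)

Section conclusion.
Context {R : realType} {m k : nat}.
Local Notation space := ('rV[R]_m * 'rV[R]_k)%type.
Local Notation mu := (@lebesgue_sf R m k).
Implicit Types (f : space -> R).

Lemma borel_lebesgue_measurable f : measurable_fun setT f -> lebesgue_measurable f.
Proof.
move=> mf B mB; exists (f @^-1` B).
  by rewrite -[X in measurable X]setTI; exact: mf.
exists set0; last by rewrite setU0.
exact: negligible_set0.
Qed.

Variables (Q Q' : space -> R) (p : R) (N : set space).
Hypothesis mN : measurable N.
Hypothesis N0 : mu N = 0%E.
Hypothesis Q'E : forall z, ~ N z -> Q' z = Q z.

Lemma integral_mass f :
  (\int[lebesgue R m k]_z (Q z * `|f z| `^ p)%:E = Lp_mass mu Q' p f)%E.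
Proof.
by apply: (@integral_modification _ _ _ mu N) => // z Nz; rewrite Q'E.
Qed.

Lemma LpQ_norm_le f (c : R) : 0 < p -> (forall z, 0 < Q' z) ->
  (Lp_mass mu Q' p f <= c%:E)%E -> (LpQ_norm Q p f <= (c `^ p^-1)%:E)%E.
Proof.
move=> p0 Q'0 fc; rewrite /LpQ_norm integral_mass -poweR_EFin.
have m0 : (0 <= Lp_mass mu Q' p f)%E by exact: Lp_mass_ge0.
apply: gt0_ler_poweR => //; rewrite ?invr_ge0 ?(ltW p0)//.
  by rewrite in_itv/= m0 leey.
by rewrite in_itv/= (le_trans m0 fc) leey.
Qed.

End conclusion.

Theorem theorem1p1 (R : realType) (m k : nat) (gamma : R)
    (V Q : 'rV[R]_m * 'rV[R]_k -> R) (CV alpha CQ beta p : R)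
    (E : completeNormedModType R) (iota : ('rV[R]_m * 'rV[R]_k -> R) -> E)
    (gamma_gt0 : 0 < gamma)
    (m_ge1 : (1 <= m)%N) (k_ge1 : (1 <= k)%N) (N_ge3 : (3 <= m + k)%N)
    (V_measurable : lebesgue_measurable V)
    (CV_gt0 : 0 < CV)
    (V_lower : \forall z \ae lebesgue R m k,
      CV / (1 + znorm z) `^ alpha <= V z)
    (Q_measurable : lebesgue_measurable Q)
    (CQ_gt0 : 0 < CQ)
    (Q_bounds : \forall z \ae lebesgue R m k,
      0 < Q z <= CQ / (1 + znorm z) `^ beta)
    (E_completion : is_energy_completion gamma V iota) :
  let N : R := (m + k)%:R in
  let pcrit : R := critical_exponent m k gamma in
  let pbar : \bar R := p_bar m k gamma alpha beta in
  let punder : \bar R := p_underline m k alpha beta in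
  let bunder : R := beta_underline m k gamma alpha in
  ([\/ [/\ alpha <= N, N < beta, 2 <= p & p <= pcrit],
       [/\ N <= alpha, alpha < beta, 2 <= p & (p%:E <= pbar)%E] |
       [/\ alpha <= N, bunder <= beta, beta < N, (punder <= p%:E)%E &
           p <= pcrit]] ->
   continuously_embedded gamma V Q p iota) /\
  ([\/ [/\ alpha <= N, N < beta, 2 <= p & p < pcrit] |
       [/\ N < alpha, alpha <= beta, 2 <= p & (p%:E < pbar)%E]] ->
   compactly_embedded gamma V Q p iota).
Proof.
move=> N pcrit pbar punder bunder.
have [N3 b2 _] := critical_exponent_bounds gamma_gt0 k_ge1 N_ge3.
rewrite -/N in N3; rewrite -/pcrit in b2.
pose w (z : 'rV[R]_m * 'rV[R]_k) : R := 1 + znorm z.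
have w1 z : 1 <= w z by rewrite lerDl znorm_ge0.
have wpow (C a : R) z : 0 < C -> 0 < C / w z `^ a.
  by move=> C0; rewrite divr_gt0// powR_gt0// (lt_le_trans _ (w1 z)).
(* The weights may be taken Borel, with their bounds valid everywhere. *)
have [V' [NV [mNV NV0 mV' V'low V'E]]] := @borel_modification _ _ _ _ V _
  (fun z x => CV / w z `^ alpha <= x) V_measurable (measurable_decay CV alpha)
  (fun z => lexx _) V_lower.
have Qref z : 0 < CQ / w z `^ beta <= CQ / w z `^ beta by rewrite lexx andbT wpow.
have [Q' [NQ [mNQ NQ0 mQ' Q'bd Q'E]]] := @borel_modification _ _ _ _ Q _
  (fun z x => 0 < x <= CQ / w z `^ beta) Q_measurable (measurable_decay CQ beta)
  Qref Q_bounds.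
have V'0 z : 0 < V' z by apply: lt_le_trans (V'low z); exact: wpow.
have V'ge0 z : 0 <= V' z by exact: ltW.
have Q'0 z : 0 < Q' z by case/andP: (Q'bd z).
have V'loc M : exists2 c : R, 0 < c &
    forall z : 'rV[R]_m * 'rV[R]_k, `|z| <= M -> c <= V' z.
  have [c c0 cP] := @decay_lower R m k CV alpha M CV_gt0.
  by exists c => // z zM; exact: le_trans (cP z zM) (V'low z).
pose D := CQ * (CV^-1 + 1).
have D0 : 0 < D by rewrite mulr_gt0// addr_gt0// invr_gt0.
have toQ z (a : R) : Q' z * a `^ p <= CQ * (a `^ p / w z `^ beta).
  rewrite [leRHS]mulrCA [leRHS]mulrC ler_wpM2r ?powR_ge0//.
  by case/andP: (Q'bd z).
have toV z (a : R) : CQ * (a ^+ 2 / w z `^ alpha + a `^ pcrit) <=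
    D * (V' z * a ^+ 2 + a `^ pcrit).
  rewrite /D -mulrA ler_wpM2l ?(ltW CQ_gt0)// mulrDl !mulrDr mul1r.
  have h : a ^+ 2 / w z `^ alpha <= CV^-1 * (V' z * a ^+ 2).
    rewrite mulrA mulrC ler_wpM2r ?sqr_ge0//.
    by rewrite ler_pdivlMl//; exact: V'low.
  have h1 : 0 <= V' z * a ^+ 2 by rewrite mulr_ge0 ?sqr_ge0.
  have h2 : 0 <= CV^-1 * a `^ pcrit by rewrite mulr_ge0 ?powR_ge0// invr_ge0 ltW.
  lra.
have young : above_segment m k gamma alpha beta p ->
    forall z (a : R), 0 <= a -> Q' z * a `^ p <= D * (V' z * a ^+ 2 + a `^ pcrit).
  move=> [p2 pb seg] z a a0; rewrite -/pcrit in pb seg.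
  have b20 : 0 < pcrit - 2 by rewrite subr_gt0.
  apply: le_trans (toQ z a) (le_trans _ (toV z a)).
  rewrite ler_wpM2l ?(ltW CQ_gt0)//.
  apply: (@weighted_young _ _ _ _ _ _ _ ((pcrit - p) / (pcrit - 2))) => //.
  - by lra.
  - by rewrite divr_ge0 ?subr_ge0 ?(ltW b2)//= ler_pdivrMr// mul1r lerD2l lerN2.
  - by field; rewrite gt_eqF.
have small : alpha < beta -> 0 < beta -> 2 <= p -> p < pcrit ->
    locally_small gamma V' Q' p.
  move=> ab beta0 p2 pb eps eps0.
  have [A [L [A0 AL]]] := weighted_small ab beta0 p2 pb (divr_gt0 eps0 D0).
  exists (CQ * A), L; split; first by rewrite mulr_ge0// ltW.
  move=> z a a0; apply: le_trans (toQ z a) _.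
  apply: le_trans (ler_wpM2l (ltW CQ_gt0) (AL (w z) a (w1 z) a0)) _.
  rewrite mulrDr; apply: lerD.
    rewrite mulrCA; apply: (le_trans (ler_wpM2l _ (toV z a))).
      by rewrite divr_ge0 ?ltW.
    by rewrite mulrA divfK// gt_eqF.
  rewrite mulrA ler_wpM2l ?mulr_ge0 ?(ltW CQ_gt0)//.
  case: ifPn => [wL|_]; last by rewrite mulr_ge0 ?sqr_ge0.
  rewrite indicE mem_set ?mul1r//= (le_trans (norm_le_znorm z))//.
  by apply: le_trans wL; rewrite lerDr.
have main : above_segment m k gamma alpha beta p ->
    exists2 J, is_continuous_embedding gamma V Q p iota J &
    locally_small gamma V' Q' p -> forall e : nat -> E,
      (exists M : R, forall n, `|e n| <= M) ->
      exists2 s : nat -> nat, {homo s : i j / (i < j)%N} &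
      exists2 g, LpQ Q p g &
        LpQ_norm Q p (fun z => J (e (s n)) z - g z) @[n --> \oo] --> 0%E.
  move=> seg; have [p2 _ _] := seg; have p0 : 0 < p by lra.
  have [iota_lin _ iota_dense] := E_completion.
  have dom0 : energy_domain gamma V (cst 0) by exact: (energy_domain0 gamma mNV NV0 V'E).
  have dom_lin (a : R) u v : energy_domain gamma V u -> energy_domain gamma V v ->
      energy_domain gamma V (fun z => a * u z + v z).
    exact: (energy_domain_lin mNV NV0 V'E mV' V'ge0).
  have dom_energy u : energy_domain gamma V u ->
      full_energy (@lebesgue_sf R m k) gamma V' u = (`|iota u| ^+ 2)%:E.
    exact: (energy_domain_norm mNV NV0 V'E V'ge0 E_completion).
  have [J [[mJ Jbd Jlin Jincl Jinj] Jcpt]] := @grushin_embedding R m k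
    (@lebesgue_sf R m k) (@lebesgue_shift R m k) (@lebesgue_bounded R m k) gamma
    gamma_gt0 m_ge1 N_ge3 (@lebesgue_box R m k gamma) V' Q' p mV' V'0 V'loc mQ' Q'0 p0
    (energy_domain gamma V) E iota dom0 dom_lin
    (fun u du => test_function_C1c du.1) iota_lin iota_dense dom_energy D (ltW D0) (young seg).
  have ipos : 0 < p^-1 by rewrite invr_gt0.
  exists J; first split.
  - move=> e; split; first exact: borel_lebesgue_measurable.
    rewrite (integral_mass p mNQ NQ0 Q'E); apply: (le_lt_trans (Jbd e)).
    exact: ltry.
  - exact: Jlin.
  - exact: Jincl.
  - exact: Jinj.
  - pose K := @embedding_cst R m k gamma D.
    have K0 : 0 <= K by apply: embedding_cst_ge0 => //; exact: ltW.
    exists (K `^ p^-1 * 2) => e.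
    apply: (le_trans (LpQ_norm_le mNQ NQ0 Q'E p0 Q'0 (Jbd e))).
    rewrite powRM ?powR_ge0// -powRrM mulfV ?gt_eqF// powRr1 ?mulr_ge0//.
    by rewrite mulrA.
  move=> sm e [M eM]; have [s shomo [g [mg goo gcvg]]] := Jcpt sm e M eM.
  exists s => //; exists g.
    split; first exact: borel_lebesgue_measurable.
    by rewrite (integral_mass p mNQ NQ0 Q'E).
  apply: (@squeeze_cvge _ _ _ _ (cst 0%E) _
    (fun n => ((3 `^ p * (2 * 2 ^- n)) `^ p^-1)%:E)).
  - apply: nearW => n; rewrite poweR_ge0/=.
    exact: (LpQ_norm_le mNQ NQ0 Q'E p0 Q'0 (gcvg n)).
  - exact: cvg_cst.
  apply: cvg_EFin; first exact: nearW.
  rewrite -[X in _ --> X](@powR0 R p^-1) ?gt_eqF//.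
  apply: cvg_powR => //.
  rewrite -(mulr0 (3 `^ p)); apply: cvgM; first exact: cvg_cst.
  rewrite -(mulr0 2); apply: cvgM; first exact: cvg_cst.
  under eq_fun do rewrite -exprVn.
  by apply: cvg_expr; rewrite ger0_norm ?invf_lt1 ?ltr1n ?invr_ge0.
have pbar_le : (p%:E <= pbar)%E -> p <= pcrit.
  by rewrite /pbar /p_bar le_min => /andP[_]; rewrite lee_fin.
split.
  move=> h; suff /main[J Jemb _] : above_segment m k gamma alpha beta p by exists J.
  case: h => [[aN Nb p2 pb]|[Na ab p2 /pbar_le pb]|[aN _ bN pu pb]].
  - by apply: above_segment_le => //; lra.
  - by apply: above_segment_le => //; lra.
  - exact: above_segment_lt.
move=> h.
have [ab beta0 p2 pb] : [/\ alpha < beta, 0 < beta, 2 <= p & p < pcrit].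
  case: h => [[aN Nb p2 pb]|[Na ab p2]]; first by split => //; lra.
  (* For [alpha = beta] the upper bound on [p] is [2]. *)
  rewrite /pbar /p_bar lt_min => /andP[pr]; rewrite lte_fin => pb.
  have aN0 : 0 < alpha - N by rewrite subr_gt0.
  move: pr; rewrite inver gt_eqF// -EFinM lte_fin ltr_pdivlMr// => pr.
  have h2 := ler_wpM2r (ltW aN0) p2.
  by split => //; lra.
have /main[J Jemb Jcpt] : above_segment m k gamma alpha beta p.
  by apply: above_segment_le => //; exact: ltW.
by exists J => //; apply: Jcpt; exact: small.
Qed.
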